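(* Let $X$ be a Banach space and let $Y$ be a Banach space with property $(\beta)$. If the Lindenstrauss theorem holds for $\mathcal{P}(^NX)$ (respectively $\mathcal{P}_k(X)$, $\mathcal{A}_u(X)$), then it also holds for $\mathcal{P}(^NX;Y)$ (respectively $\mathcal{P}_k(X;Y)$, $\mathcal{A}_u(X;Y)$). Here $N,k\in\mathbb{N}$.
   Context: Banach spaces are over $\mathbb{K}=\mathbb{R}$ or $\mathbb{C}$; in statements about $\mathcal{A}_u$ they are complex. $B_X$, $B_X^\circ$ are the closed and open unit balls of $X$. $\mathcal{P}(^NX;Y)$ is the Banach space of continuous $N$-homogeneous polynomials $P:X\to Y$, i.e. $P(x)=\Phi(x,\dots,x)$ with $\Phi:X^N\to Y$ continuous $N$-linear. $\mathcal{P}_k(X;Y)$ is the space of continuous polynomials of degree at most $k$, $P=\sum_{j=0}^kP_j$ with $P_j$ continuous $j$-homogeneous. $\mathcal{A}_u(X;Y)$ is the space of functions $f:B_X\to Y$ uniformly continuous on $B_X$ and holomorphic on $B_X^\circ$. All carry the norm $\|f\|=\sup_{x\in B_X}\|f(x)\|$. When $Y=\mathbb{K}$ it is omitted from the notation. Aron-Berner extension: for a continuous $j$-linear $\Phi:X^j\to Y$, its canonical extension $\overline{\Phi}:(X'')^j\to Y''$ is $\overline{\Phi}(x_1'',\dots,x_j'')=w^*\text{-}\lim_{\alpha_1}\cdots\lim_{\alpha_j}\Phi(x_{1,\alpha_1},\dots,x_{j,\alpha_j})$, where $(x_{i,\alpha_i})_{\alpha_i}\subset X$ is a net $w^*$-convergent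 to $x_i''$. For $P_j(x)=\Phi(x,\dots,x)$ with $\Phi$ symmetric, $\overline{P_j}(x'')=\overline{\Phi}(x'',\dots,x'')$ (and $\overline{P_0}=P_0$); for $P=\sum_{j=0}^kP_j$, $\overline{P}=\sum_{j=0}^k\overline{P_j}$. For $f\in\mathcal{A}_u(X;Y)$ with Taylor series $f=\sum_{j\ge0}P_j$ at $0$, $\overline{f}=\sum_{j\ge0}\overline{P_j}$ on $B_{X''}^\circ$, which extends to a uniformly continuous function on $B_{X''}$. $\overline{f}$ attains its norm if $\|\overline{f}(x_0'')\|=\sup_{x''\in B_{X''}}\|\overline{f}(x'')\|$ for some $x_0''\in B_{X''}$. ''The Lindenstrauss theorem holds for'' one of these spaces means: the set of its elements whose Aron-Berner extensions attain their norms is norm dense in the space. A Banach space $Y$ has property $(\beta)$ if there is a set $\{(y_\alpha,g_\alpha):\alpha\in\Lambda\}\subset Y\times Y'$ such that: (i) $\|y_\alpha\|=\|g_\alpha\|=g_\alpha(y_\alpha)=1$ for all $\alpha$; (ii) there is $0\le\lambda<1$ with $|g_\alpha(y_\beta)|\le\lambda$ for $\alpha\ne\beta$; (iii) $\|y\|=\sup_{\alpha\in\Lambda}|g_\alpha(y)|$ for all $y\in Y$. *)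

(* Defs.v *)
From HB Require Import structures.
From mathcomp Require Import all_boot all_order all_algebra perm.
From mathcomp Require Import complex.
From mathcomp Require Import all_classical all_reals.
From mathcomp Require Import topology normedtype sequences landau derive.

Set Implicit Arguments.
Unset Strict Implicit.
Unset Printing Implicit Defensive.

Import Order.TTheory GRing.Theory Num.Theory.
Import numFieldNormedType.Exports.

Local Open Scope classical_set_scope.
Local Open Scope ring_scope.

(* Norms over [K] take their values in [K].  For [K = R[i]] the order is partial
   ([x <= y] forces equal imaginary parts), so the suprema used below are least
   upper bounds of sets of nonnegative elements; the structure asserts that they
   exist.  Its instances are [R] and [R[i]] for [R : realType]. *)
HB.mixin Record NumField_isSupComplete K of Num.NumField K := {
  nneg_supremums : forall A : set K, A !=set0 -> has_ubound A ->
    (forall x, A x -> 0 <= x) -> supremums A !=set0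
}.

#[short(type="scalarFieldType")]
HB.structure Definition ScalarField :=
  {K of Num.NumField K & NumField_isSupComplete K}.

Section ScalarInstances.
Variable R : realType.

Lemma real_nneg_supremums (A : set R) : A !=set0 -> has_ubound A ->
  (forall x, A x -> 0 <= x) -> supremums A !=set0.
Proof.
move=> A0 ubA _; exists (sup A); split; first exact: sup_upper_bound.
by move=> y Ay; exact: ge_sup.
Qed.

#[non_forgetful_inheritance]
HB.instance Definition _ := NumField_isSupComplete.Build R real_nneg_supremums.

Lemma complex_nneg_supremums (A : set R[i]) : A !=set0 -> has_ubound A ->
  (forall x, A x -> 0 <= x) -> supremums A !=set0.
Proof.
move=> [a Aa] [M ubM] A_ge0.
have AE x : A x -> x = (complex.Re x)%:C%C.
  by move=> /A_ge0; rewrite lecE => /andP[/eqP /= x0 _]; case: x x0 => ? ? /= ->.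
have supA : has_sup (@complex.Re R @` A).
  split; first by exists (complex.Re a), a.
  exists (complex.Re M) => _ [x Ax <-].
  by have := ubM _ Ax; rewrite lecE => /andP[].
exists (sup (@complex.Re R @` A))%:C%C; split.
  move=> x Ax; rewrite (AE _ Ax) lecR.
  by apply: sup_upper_bound => //; exists x.
move=> y uby; have := uby _ Aa; rewrite lecE => /andP[/eqP yIm _].
rewrite lecE /= yIm (AE _ Aa) /= eqxx /=.
apply: ge_sup; first by exists (complex.Re a), a.
by move=> _ [x Ax <-]; have := uby _ Ax; rewrite lecE => /andP[].
Qed.

HB.instance Definition _ :=
  NumField_isSupComplete.Build R[i] complex_nneg_supremums.

End ScalarInstances.

Section SupNorm.
Variables (K : scalarFieldType) (X Y : normedModType K).
Implicit Types f : X -> Y.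

Definition sup_norm f : K :=
  supremum 0 [set `|f x| | x in [set x | `|x| <= 1]].

Lemma sup_norm_lub f (M : K) : (forall x, `|x| <= 1 -> `|f x| <= M) ->
  isLub [set `|f x| | x in [set x | `|x| <= 1]] (sup_norm f).
Proof.
move=> fM; set A := image _ _.
have A0 : A !=set0 by exists `|f 0|; exists 0 => //=; rewrite normr0.
have ubA : has_ubound A by exists M => _ [x x1 <-]; exact: fM.
have A_ge0 y : A y -> 0 <= y by move=> [x _ <-].
have [s As] := nneg_supremums _ A0 ubA A_ge0.
rewrite /sup_norm /supremum ifF; last by apply/negbTE/set0P.
by case: xgetP => [y -> //|/(_ s)/(_ As)].
Qed.

Lemma le_sup_norm f (M : K) : (forall x, `|x| <= 1 -> `|f x| <= M) ->
  forall x, `|x| <= 1 -> `|f x| <= sup_norm f.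
Proof. by move=> /sup_norm_lub[ub _] x x1; apply: ub; exists x. Qed.

Lemma sup_norm_le f (M : K) : (forall x, `|x| <= 1 -> `|f x| <= M) ->
  sup_norm f <= M.
Proof.
by move=> fM; apply: (sup_norm_lub fM).2 => _ [x x1 <-]; exact: fM.
Qed.

End SupNorm.

Section Dual.
Variables (K : scalarFieldType) (X : normedModType K).

Definition cont_linear : {pred X -> K^o} :=
  [pred f : X -> K^o | `[< linear f /\ continuous f >]].

Lemma cont_linearP (f : X -> K^o) :
  reflect (linear f /\ continuous f) (f \in cont_linear).
Proof. exact: asboolP. Qed.

Lemma cont_linear_submod : submod_closed cont_linear.
Proof.
split.
  apply/cont_linearP; split; last by move=> x; exact: cvg_cst.
  by move=> a x y /=; rewrite scaler0 addr0.
move=> a f g /cont_linearP[lf cf] /cont_linearP[lg cg].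
apply/cont_linearP; split.
  move=> b x y; change (a *: f (b *: x + y) + g (b *: x + y) =
    b *: (a *: f x + g x) + (a *: f y + g y)).
  by rewrite lf lg !scalerDr addrACA !scalerA (mulrC a).
move=> x; apply: (@cvgD K K^o X (nbhs x) _ (a *: f) g); last exact: cg.
by apply: cvgZl_tmp; exact: cf.
Qed.

HB.instance Definition _ :=
  GRing.isSubmodClosed.Build K (X -> K^o) cont_linear cont_linear_submod.

Record dual := Dual { dual_fun :> X -> K^o; _ : dual_fun \in cont_linear }.

HB.instance Definition _ := [isSub for dual_fun].
HB.instance Definition _ := [Choice of dual by <:].
HB.instance Definition _ := [SubChoice_isSubLmodule of dual by <:].

Lemma dual_linear (f : dual) : linear f.
Proof. by case: f => f /= /cont_linearP[]. Qed.

Lemma dual_continuous (f : dual) : continuous f.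
Proof. by case: f => f /= /cont_linearP[]. Qed.

HB.instance Definition _ (f : dual) :=
  GRing.isLinear.Build K X K^o *:%R (dual_fun f) (dual_linear f).

Lemma le_dual_norm_ball (f : dual) (x : X) : `|x| <= 1 -> `|f x| <= sup_norm f.
Proof.
have : bounded_near (f : {linear X -> K^o}) (nbhs (0 : X)).
  by apply/linear_bounded_continuous; exact: dual_continuous.
move=> /linear_boundedP /pinfty_ex_gt0 [M M0 fM].
apply: (@le_sup_norm K X K^o f M) => y y1; apply: le_trans (fM y) _.
by rewrite ler_piMr // ltW.
Qed.

Lemma le_dual_norm (f : dual) (x : X) : `|f x| <= sup_norm f * `|x|.
Proof.
have [->|x0] := eqVneq x 0; first by rewrite raddf0 !normr0 mulr0.
have nx0 : 0 < `|x| by rewrite normr_gt0.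
have := @le_dual_norm_ball f (`|x|^-1 *: x).
rewrite normfZV // lexx => /(_ isT).
by rewrite linearZ /= normrM ger0_norm ?invr_ge0 // ler_pdivrMl // mulrC.
Qed.

Lemma dual_ler_normD (f g : dual) :
  sup_norm (f + g : dual) <= sup_norm f + sup_norm g.
Proof.
apply: sup_norm_le => x x1; apply: le_trans (ler_normD _ _) _.
by apply: lerD; exact: le_dual_norm_ball.
Qed.

Lemma dual_norm_ge0 (f : dual) : 0 <= sup_norm f.
Proof.
by apply: le_trans (@le_dual_norm_ball f 0 _) => //; rewrite normr0.
Qed.

Lemma dual_normrZ (a : K) (f : dual) :
  sup_norm (a *: f : dual) = `|a| * sup_norm f.
Proof.
have le_scale (b : K) (g : dual) : sup_norm (b *: g : dual) <= `|b| * sup_norm g.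
  apply: sup_norm_le => x x1; rewrite -[(b *: g) x]/(b * g x) normrM.
  by apply: ler_wpM2l => //; exact: le_dual_norm_ball.
apply/eqP; rewrite eq_le le_scale andTb.
have [->|a0] := eqVneq a 0.
  by rewrite normr0 mul0r; exact: dual_norm_ge0.
have := le_scale a^-1 (a *: f).
by rewrite scalerK // normfV ler_pdivlMl // normr_gt0.
Qed.

Lemma dual_normr0_eq0 (f : dual) : sup_norm f = 0 -> f = 0.
Proof.
move=> f0; apply: val_inj; apply/funext => x; apply/normr0_eq0/eqP.
by rewrite -normr_le0 normr_id (le_trans (le_dual_norm f x)) // f0 mul0r.
Qed.

HB.instance Definition _ := Lmodule_isNormed.Build K dual
  dual_ler_normD dual_normrZ dual_normr0_eq0.

End Dual.

Notation bidual X := (dual (dual X)).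

Section Evaluation.
Variables (K : scalarFieldType) (X : normedModType K).

Lemma eval_cont_linear (x : X) :
  (fun phi : dual X => phi x) \in @cont_linear K (dual X).
Proof.
apply/cont_linearP; split=> [//|].
pose ev := fun phi : dual X => phi x : K^o.
have ev_linear : linear ev by [].
pose evl := GRing.isLinear.Build K (dual X) K^o *:%R ev ev_linear.
pose l : {linear dual X -> K^o} := HB.pack ev evl.
apply: (@bounded_linear_continuous K (dual X) K^o l).
apply/bounded_funP => r; exists (r * `|x|) => phi phir.
apply: le_trans (le_dual_norm phi x) _.
exact: ler_wpM2r.
Qed.

Definition evaluation (x : X) : bidual X := Dual (eval_cont_linear x).

End Evaluation.

Section Polynomials.
Variables (K : scalarFieldType) (X Y : normedModType K).
Implicit Types (j k N : nat) (P : X -> Y).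

Definition multilinear j (Phi : ('I_j -> X) -> Y) : Prop :=
  forall (x : 'I_j -> X) (i : 'I_j), linear (fun v => Phi (dfwith x i v)).

Definition cont_multilinear j (Phi : ('I_j -> X) -> Y) : Prop :=
  multilinear Phi /\
  continuous (Phi : prod_topology (fun _ : 'I_j => X) -> Y).

Definition symmetric_map j (Phi : ('I_j -> X) -> Y) : Prop :=
  forall (s : {perm 'I_j}) (x : 'I_j -> X), Phi (x \o s) = Phi x.

Definition homogeneous_poly N : set (X -> Y) :=
  [set P | exists2 Phi : ('I_N -> X) -> Y, cont_multilinear Phi &
    forall x, P x = Phi (fun=> x)].

Definition poly_deg_le k : set (X -> Y) :=
  [set P | exists2 p : nat -> X -> Y,
    forall j, (j <= k)%N -> homogeneous_poly j (p j) &
    forall x, P x = \sum_(j < k.+1) p j x].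

End Polynomials.

Definition uniformly_continuous_on_ball (K : scalarFieldType)
    (X Y : normedModType K) (f : X -> Y) : Prop :=
  forall e : K, 0 < e -> exists2 d : K, 0 < d &
    forall x y, `|x| <= 1 -> `|y| <= 1 -> `|x - y| < d -> `|f x - f y| < e.

(* A function on the closed unit ball is represented by an arbitrary extension to
   the whole space; its values outside the ball are never used.  For [K = R[i]],
   [differentiable] is complex Frechet differentiability. *)
Definition Au (K : scalarFieldType) (X Y : normedModType K) : set (X -> Y) :=
  [set f | uniformly_continuous_on_ball f /\
    forall x, `|x| < 1 -> differentiable f x].

Section AronBerner.
Variables (K : scalarFieldType) (X Y : normedModType K).

Definition wstar_cvg (E : normedModType K) (F : set_system (dual E))
    (l : dual E) : Prop :=
  forall v : E, (fun phi : dual E => phi v) @ F --> l v.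

Definition ocons j (x : X) (y : 'I_j -> X) : 'I_j.+1 -> X :=
  fun i => oapp y x (unlift ord0 i).

(* [iter_wstar_lim F psi l]: l is the iterated w*-limit of [psi], taken along
   [F ord_max] first (innermost) and along [F ord0] last. *)
Fixpoint iter_wstar_lim j : ('I_j -> set_system X) ->
    (('I_j -> X) -> bidual Y) -> bidual Y -> Prop :=
  match j with
  | 0 => fun _ psi l => forall x, psi x = l
  | j'.+1 => fun F psi l => exists2 h : X -> bidual Y,
      forall x, iter_wstar_lim (fun i => F (lift ord0 i))
                  (fun y => psi (ocons x y)) (h x) &
      wstar_cvg (h @ F ord0) l
  end.

(* Nets in [X] are given by their tail filters, i.e. by proper filters on [X]. *)
Definition canonical_extension j (Phi : ('I_j -> X) -> Y)
    (Phibar : ('I_j -> bidual X) -> bidual Y) : Prop :=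
  forall (x'' : 'I_j -> bidual X) (F : 'I_j -> set_system X),
    (forall i, ProperFilter (F i)) ->
    (forall i, wstar_cvg (evaluation (X := X) @ F i) (x'' i)) ->
    iter_wstar_lim F (fun x => evaluation (Phi x)) (Phibar x'').

Definition AB_homogeneous j (P : X -> Y) (Pbar : bidual X -> bidual Y) : Prop :=
  exists Phi : ('I_j -> X) -> Y, exists Phibar : ('I_j -> bidual X) -> bidual Y,
    [/\ cont_multilinear Phi, symmetric_map Phi,
        forall x, P x = Phi (fun=> x),
        canonical_extension Phi Phibar &
        forall x'', Pbar x'' = Phibar (fun=> x'')].

Definition AB_poly k (P : X -> Y) (Pbar : bidual X -> bidual Y) : Prop :=
  exists p : nat -> X -> Y, exists pbar : nat -> bidual X -> bidual Y,
    [/\ forall j, (j <= k)%N -> AB_homogeneous j (p j) (pbar j),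
        forall x, P x = \sum_(j < k.+1) p j x &
        forall x'', Pbar x'' = \sum_(j < k.+1) pbar j x''].

(* The homogeneous polynomials [p j] are determined by [f]: restricted to complex
   lines through 0 the expansion is a convergent power series. *)
Definition AB_Au (f : X -> Y) (fbar : bidual X -> bidual Y) : Prop :=
  exists p : nat -> X -> Y, exists pbar : nat -> bidual X -> bidual Y,
    [/\ forall j, AB_homogeneous j (p j) (pbar j),
        forall x, `|x| < 1 -> series (p ^~ x) @ \oo --> f x,
        forall x'', `|x''| < 1 -> series (pbar ^~ x'') @ \oo --> fbar x'' &
        uniformly_continuous_on_ball fbar].

End AronBerner.

Definition attains_norm (K : scalarFieldType) (X Y : normedModType K)
    (f : X -> Y) : Prop :=
  exists2 x0 : X, `|x0| <= 1 & `|f x0| = sup_norm f.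

Section Lindenstrauss.
Variables (K : scalarFieldType) (X Y : normedModType K).

Definition lindenstrauss_for (S : set (X -> Y))
    (AB : (X -> Y) -> (bidual X -> bidual Y) -> Prop) : Prop :=
  forall f, S f -> forall e : K, 0 < e ->
    exists g, [/\ S g, exists2 gbar, AB g gbar & attains_norm gbar &
                  sup_norm (f - g) < e].

Definition lindenstrauss_homogeneous (N : nat) : Prop :=
  lindenstrauss_for (@homogeneous_poly K X Y N) (@AB_homogeneous K X Y N).

Definition lindenstrauss_poly (k : nat) : Prop :=
  lindenstrauss_for (@poly_deg_le K X Y k) (@AB_poly K X Y k).

Definition lindenstrauss_Au : Prop :=
  lindenstrauss_for (@Au K X Y) (@AB_Au K X Y).

End Lindenstrauss.

Definition property_beta (K : scalarFieldType) (Y : normedModType K) : Prop :=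
  exists (L : Type) (y : L -> Y) (g : L -> dual Y),
    [/\ forall a, [/\ `|y a| = 1, `|g a| = 1 & g a (y a) = 1],
        exists2 lam : K, 0 <= lam < 1 &
          forall a b, a <> b -> `|g a (y b)| <= lam &
        forall z : Y, `|z| = supremum 0 (range (fun a => `|g a z| : K))].

(* Main.v *)
(* Let [f] be given, choose a functional [g a] of the family defining property (beta)
   for which [g a o f] almost has the norm of [f], and let [p] be a scalar
   approximation of [g a o f] whose Aron-Berner extension attains its norm at [u0].
   Then [Q = f + ((1 + eta) p - g a o f) y_a] is close to [f]; since [lam < 1], all
   [g b o Q] with [b <> a] are dominated by [g a o Q = (1 + eta) p], and the
   extension of [Q] attains its norm at [u0].

   The equality of the norms of [Q] and of its extension is the theorem of Davie and
   Gamelin.  It is proved by walking from [u] in the ball of the bidual to a point of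
   [X] in [n] steps [w -> w + (z - u) / n]: if [z] in the ball of [X] is such that the
   derivative of the polynomial at [w] almost agrees at [z] and [u], each step costs
   O(1 / n ^ 2).  Only one functional is tested at each step, so the full strength of
   Goldstine's theorem is not needed.

   For [A_u], no Cauchy theory for vector-valued functions is used.  The hypothesis
   that the scalar theorem holds approximates each [g a o f] uniformly by functions
   with a power series expansion.  Averages of [f] over roots of unity converge,
   uniformly in [a], to the coefficients of these expansions, and this yields the
   Taylor series of [f] itself by polarization. *)

From HB Require Import structures.
Require Import Defs.
From mathcomp Require Import all_boot all_order all_algebra perm.
From mathcomp Require Import complex separable cyclic cyclotomic.
From mathcomp Require Import all_classical all_reals.
From mathcomp Require Import topology normedtype sequences landau derive.
From mathcomp Require Import ring.

Set Implicit Arguments.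
Unset Strict Implicit.
Unset Printing Implicit Defensive.

Import Order.TTheory GRing.Theory Num.Theory.
Import numFieldNormedType.Exports.

Local Open Scope classical_set_scope.
Local Open Scope ring_scope.

(** * Scalars and dual spaces *)


(** An extension is given as a relation over all w*-convergent nets, which cannot be computed with.
    It is replaced by the recursive formula [form_ext]: extending one variable means applying an
    element of the bidual to the functional in that variable. Uniqueness of iterated limits, along
    filters known to converge, identifies the two. The walk never leaves the span of [X] and the
    single element [u], where symmetry persists. Its direction enters through the first argument,
    the outermost one in [form_ext], so the derivative is w*-continuous and is given by one
    functional on [X]. For A_u the same bound, applied to differences of polynomials, makes the
    extensions of approximating polynomials uniformly Cauchy on the ball of the bidual; their limit
    is the required extension. *)

Section Scalars.
Variable K : scalarFieldType.
Implicit Types (x y e : K).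

(** If the natural numbers were bounded, their supremum [s] would make [s - 1] another upper bound.
    The supremum axiom of the structure is thus enough for the Archimedean property. *)
Lemma scalar_archi x : exists n : nat, `|x| < n%:R.
Proof.
apply: contrapT => /forallNP Nn.
pose A := range (fun n : nat => n%:R : K).
have A0 : A !=set0 by exists 0, 0%N.
have leA n : n%:R <= `|x|.
  by have /negP := Nn n; rewrite -real_leNgt ?realn // normr_real.
have ubA : has_ubound A by exists `|x| => _ [n _ <-].
have [s [ubs lbs]] : supremums A !=set0.
  by apply: nneg_supremums => // _ [n _ <-]; exact: ler0n.
have /lbs : ubound A (s - 1).
  move=> _ [n _ <-]; rewrite lerBrDr natr1; apply: ubs; by exists n.+1.
by rewrite -subr_ge0 addrAC subrr add0r oppr_ge0 ler10.
Qed.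

Lemma scalar_invS_lt e : 0 < e -> exists n : nat, forall m, (n <= m)%N -> (m.+1%:R^-1 < e).
Proof.
move=> e0; have [n ne] := scalar_archi e^-1.
exists n => m nm; rewrite -(invrK e) ltf_pV2 ?posrE ?invr_gt0 ?ltr0Sn//.
rewrite -[e^-1]ger0_norm ?invr_ge0 ?ltW//; apply: lt_le_trans ne _.
by rewrite ler_nat leqW.
Qed.

(** Bernoulli's inequality for [r^-1] makes [r^-1 ^+ m] exceed [C / e]. *)
Lemma scalar_expr_lt (r C : K) e : 0 <= r < 1 -> 0 <= C -> 0 < e ->
  exists n : nat, forall m, (n <= m)%N -> C * r ^+ m < e.
Proof.
move=> /andP[r0 r1] C0 e0.
have [->|rn0] := eqVneq r 0.
  exists 1%N => -[//|m] _; by rewrite expr0n mulr0.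
have rgt0 : 0 < r by rewrite lt_def rn0.
have h0 : 0 < r^-1 - 1 by rewrite subr_gt0 -[ltLHS]invr1 ltf_pV2 ?posrE.
have bern (n : nat) : 1 + n%:R * (r^-1 - 1) <= r^-1 ^+ n.
  elim: n => [|n IH]; first by rewrite mul0r addr0 expr0.
  rewrite exprS; apply: le_trans (ler_wpM2l _ IH); last by rewrite invr_ge0.
  rewrite -subr_ge0 (_ : _ - _ = n%:R * (r^-1 - 1) ^+ 2).
    by rewrite mulr_ge0 // exprn_ge0 // ltW.
  by rewrite -natr1; ring.
have [n nC] := scalar_archi (C / e / (r^-1 - 1)).
exists n => m nm.
have : C / e < r^-1 ^+ m.
  apply: lt_le_trans (bern m); apply: ltr_wpDl => //.
  rewrite -ltr_pdivrMr //; apply: le_lt_trans (lt_le_trans nC _).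
    by rewrite ger0_norm // divr_ge0 ?divr_ge0 // ltW.
  by rewrite ler_nat.
by rewrite exprVn ltr_pdivrMr // mulrC ltr_pdivlMr ?exprn_gt0.
Qed.

(** Stands in for a minimum: the order of [K] is only partial, and [x * y / (x + y)] lies below both
    numbers without any comparison of them. *)
Lemma pos_common_lb x y : 0 < x -> 0 < y -> exists d, [/\ 0 < d, d <= x & d <= y].
Proof.
move=> x0 y0; exists (x * y / (x + y)).
have xy0 : 0 < x + y by rewrite addr_gt0.
split; first by rewrite divr_gt0 // mulr_gt0.
  by rewrite ler_pdivrMr // ler_wpM2l ?ltW // ltrDr.
by rewrite ler_pdivrMr // mulrC ler_wpM2l ?ltW // ltrDl.
Qed.

Lemma forall_pos_le0 x : 0 <= x -> (forall e, 0 < e -> x <= e) -> x = 0.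
Proof.
move=> x0 xe; apply/eqP; rewrite eq_le x0 andbT.
by apply/ler_addgt0Pr => e e0; rewrite add0r xe.
Qed.

End Scalars.

Section SupNormTheory.
Variables (K : scalarFieldType) (X Y : normedModType K).
Implicit Types f : X -> Y.

Definition bounded_on_ball f := exists M : K, forall x, `|x| <= 1 -> `|f x| <= M.

Lemma bounded_on_ball_ge0 f (M : K) : (forall x, `|x| <= 1 -> `|f x| <= M) -> 0 <= M.
Proof. by move=> /(_ 0); rewrite normr0 ler01 => /(_ isT); exact: le_trans. Qed.

Lemma sup_norm_ge f x : bounded_on_ball f -> `|x| <= 1 -> `|f x| <= sup_norm f.
Proof. by move=> [M fM]; exact: le_sup_norm fM x. Qed.

Lemma sup_norm_ge0 f : bounded_on_ball f -> 0 <= sup_norm f.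
Proof. by move=> bf; apply: le_trans (sup_norm_ge bf (x := 0) _) => //; rewrite normr0. Qed.

Lemma sup_norm_gt f (c : K) : bounded_on_ball f -> c < sup_norm f ->
  exists2 x, `|x| <= 1 & c < `|f x|.
Proof.
move=> bf cf; apply: contrapT => Nx.
(* An element comparable to a nonnegative one is real; only then does the failure of a strict
   inequality give the reverse one. *)
have cr : c \is Num.real.
  by rewrite -(ger_real (ltW cf)) ger0_real // sup_norm_ge0.
have : sup_norm f <= c.
  apply: sup_norm_le => x x1; rewrite real_leNgt ?normr_real //.
  by apply/negP => cx; apply: Nx; exists x.
by move=> /(lt_le_trans cf); rewrite ltxx.
Qed.

End SupNormTheory.

Section DualTheory.
Variables (K : scalarFieldType) (X : normedModType K).

Lemma bounded_linear_in_dual (f : X -> K^o) (C : K) :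
  linear f -> (forall x, `|f x| <= C * `|x|) -> f \in @cont_linear K X.
Proof.
move=> lf fC; apply/cont_linearP; split=> //.
pose evl := GRing.isLinear.Build K X K^o *:%R f lf.
pose l : {linear X -> K^o} := HB.pack f evl.
apply: (@bounded_linear_continuous K X K^o l).
apply/bounded_funP => r; exists (`|C| * `|r|) => x xr.
apply: le_trans (fC x) _; apply: (@le_trans _ _ `|C * `|x| |).
  by apply: real_ler_norm; rewrite ger0_real // (le_trans _ (fC x)).
rewrite normrM normr_id ler_wpM2l //; apply: (le_trans xr).
by apply: real_ler_norm; rewrite ger0_real // (le_trans _ xr).
Qed.

(** A map that is not continuous and linear is sent to 0. This totality allows [form_ext] to be a
    plain recursion, defined before its intermediate functionals are known to be linear and
    bounded. *)
Definition to_dual (f : X -> K^o) : dual X := insubd 0 f.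

Lemma to_dualE (f : X -> K^o) (C : K) :
  linear f -> (forall x, `|f x| <= C * `|x|) -> forall x, to_dual f x = f x.
Proof.
move=> lf fC x; rewrite -[LHS]/((val (insubd (0 : dual X) f)) x) insubdK //.
exact: bounded_linear_in_dual fC.
Qed.

Lemma dual_norm_le (f : dual X) (C : K) : 0 <= C ->
  (forall x, `|f x| <= C * `|x|) -> `|f| <= C.
Proof.
move=> C0 fC; apply: sup_norm_le => x x1; apply: le_trans (fC x) _.
by rewrite ler_piMr.
Qed.

Lemma le_dual_normM (f : dual X) (x : X) : `|f x| <= `|f| * `|x|.
Proof. exact: le_dual_norm. Qed.

Lemma dual_ext (f g : dual X) : (forall x, f x = g x) -> f = g.
Proof. by move=> fg; apply: val_inj; apply/funext. Qed.

Lemma dual_mapZ (f : dual X) a x : f (a *: x) = a * f x.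
Proof. by rewrite linearZ. Qed.

Lemma dual_mapD (f : dual X) x y : f (x + y) = f x + f y.
Proof. by rewrite raddfD. Qed.

Lemma dual_addE (f g : dual X) x : (f + g) x = f x + g x. Proof. by []. Qed.

Lemma dual_scaleE (a : K) (f : dual X) x : (a *: f) x = a * f x. Proof. by []. Qed.

Lemma dual_subE (f g : dual X) x : (f - g) x = f x - g x. Proof. by []. Qed.

Lemma dual_mapB (f : dual X) x y : f (x - y) = f x - f y.
Proof. by rewrite raddfB. Qed.

Lemma dual_map0 (f : dual X) : f 0 = 0.
Proof. by rewrite raddf0. Qed.

Lemma dual_map_sum (f : dual X) (I : Type) (r : seq I) (P : pred I) (F : I -> X) :
  f (\sum_(i <- r | P i) F i) = \sum_(i <- r | P i) f (F i).
Proof. by rewrite raddf_sum. Qed.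

Lemma dual_sumE (I : Type) (r : seq I) (P : pred I) (F : I -> dual X) x :
  (\sum_(i <- r | P i) F i) x = \sum_(i <- r | P i) F i x.
Proof. by elim/big_rec2: _ => // i a b _ <-. Qed.

Lemma dual_bounded (f : dual X) : bounded_on_ball (f : X -> K^o).
Proof. by exists (sup_norm f) => x; exact: le_dual_norm_ball. Qed.

End DualTheory.

Section BidualTheory.
Variables (K : scalarFieldType) (X : normedModType K).

Lemma evaluationE (x : X) (f : dual X) : evaluation x f = f x. Proof. by []. Qed.

Lemma le_norm_evaluation (x : X) : `|evaluation x| <= `|x|.
Proof. by apply: dual_norm_le => // f; rewrite evaluationE mulrC; exact: le_dual_normM. Qed.

Lemma evaluation_linear : linear (@evaluation K X).
Proof. by move=> a x y; apply: dual_ext => f; rewrite evaluationE linearP. Qed.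

(* Goldstine's theorem for a single functional. *)
Lemma ball_approx_bidual (f : dual X) (u : bidual X) (e : K) :
  `|u| <= 1 -> 0 < e -> exists2 z : X, `|z| <= 1 & `|f z - u f| <= e.
Proof.
move=> u1 e0.
have uf : `|u f| <= `|f|.
  by apply: le_trans (le_dual_normM u f) _; rewrite ler_piMl.
have [uf0|ufn0] := eqVneq (u f) 0.
  by exists 0; rewrite ?normr0 // uf0 raddf0 subrr normr0 ltW.
have [z z1 fz] : exists2 z : X, `|z| <= 1 & `|f| - e < `|f z|.
  by apply: (sup_norm_gt (dual_bounded f)); rewrite ltrBlDr ltrDl.
(* If [|u f| <= |f z|], shrinking [z] by the factor [u f / f z] gives the exact value. *)
have [ufz|fzu] := real_leP (normr_real (u f)) (normr_real (f z)).
  have fz0 : f z != 0 by rewrite -normr_gt0 (lt_le_trans _ ufz) // normr_gt0.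
  exists ((u f / f z) *: z); last by rewrite dual_mapZ divfK // subrr normr0 ltW.
  rewrite normrZ normrM normfV mulr_ile1 // ?mulr_ge0 ?invr_ge0 //.
  by rewrite ler_pdivrMr ?normr_gt0 // mul1r.
(* Here [|f| - e < |f z| < |u f| <= |f|], so the moduli are within [e] already and it suffices to
   rotate [z] until [f z] has the phase of [u f]. *)
exists ((u f / `|u f| * (`|f z| / f z)) *: z).
  rewrite normrZ !normrM !normfV !normr_id mulr_ile1 ?mulr_ge0 ?invr_ge0 //.
  rewrite divff ?normr_eq0 // mul1r.
  by have [->|?] := eqVneq (f z) 0; rewrite ?normr0 ?mul0r // divff ?normr_eq0.
rewrite dual_mapZ.
have -> : u f / `|u f| * (`|f z| / f z) * f z - u f =
    u f / `|u f| * (`|f z| - `|u f|).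
  rewrite mulrBr; congr (_ - _); last by rewrite divfK ?normr_eq0.
  have [->|?] := eqVneq (f z) 0; first by rewrite normr0 !mulr0.
  by rewrite -mulrA divfK.
rewrite normrM normf_div normr_id divff ?normr_eq0 // mul1r distrC.
rewrite ger0_norm; last by rewrite subr_ge0 ltW.
rewrite ltW // ltrBlDr; apply: le_lt_trans uf _.
by rewrite addrC -ltrBlDr.
Qed.

End BidualTheory.

(** * Multilinear forms on lists *)


Section ListForms.
Variables (K : scalarFieldType) (V W : normedModType K).
Implicit Types (F : seq V -> W) (l : seq V) (j : nat) (C : K).

(* A j-linear map is handled as a function on lists, only the lists of size [j]
   being relevant; fixing the first argument is then precomposition with
   [cons x]. *)
Definition form_linear j F := forall l1 l2 a x y, (size l1 + size l2).+1 = j ->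
  F (l1 ++ (a *: x + y) :: l2) = a *: F (l1 ++ x :: l2) + F (l1 ++ y :: l2).

Definition form_bounded j C F := forall l, size l = j ->
  `|F l| <= C * \prod_(x <- l) `|x|.

(** Symmetry in adjacent entries, relative to a set [E] of admissible entries: [E] is everything for
    forms on [X], but only a subspace for their extensions to the bidual. *)
Definition form_swap (E : set V) j F := forall l1 l2 a b,
  (size l1 + size l2).+2 = j -> E a -> E b -> (forall x, x \in l1 -> E x) ->
  (forall x, x \in l2 -> E x) ->
  F (l1 ++ a :: b :: l2) = F (l1 ++ b :: a :: l2).

Lemma form_linear_cons j F x : form_linear j.+1 F ->
  form_linear j (fun l => F (x :: l)).
Proof. by move=> lF l1 l2 a y z lj; rewrite -!cat_cons lF //= addSn lj. Qed.

Lemma form_bounded_cons j C F x : form_bounded j.+1 C F ->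
  form_bounded j (C * `|x|) (fun l => F (x :: l)).
Proof.
move=> bF l lj; have /bF : size (x :: l) = j.+1 by rewrite /= lj.
by rewrite big_cons mulrA.
Qed.

Lemma form_swap_cons E j F x : E x -> form_swap E j.+1 F ->
  form_swap E j (fun l => F (x :: l)).
Proof.
move=> Ex sF l1 l2 a b lj Ea Eb E1 E2; rewrite -!cat_cons sF //= ?addSn ?lj //.
by move=> y; rewrite in_cons => /orP[/eqP ->//|/E1].
Qed.

Lemma form_linear0D j F l x y : form_linear j F -> (size l).+1 = j ->
  F ((x + y) :: l) = F (x :: l) + F (y :: l).
Proof. by move=> lF lj; have := lF [::] l 1 x y lj; rewrite /= !scale1r. Qed.

Lemma form_linear0Z j F l a x : form_linear j F -> (size l).+1 = j ->
  F ((a *: x) :: l) = a *: F (x :: l).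
Proof.
move=> lF lj; have F0 : F (0 :: l) = 0.
  have := form_linear0D 0 0 lF lj; rewrite addr0 => /eqP.
  by rewrite -subr_eq0 opprD addNKr oppr_eq0 => /eqP.
by have := lF [::] l a x 0 lj; rewrite /= addr0 F0 addr0.
Qed.

Lemma form_linear0B j F l x y : form_linear j F -> (size l).+1 = j ->
  F ((x - y) :: l) = F (x :: l) - F (y :: l).
Proof.
move=> lF lj; rewrite (form_linear0D _ _ lF lj) -[- y]scaleN1r.
by rewrite (form_linear0Z _ _ lF lj) scaleN1r.
Qed.

Lemma form_linear_00 j F l : form_linear j F -> (size l).+1 = j -> F (0 :: l) = 0.
Proof.
by move=> lF lj; rewrite -[0 in LHS](scale0r (0 : V)) (form_linear0Z _ _ lF lj) scale0r.
Qed.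

Lemma form_linear_map_scale j F l k : form_linear j F -> size l = j ->
  F [seq k *: x | x <- l] = k ^+ j *: F l.
Proof.
elim: l j F => [|x l IH] [|j] F lF //= lj; first by rewrite expr0 scale1r.
rewrite (form_linear0Z _ _ lF) ?size_map //.
case: lj => lj; rewrite (IH j (fun l => F (x :: l))) ?scalerA ?exprS //.
exact: form_linear_cons.
Qed.

Lemma form_bounded_ball j C F : form_linear j F ->
  (forall l, size l = j -> (forall x, x \in l -> `|x| <= 1) -> `|F l| <= C) ->
  form_bounded j C F.
Proof.
move=> lF FC l; elim: l j F lF FC => [|x l IH] [//|j] F lF FC //= lj.
  by rewrite big_nil mulr1 FC.
rewrite big_cons; have [->|xn0] := eqVneq x 0.
  by rewrite (form_linear_00 lF) // !normr0 mul0r mulr0.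
have nx0 : 0 < `|x| by rewrite normr_gt0.
have -> : x = `|x| *: (`|x|^-1 *: x) by rewrite scalerA divff ?scale1r ?gt_eqF.
rewrite (form_linear0Z _ _ lF) // !normrZ normr_id normfV normr_id.
rewrite mulVf ?gt_eqF // mulr1 mulrCA ler_pM2l //.
case: lj => lj; apply: (IH j (fun l => F (`|x|^-1 *: x :: l))) => //; first exact: form_linear_cons.
move=> l' lj' l'1; apply: FC; first by rewrite /= lj'.
move=> y; rewrite in_cons => /orP[/eqP ->|/l'1//].
by rewrite normfZV.
Qed.

Lemma prod_norm_le l (B : K) : (forall x, x \in l -> `|x| <= B) ->
  \prod_(x <- l) `|x| <= B ^+ size l.
Proof.
elim: l => [|x l IH] lB; first by rewrite big_nil expr0.
rewrite big_cons exprS ler_pM //; first exact: prodr_ge0.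
  by apply: lB; rewrite mem_head.
by apply: IH => y yl; apply: lB; rewrite in_cons yl orbT.
Qed.

Lemma form_bounded_le j C F l (B : K) : 0 <= C -> form_bounded j C F -> size l = j ->
  (forall x, x \in l -> `|x| <= B) -> `|F l| <= C * B ^+ j.
Proof.
move=> C0 bF lj lB; apply: le_trans (bF l lj) _.
by rewrite ler_wpM2l // -lj prod_norm_le.
Qed.

(** Entries are exchanged one at a time. An exchange costs [C * d * B ^+ j.-1]; since [1 <= B], the
    power [B ^+ j] serves for all degrees in the induction. *)
Lemma form_lipschitz j C F (B d : K) l l' : 0 <= C -> 0 <= d -> 1 <= B ->
  form_linear j F -> form_bounded j C F -> size l = j -> size l' = j ->
  (forall x, x \in l -> `|x| <= B) -> (forall x, x \in l' -> `|x| <= B) ->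
  (forall i, `|nth 0 l' i - nth 0 l i| <= d) ->
  `|F l' - F l| <= j%:R * C * B ^+ j * d.
Proof.
move=> C0 d0 B1; elim: l l' j C C0 F => [|x l IH] [|x' l'] [|j] // C C0 F lF bF.
  by move=> _ _ _ _ _; rewrite subrr normr0 !mul0r.
move=> [lj] [lj'] lB lB' ll'.
have -> : F (x' :: l') - F (x :: l) =
    (F (x' :: l') - F (x' :: l)) + F ((x' - x) :: l).
  by rewrite (form_linear0B _ _ lF) ?lj // addrA subrK.
have x'B : `|x'| <= B by apply: lB'; rewrite mem_head.
have B0 : 0 <= B by apply: le_trans B1.
have lB1 y : y \in l -> `|y| <= B by move=> yl; apply: lB; rewrite in_cons yl orbT.
apply: le_trans (ler_normD _ _) _.
have -> : j.+1%:R * C * B ^+ j.+1 * d =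
    j%:R * (C * B) * B ^+ j * d + C * B ^+ j.+1 * d.
  by rewrite exprS -natr1; ring.
apply: lerD.
  have h1 : `|F (x' :: l') - F (x' :: l)| <= j%:R * (C * `|x'|) * B ^+ j * d.
    apply: (IH l' j (C * `|x'|) _ (fun l => F (x' :: l))) => //.
    - by rewrite mulr_ge0.
    - exact: form_linear_cons.
    - exact: form_bounded_cons.
    - by move=> y yl; apply: lB'; rewrite in_cons yl orbT.
    - by move=> i; have := ll' i.+1.
  apply: le_trans h1 _; rewrite !ler_wpM2r ?exprn_ge0 // ler_wpM2l //.
  by rewrite ler_wpM2l.
have bF' := @form_bounded_cons j C F (x' - x) bF.
apply: le_trans (form_bounded_le _ bF' lj lB1) _; first by rewrite mulr_ge0.
have -> : C * B ^+ j.+1 * d = C * d * B ^+ j * B by rewrite exprS; ring.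
apply: le_trans (ler_peMr _ B1); last by rewrite !mulr_ge0 ?exprn_ge0.
by rewrite ler_wpM2r ?exprn_ge0 // ler_wpM2l //; exact: (ll' 0%N).
Qed.

Lemma form_diag_lipschitz j C F x y : 0 <= C -> form_linear j F -> form_bounded j C F ->
  `|x| <= 1 -> `|y| <= 1 -> `|F (nseq j y) - F (nseq j x)| <= j%:R * C * `|y - x|.
Proof.
move=> C0 lF bF x1 y1.
have := @form_lipschitz j C F 1 `|y - x| (nseq j x) (nseq j y) C0.
rewrite expr1n mulr1; apply; rewrite ?size_nseq //.
- by move=> z /nseqP[->].
- by move=> z /nseqP[->].
- move=> i; rewrite !nth_nseq; case: ifP => // _.
  by rewrite subrr normr0.
Qed.

(** Second-order Taylor estimate. Freezing the first entry at [w + h] lowers the degree by one;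
    symmetry serves to exchange [w + h] and [h] in the first two places. The constant [j ^ 2] is
    chosen for the induction, where [(j + 1) ^ 2 + (j + 1) <= (j + 2) ^ 2] is used. *)
Lemma form_diag_taylor (E : set V) j C F w h : 0 <= C ->
  form_linear j F -> form_bounded j C F -> form_swap E j F ->
  E w -> E h -> E (w + h) -> `|w| <= 1 -> `|w + h| <= 1 ->
  `|F (nseq j (w + h)) - F (nseq j w) - j%:R *: F (h :: nseq j.-1 w)|
    <= j%:R ^+ 2 * C * `|h| ^+ 2.
Proof.
move=> C0 lF bF sF Ew Eh Ewh w1 wh1.
elim: j C C0 F lF bF sF => [|j IH] C C0 F lF bF sF.
  by rewrite /= subrr scale0r subr0 normr0 expr0n /= !mul0r.
case: j IH lF bF sF => [|j] IH lF bF sF.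
  rewrite /= scale1r (form_linear0D _ _ lF) // addrAC addrK subrr normr0.
  by rewrite mulr_ge0 // ?exprn_ge0 // mulr_ge0 // exprn_ge0.
pose G l := F ((w + h) :: l).
have C1 : 0 <= C * `|w + h| by rewrite mulr_ge0.
have := IH _ C1 G (form_linear_cons (w + h) lF) (form_bounded_cons (w + h) bF)
  (form_swap_cons Ewh sF).
rewrite /= {IH} => IH.
have sz : (size (w :: nseq j w)).+1 = j.+2 by rewrite /= size_nseq.
have GhE : G (h :: nseq j w) = F (h :: w :: nseq j w) + F (h :: h :: nseq j w).
  rewrite /G (sF [::]) ?size_nseq //=; last by move=> z /nseqP[->].
  by apply: (form_linear0D _ _ (form_linear_cons h lF)); rewrite size_nseq.
have FE : F [:: w + h, w & nseq j w] = F [:: w, w & nseq j w] + F [:: h, w & nseq j w].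
  by rewrite (form_linear0D _ _ lF).
set X := G _ in IH.
rewrite -[X in `|X - _ - _|]/X.
set A := G (w :: _) in IH; have AE : A = F [:: w, w & nseq j w] + F [:: h, w & nseq j w] by [].
rewrite GhE in IH.
set B := F [:: h, w & _] in IH AE FE GhE *.
set D := F [:: h, h & _] in IH GhE *.
(* The linear part of [G] along [h] is [B + D] instead of [B]; the surplus [D] is quadratic in
   [h]. *)
have -> : X - F [:: w, w & nseq j w] - j.+2%:R *: B =
    (X - A - j.+1%:R *: (B + D)) + j.+1%:R *: D.
  rewrite AE scalerDr -[j.+2%:R]natr1 scalerDl scale1r !opprD !addrA.
  by rewrite -!addrA; congr (_ + (_ + _)); rewrite [RHS]addrCA addNr addr0 addrC.
apply: le_trans (ler_normD _ _) _.
have hD : `|D| <= C * `|h| ^+ 2.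
  have /bF : size [:: h, h & nseq j w] = j.+2 by rewrite /= size_nseq.
  move=> /le_trans; apply; rewrite !big_cons ler_wpM2l // mulrA -expr2.
  rewrite ler_piMr ?exprn_ge0 //.
  have := @prod_norm_le (nseq j w) 1; rewrite expr1n; apply.
  by move=> z /nseqP[->].
apply: (@le_trans _ _ (j.+1%:R ^+ 2 * C * `|h| ^+ 2 + j.+1%:R * (C * `|h| ^+ 2))).
  apply: lerD.
    apply: le_trans IH _; rewrite ler_wpM2r ?exprn_ge0 // ler_wpM2l ?exprn_ge0 //.
    by rewrite ler_piMr.
  by rewrite normrZ ger0_norm // ler_wpM2l.
rewrite -subr_ge0 (_ : _ - _ = j.+2%:R * (C * `|h| ^+ 2)).
  by rewrite mulr_ge0 // mulr_ge0 // exprn_ge0.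
by rewrite -[j.+2%:R]natr1; ring.
Qed.

End ListForms.

(** * Extension of forms to the bidual *)


Section FormExtension.
Variables (K : scalarFieldType) (X : normedModType K).
Implicit Types (F G : seq X -> K^o) (s : seq (bidual X)) (j : nat) (C : K).

(** The iterated w*-limit without nets. The head of the list is applied last, so it corresponds to
    the outermost limit, in agreement with [iter_wstar_lim]. *)
Fixpoint form_ext F s {struct s} : K^o :=
  match s with
  | [::] => F [::]
  | u :: s' => u (to_dual (fun x => form_ext (fun l => F (x :: l)) s'))
  end.

Lemma form_ext_eq j F G s : size s = j ->
  (forall l, size l = j -> F l = G l) -> form_ext F s = form_ext G s.
Proof.
elim: s j F G => [|u s IH] [|j] F G //= sj FG; first exact: FG.
congr (u (to_dual _)); apply/funext => x.
by apply: (IH j) => [|l lj]; [case: sj | apply: FG; rewrite /= lj].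
Qed.

(** The bound and the linearity in [F] need a common induction: both are required on the tail for
    the argument of [to_dual] to belong to the dual, as otherwise [to_dual] would return 0. *)
Lemma form_ext_bound_lin j F C s : size s = j -> 0 <= C ->
  form_linear j F -> form_bounded j C F ->
  `|form_ext F s| <= C * \prod_(u <- s) `|u| /\
  forall G D a, 0 <= D -> form_linear j G -> form_bounded j D G ->
    form_ext (fun l => a *: F l + G l) s = a *: form_ext F s + form_ext G s.
Proof.
elim: s j F C => [|u s IH] [|j] F C // sj C0 lF bF.
  by split=> //=; have := bF [::] erefl; rewrite !big_nil.
have {}sj : size s = j by case: sj.
have dualE H D x : 0 <= D -> form_linear j.+1 H -> form_bounded j.+1 D H ->
  to_dual (fun x => form_ext (fun l => H (x :: l)) s) x =
    form_ext (fun l => H (x :: l)) s.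
  move=> D0 lH bH; apply: (@to_dualE _ _ _ (D * \prod_(u <- s) `|u|)).
    move=> a y z.
    have [_ H2] := IH j _ (D * `|y|) sj (mulr_ge0 D0 (normr_ge0 _))
      (form_linear_cons y lH) (form_bounded_cons y bH).
    rewrite -(H2 _ (D * `|z|)) //; last 3 first.
    - by rewrite mulr_ge0.
    - exact: form_linear_cons.
    - exact: form_bounded_cons.
    by apply: (form_ext_eq (j := j)) => // l lj; apply: (lH [::]); rewrite /= lj.
  move=> y; have [H1 _] := IH j _ (D * `|y|) sj (mulr_ge0 D0 (normr_ge0 _))
      (form_linear_cons y lH) (form_bounded_cons y bH).
  by rewrite mulrAC.
split.
  rewrite big_cons mulrCA; apply: le_trans (le_dual_normM _ _) _.
  rewrite ler_wpM2l //; apply: dual_norm_le.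
    by rewrite mulr_ge0 // prodr_ge0.
  move=> y; rewrite (dualE _ C) //; rewrite mulrAC.
  by apply: (IH j _ (C * `|y|) sj (mulr_ge0 C0 (normr_ge0 _))
      (form_linear_cons y lF) (form_bounded_cons y bF)).1.
move=> G D a D0 lG bG /=; rewrite -[a *: _]/(a * _) -dual_mapZ -dual_mapD.
congr (u _); apply: dual_ext => x.
rewrite dual_addE dual_scaleE (dualE F C) // (dualE G D) //.
rewrite -[a * _]/(a *: _).
rewrite (dualE (fun l => a *: F l + G l) (`|a| * C + D)).
- have [_ H2] := IH j _ (C * `|x|) sj (mulr_ge0 C0 (normr_ge0 _))
      (form_linear_cons x lF) (form_bounded_cons x bF).
  apply: (H2 _ (D * `|x|)); first by rewrite mulr_ge0.
  + exact: form_linear_cons.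
  + exact: form_bounded_cons.
- by rewrite addr_ge0 // mulr_ge0.
- move=> l1 l2 b y z lj; rewrite lF // lG // !scalerDr addrACA !scalerA.
  by rewrite (mulrC a).
- move=> l lj; apply: le_trans (ler_normD _ _) _; rewrite mulrDl lerD ?bG //.
  by rewrite normrZ -mulrA ler_wpM2l // bF.
Qed.

Lemma form_ext_bounded j F C : 0 <= C -> form_linear j F -> form_bounded j C F ->
  form_bounded j C (form_ext F).
Proof. by move=> C0 lF bF s sj; exact: (form_ext_bound_lin sj C0 lF bF).1. Qed.

Lemma form_extP j F G C D a s : 0 <= C -> form_linear j F -> form_bounded j C F ->
  0 <= D -> form_linear j G -> form_bounded j D G -> size s = j ->
  form_ext (fun l => a *: F l + G l) s = a *: form_ext F s + form_ext G s.
Proof.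
by move=> C0 lF bF D0 lG bG sj; apply: (form_ext_bound_lin sj C0 lF bF).2 lG bG.
Qed.

(** The working interface of [form_ext]: one step of the recursion with a genuine functional [phi]
    in place of [to_dual]. *)
Lemma form_ext_cons j F C s : 0 <= C -> form_linear j.+1 F ->
  form_bounded j.+1 C F -> size s = j ->
  exists2 phi : dual X, forall x, phi x = form_ext (fun l => F (x :: l)) s &
    forall u, form_ext F (u :: s) = u phi.
Proof.
move=> C0 lF bF sj.
exists (to_dual (fun x => form_ext (fun l => F (x :: l)) s)) => // x.
apply: (@to_dualE _ _ _ (C * \prod_(u <- s) `|u|)) => [a y z|y].
  rewrite -(@form_extP j _ _ (C * `|y|) (C * `|z|)) ?mulr_ge0 //.
  - by apply: (form_ext_eq (j := j)) => // l lj; apply: (lF [::]); rewrite /= lj.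
  - exact: form_linear_cons.
  - exact: form_bounded_cons.
  - exact: form_linear_cons.
  - exact: form_bounded_cons.
rewrite mulrAC; apply: (@form_ext_bounded j) => //; first by rewrite mulr_ge0.
- exact: form_linear_cons.
- exact: form_bounded_cons.
Qed.

Lemma form_ext_linear j F C : 0 <= C -> form_linear j F -> form_bounded j C F ->
  form_linear j (form_ext F).
Proof.
move=> C0 + + s1 s2 a u v; elim: s1 j F C C0 => [//|w s1 IH] j F C C0 lF bF /=.
case: j lF bF => // j lF bF [sj].
have sz (t : bidual X) : size (s1 ++ t :: s2) = j by rewrite size_cat /= addnS.
have [pa paE pa'] := form_ext_cons C0 lF bF (sz (a *: u + v)).
have [pu puE pu'] := form_ext_cons C0 lF bF (sz u).
have [pv pvE pv'] := form_ext_cons C0 lF bF (sz v).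
have := pa' w; have := pu' w; have := pv' w => /= -> -> ->.
rewrite -[a *: _]/(a * _) -dual_mapZ -dual_mapD; congr (w _).
apply: dual_ext => x; rewrite dual_addE dual_scaleE paE puE pvE.
apply: (IH j _ (C * `|x|)) => //; first by rewrite mulr_ge0.
- exact: form_linear_cons.
- exact: form_bounded_cons.
Qed.

Lemma form_ext_evaluation j F C l : 0 <= C -> form_linear j F ->
  form_bounded j C F -> size l = j -> form_ext F (map (@evaluation K X) l) = F l.
Proof.
elim: l j F C => [|x l IH] [|j] F C // C0 lF bF [lj].
have sl : size (map (@evaluation K X) l) = j by rewrite size_map.
have [phi phiE phi'] := form_ext_cons C0 lF bF sl.
rewrite map_cons phi' evaluationE phiE; apply: (IH j _ (C * `|x|)) => //.
- by rewrite mulr_ge0.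
- exact: form_linear_cons.
- exact: form_bounded_cons.
Qed.

Variable u : bidual X.

Definition span_with : set (bidual X) :=
  [set w | exists y b, w = evaluation y + b *: u].

(* In general the extension of a symmetric form is not symmetric on the bidual;
   it is on the span of [X] and a single element. *)
Lemma form_ext_swap j F C : 0 <= C -> form_linear j F -> form_bounded j C F ->
  form_swap setT j F -> form_swap span_with j (form_ext F).
Proof.
move=> C0 lF bF sF s1 s2 a b + Ea Eb _ _.
elim: s1 j F C C0 lF bF sF => [|w s1 IH] j F C C0 lF bF sF /=; last first.
  case: j lF bF sF => // j lF bF sF [sj].
  have sz (c d : bidual X) : size (s1 ++ c :: d :: s2) = j.
    by rewrite size_cat /= !addnS.
  have [p pE p'] := form_ext_cons C0 lF bF (sz a b).
  have [q qE q'] := form_ext_cons C0 lF bF (sz b a).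
  have := p' w; have := q' w => /= -> ->; congr (w _).
  apply: dual_ext => x; rewrite pE qE.
  apply: (IH j _ (C * `|x|)) => //; first by rewrite mulr_ge0.
  - exact: form_linear_cons.
  - exact: form_bounded_cons.
  - exact: form_swap_cons.
case: j lF bF sF => [//|[//|j]] lF bF sF [sj]; rewrite add0n in sj.
case: Ea => y [c ->]; case: Eb => z [d ->].
pose B x x' := form_ext (fun l => F (x :: x' :: l)) s2.
have BC x x' : B x x' = B x' x.
  apply: (form_ext_eq (j := j)) => // l lj.
  by apply: (sF [::]) => //; rewrite /= lj.
have row x : exists2 phi : dual X, forall x', phi x' = B x x' &
    forall v, form_ext (fun l => F (x :: l)) (v :: s2) = v phi.
  apply: (@form_ext_cons j _ (C * `|x|)) => //; first by rewrite mulr_ge0.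
  - exact: form_linear_cons.
  - exact: form_bounded_cons.
have [chi chiE _] := @form_ext_cons j.+1 F C (u :: s2) C0 lF bF (congr1 S sj).
(* Bilinear expansion in the two leading entries. [B] is symmetric, the two mixed terms are
   exchanged with each other, and the [u]-[u] term is its own mirror image. With two independent
   elements of the bidual the last term would instead compare two orders of limits. *)
have main y1 c1 z1 d1 : form_ext F
    [:: evaluation y1 + c1 *: u, evaluation z1 + d1 *: u & s2] =
    B y1 z1 + d1 * form_ext (fun l => F (y1 :: l)) (u :: s2) +
    c1 * form_ext (fun l => F (z1 :: l)) (u :: s2) + c1 * d1 * u chi.
  have [phi phiE phi'] := @form_ext_cons j.+1 F C ((evaluation z1 + d1 *: u) :: s2)
    C0 lF bF (congr1 S sj).
  have [pz pzE pz'] := row z1.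
  have phiD : phi = pz + d1 *: chi.
    apply: dual_ext => x; rewrite phiE dual_addE dual_scaleE chiE.
    have [px pxE px'] := row x.
    by rewrite !px' dual_addE dual_scaleE evaluationE pxE pzE BC.
  rewrite phi' pz' dual_addE dual_scaleE evaluationE {1}phiD dual_addE dual_scaleE.
  rewrite pzE chiE BC [in u phi]phiD dual_mapD dual_mapZ.
  by rewrite mulrDr !addrA mulrA.
rewrite -[LHS]/(form_ext F [:: evaluation y + c *: u, evaluation z + d *: u & s2]).
rewrite -[RHS]/(form_ext F [:: evaluation z + d *: u, evaluation y + c *: u & s2]).
by rewrite !main (BC z) (mulrC d c) (addrAC (B y z)).
Qed.

End FormExtension.

(** * The theorem of Davie and Gamelin for forms *)


Section DavieGamelin.
Variables (K : scalarFieldType) (X : normedModType K).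
Variables (r : seq nat) (F : nat -> seq X -> K^o) (C : nat -> K).
Hypotheses (C_ge0 : forall j, j \in r -> 0 <= C j)
  (F_lin : forall j, j \in r -> form_linear j (F j))
  (F_bnd : forall j, j \in r -> form_bounded j (C j) (F j))
  (F_swap : forall j, j \in r -> form_swap setT j (F j)).

Let P (w : bidual X) : K^o := \sum_(j <- r) form_ext (F j) (nseq j w).
Let kappa : K := \sum_(j <- r) j%:R ^+ 2 * C j.

(** The direction [v] stands in the first entry, which [form_ext] evaluates last. The derivative is
    therefore evaluation of [v] at an element of [dual X], so a point of [X] can imitate [u] to
    first order. *)
Let derivative_functional (w : bidual X) : exists psi : dual X, forall v : bidual X,
  \sum_(j <- r) j%:R *: form_ext (F j) (v :: nseq j.-1 w) = v psi.
Proof.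
elim: r C_ge0 F_lin F_bnd F_swap => [|j s IH] C0 lF bF sF.
  by exists 0 => v; rewrite big_nil raddf0.
have [psi psiE] : exists psi : dual X, forall v : bidual X,
    \sum_(j <- s) j%:R *: form_ext (F j) (v :: nseq j.-1 w) = v psi.
  by apply: IH => i si; [apply: C0|apply: lF|apply: bF|apply: sF];
    rewrite in_cons si orbT.
have js : j \in j :: s by rewrite mem_head.
have {C0 lF bF sF} [C0 lF bF] := And3 (C0 _ js) (lF _ js) (bF _ js).
case: j C0 lF bF {js} => [|j] C0 lF bF.
  by exists psi => v; rewrite big_cons scale0r add0r.
have [phi _ phiE] := form_ext_cons C0 lF bF (size_nseq j w).
exists (j.+1%:R *: phi + psi) => v.
by rewrite big_cons psiE phiE dual_mapD dual_mapZ.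
Qed.

Let kappa_ge0 : 0 <= kappa.
Proof.
by rewrite /kappa big_seq sumr_ge0 // => j jr; rewrite mulr_ge0 ?exprn_ge0 ?C_ge0.
Qed.

(* [psi] is the derivative of [P] at [w], so moving [w] towards a point [z] of the
   ball with [psi z] close to [u psi] changes [P] only to second order. *)
Let step (u w : bidual X) (c : K) : `|u| <= 1 -> span_with u w -> `|w| <= 1 -> 0 < c ->
  exists2 z : X, `|z| <= 1 & (`|w + c *: (evaluation z - u)| <= 1 ->
    `|P (w + c *: (evaluation z - u)) - P w| <= (4 * kappa + 1) * c ^+ 2).
Proof.
move=> u1 Ew w1 c0; have [psi psiE] := derivative_functional w.
have [z z1 zpsi] := ball_approx_bidual psi u1 c0.
exists z => //; set h := c *: _ => wh1.
have Eh : span_with u h.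
  exists (c *: z), (- c); apply: dual_ext => f.
  rewrite !(dual_addE, dual_scaleE, evaluationE) dual_mapZ -[(- u) f]/(- u f); ring.
have Ewh : span_with u (w + h).
  have [y [b ->]] := Ew; have [y' [b' ->]] := Eh.
  exists (y + y'), (b + b'); rewrite scalerDl addrACA.
  by have := evaluation_linear 1 y y'; rewrite !scale1r => ->.
have h2 : `|h| <= 2 * c.
  rewrite normrZ (gtr0_norm c0) mulrC ler_wpM2r ?(ltW c0) //.
  apply: le_trans (ler_normB _ _) _; rewrite -[2]/(1 + 1) lerD //.
  exact: le_trans (le_norm_evaluation z) z1.
(* The first summand is the Taylor remainder, where [|h| <= 2 c] produces [4 * kappa]; the second is
   [c] times [psi z - u psi], at most [c ^ 2], and produces the 1. *)
have -> : P (w + h) - P w = (P (w + h) - P w - h psi) + h psi by rewrite subrK.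
apply: le_trans (ler_normD _ _) _; rewrite mulrDl mul1r lerD //; last first.
  rewrite dual_scaleE dual_addE normrM (gtr0_norm c0) expr2 ler_wpM2l ?(ltW c0) //.
rewrite -psiE -!sumrB; apply: le_trans (ler_norm_sum _ _ _) _.
rewrite mulrAC mulr_sumr big_seq [leRHS]big_seq; apply: ler_sum => j jr.
apply: le_trans (form_diag_taylor (C_ge0 jr) _ _ _ Ew Eh Ewh w1 wh1) _.
- by apply: form_ext_linear (F_lin jr) (F_bnd jr); exact: C_ge0.
- by apply: form_ext_bounded (F_lin jr) (F_bnd jr); exact: C_ge0.
- by apply: form_ext_swap (F_lin jr) (F_bnd jr) (F_swap jr); exact: C_ge0.
rewrite [leRHS]mulrC ler_wpM2l ?mulr_ge0 ?exprn_ge0 ?C_ge0 //.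
apply: (@le_trans _ _ ((2 * c) ^+ 2)).
  by rewrite ler_pXn2r // nnegrE // mulr_ge0 // ltW.
by rewrite exprMn -natrX.
Qed.

Lemma form_ext_sum_bound (M : K) :
  (forall x, `|x| <= 1 -> `|\sum_(j <- r) F j (nseq j x)| <= M) ->
  forall u : bidual X, `|u| <= 1 ->
    `|\sum_(j <- r) form_ext (F j) (nseq j u)| <= M.
Proof.
move=> PM u u1; apply/ler_addgt0Pr => e e0.
pose k := 4 * kappa + 1.
have k0 : 0 < k by rewrite ltr_wpDl // mulr_ge0.
have [n /(_ n (leqnn n)) ne] := scalar_invS_lt (divr_gt0 e0 k0).
set c : K := n.+1%:R^-1 in ne.
have c0 : 0 < c by rewrite invr_gt0 ltr0Sn.
have nc : n.+1%:R * c = 1 by rewrite divff // pnatr_eq0.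
(* The form of the point after [m] steps keeps it in the span of [X] and [u], and [|y| <= m c] keeps
   it in the unit ball. After [n + 1] steps the component along [u] is gone, at a total cost of
   [(n + 1) k c ^ 2 = k c], below [e] by the choice of [n]. *)
have walk (m : nat) : (m <= n.+1)%N -> exists2 y : X, `|y| <= m%:R * c &
    `|P (evaluation y + (1 - m%:R * c) *: u) - P u| <= m%:R * (k * c ^+ 2).
  elim: m => [_|m IH mn].
    exists 0; first by rewrite normr0 mul0r.
    rewrite !mul0r subr0 scale1r (_ : evaluation 0 = 0) ?add0r ?subrr ?normr0 //.
    by apply: dual_ext => f; rewrite evaluationE raddf0.
  have [y y1 Py] := IH (ltnW mn).
  set w := evaluation y + _ in Py.
  have small (i : nat) (v : X) : (i <= n.+1)%N -> `|v| <= i%:R * c ->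
      `|evaluation v + (1 - i%:R * c) *: u| <= 1.
    move=> il vl; apply: le_trans (ler_normD _ _) _.
    have ic : 0 <= 1 - i%:R * c.
      by rewrite subr_ge0 -[leRHS]nc ler_wpM2r ?(ltW c0) // ler_nat.
    rewrite -[leRHS](subrK (i%:R * c)) addrC lerD //; last first.
      exact: le_trans (le_norm_evaluation v) vl.
    by rewrite normrZ ger0_norm // ler_piMr.
  have Ew : span_with u w by exists y, (1 - m%:R * c).
  have [z z1 Pz] := step u1 Ew (small _ _ (ltnW mn) y1) c0.
  have yz : `|y + c *: z| <= m.+1%:R * c.
    rewrite -natr1 mulrDl mul1r; apply: le_trans (ler_normD _ _) _.
    by rewrite lerD // normrZ (gtr0_norm c0) ler_piMr // ltW.
  exists (y + c *: z) => //.
  have := small _ _ mn yz.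
  have -> : evaluation (y + c *: z) + (1 - m.+1%:R * c) *: u =
      w + c *: (evaluation z - u).
    apply: dual_ext => f; rewrite !(dual_addE, dual_scaleE, evaluationE) dual_mapD dual_mapZ.
    by rewrite -[(- u) f]/(- u f) -natr1; ring.
  move=> /Pz; set P1 := P (_ + _) => P1w.
  have -> : P1 - P u = (P1 - P w) + (P w - P u) by rewrite addrA subrK.
  apply: le_trans (ler_normD _ _) _.
  by rewrite -natr1 mulrDl mul1r addrC lerD.
have [y] := walk _ (leqnn _); rewrite nc subrr scale0r addr0 => y1.
have PyE : P (evaluation y) = \sum_(j <- r) F j (nseq j y).
  rewrite /P big_seq [RHS]big_seq; apply: eq_bigr => j jr.
  rewrite -map_nseq.
  exact: (form_ext_evaluation (C_ge0 jr) (F_lin jr) (F_bnd jr) (size_nseq _ _)).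
rewrite PyE distrC => Py.
rewrite -/(P u) -(subrK (\sum_(j <- r) F j (nseq j y)) (P u)) addrC.
apply: le_trans (ler_normD _ _) _; rewrite lerD ?PM //.
apply: le_trans Py _.
have -> : n.+1%:R * (k * c ^+ 2) = c * k * (n.+1%:R * c) by ring.
by rewrite nc mulr1 -ler_pdivlMr // ltW.
Qed.

End DavieGamelin.

(** * Multilinear maps *)


Section FormOf.
Variables (K : scalarFieldType) (X Y : normedModType K).
Implicit Types (j : nat) (C : K).

Definition form_of j (Phi : ('I_j -> X) -> Y) : seq X -> Y :=
  fun l => Phi (fun i => nth 0 l i).

Lemma form_of_enum j (Phi : ('I_j -> X) -> Y) x :
  form_of Phi [seq x i | i <- enum 'I_j] = Phi x.
Proof.
congr (Phi _); apply/funext => i.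
by rewrite (nth_map i) ?size_enum_ord // nth_ord_enum.
Qed.

Lemma form_of_nseq j (Phi : ('I_j -> X) -> Y) x :
  form_of Phi (nseq j x) = Phi (fun=> x).
Proof. by congr (Phi _); apply/funext => i; rewrite nth_nseq ltn_ord. Qed.

Lemma form_of_linear j (Phi : ('I_j -> X) -> Y) :
  multilinear Phi -> form_linear j (form_of Phi).
Proof.
move=> lPhi l1 l2 a x y lj.
have l1j : (size l1 < j)%N by rewrite -lj ltnS leq_addr.
pose z (i : 'I_j) := nth 0 (l1 ++ 0 :: l2) i.
have E v : form_of Phi (l1 ++ v :: l2) = Phi (dfwith z (Ordinal l1j) v).
  congr (Phi _); apply/funext => i; have [->|ni] := eqVneq i (Ordinal l1j).
    by rewrite dfwithin nth_cat ltnn subnn.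
  rewrite dfwithout; last by rewrite eq_sym.
  rewrite /z !nth_cat; case: ltnP => // li.
  have : (0 < i - size l1)%N by rewrite subn_gt0 ltn_neqAle li eq_sym andbT.
  by case: (i - size l1)%N.
by rewrite !E lPhi.
Qed.

Lemma form_of_swap j (Phi : ('I_j -> X) -> Y) :
  symmetric_map Phi -> form_swap setT j (form_of Phi).
Proof.
move=> sPhi l1 l2 a b lj _ _ _ _.
have p1 : (size l1 < j)%N by rewrite -lj ltnS leqW // leq_addr.
have p2 : ((size l1).+1 < j)%N by rewrite -lj !ltnS leq_addr.
rewrite /form_of -[RHS](sPhi (tperm (Ordinal p1) (Ordinal p2))).
congr (Phi _); apply/funext => i /=.
case: tpermP => [->|->|/eqP i1 /eqP i2] /=.
- by rewrite !nth_cat ltnn subnn ltnNge leqnSn /= subSnn.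
- by rewrite !nth_cat ltnn subnn ltnNge leqnSn /= subSnn.
- rewrite !nth_cat; case: ltnP => // li.
  have : (1 < i - size l1)%N.
    rewrite ltn_subRL addn1 ltn_neqAle eq_sym i2 /=.
    by rewrite ltn_neqAle li eq_sym i1.
  by case: (i - size l1)%N => [|[|]].
Qed.

(** The filter generated by the cubes around 0; it converts continuity for the product topology into
    a bound on a cube. *)
Definition small_box j : set_system ('I_j -> X) :=
  [set A | exists2 d : K, 0 < d & forall x, (forall i, `|x i| < d) -> A x].

Lemma small_box_cvg0 j :
  Filter (@small_box j) /\ @small_box j --> ((fun=> 0) : prod_topology (fun _ : 'I_j => X)).
Proof.
have FB : Filter (@small_box j).
  split; first by exists 1.
    move=> P Q [d d0 Pd] [d' d'0 Qd].
    have [e [e0 ed ed']] := pos_common_lb d0 d'0.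
    exists e => // x xe; split; [apply: Pd|apply: Qd] => i.
      exact: lt_le_trans (xe i) ed.
    exact: lt_le_trans (xe i) ed'.
  by move=> P Q PQ [d d0 Pd]; exists d => // x /Pd /PQ.
split=> //; apply/cvg_sup => i A.
rewrite (@nbhsE (initial_topology (fun f : 'I_j -> X => f i))).
move=> -[_ [[U oU <-] /= U0] UA].
have : nbhs (0 : X) U by apply: open_nbhs_nbhs; split.
move=> /nbhs_normP [d d0 dU]; exists d => // x xd; apply: UA.
by apply: dU; rewrite /= sub0r normrN.
Qed.

Lemma cont_multilinear_bounded j (Phi : ('I_j -> X) -> Y) : cont_multilinear Phi ->
  exists2 C : K, 0 <= C & form_bounded j C (form_of Phi).
Proof.
move=> [lPhi cPhi]; have lF := form_of_linear lPhi.
(* A 0-linear map is a constant and need not vanish at 0, unlike those of positive degree. *)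
case: j Phi lPhi cPhi lF => [|j] Phi lPhi cPhi lF.
  exists `|form_of Phi [::]| => // -[|//] _.
  by rewrite big_nil mulr1.
have Phi0 : Phi (fun=> 0) = 0.
  by rewrite -form_of_nseq /= (form_linear_00 lF) // size_nseq.
have [FB B0] := small_box_cvg0 j.+1.
have : nbhs (Phi (fun=> 0)) [set y | `|y| < 1].
  by rewrite Phi0; apply/nbhs_normP; exists 1 => //= y; rewrite /= sub0r normrN.
move=> /cPhi /B0 [d d0 Bd].
(* Entries of norm at most 1, scaled by [d / 2], lie strictly inside the cube of size [d], where
   [Phi] has norm below 1. *)
have d20 : 0 < d / 2 by rewrite divr_gt0.
exists ((d / 2) ^- j.+1); first by rewrite invr_ge0 exprn_ge0 // ltW.
apply: form_bounded_ball => // l lj l1.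
rewrite -(ler_pM2l (exprn_gt0 j.+1 d20)) divff ?gt_eqF ?exprn_gt0 //.
rewrite -[X in X ^+ _ * _](gtr0_norm d20) -normrX -normrZ.
rewrite -(form_linear_map_scale _ lF lj).
apply/ltW/Bd => i; rewrite (nth_map 0) ?lj // normrZ gtr0_norm //.
apply: (@le_lt_trans _ _ (d / 2)); first by rewrite ler_piMr ?(ltW d20) // l1 // mem_nth ?lj.
by rewrite ltr_pdivrMr // ltr_pMr // ltr1n.
Qed.

Lemma form_bounded_continuous j (Phi : ('I_j -> X) -> Y) (C : K) : 0 <= C ->
  multilinear Phi -> form_bounded j C (form_of Phi) -> cont_multilinear Phi.
Proof.
move=> C0 lPhi bPhi; split=> // x; have lF := form_of_linear lPhi.
(* [B] bounds the entries of [x] and those of all points within distance 1 of it; on this region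
   [Phi] is Lipschitz. *)
pose B : K := 1 + \sum_i `|x i|.
have B1 : 1 <= B by rewrite lerDl sumr_ge0.
have xB i : `|x i| + 1 <= B.
  by rewrite /B addrC lerD2l (bigD1 i) //= lerDl sumr_ge0.
pose T : topologicalType := prod_topology (fun _ : 'I_j => X).
have FT : Filter (nbhs (x : T)) := nbhs_filter (x : T).
apply/(@cvgrPdist_le K Y T (nbhs (x : T)) FT Phi (Phi x)) => e e0.
pose k := j%:R * C * B ^+ j + 1.
have B0 : 0 <= B by apply: le_trans B1.
have k0 : 0 < k by rewrite ltr_wpDl // !mulr_ge0 ?exprn_ge0.
have [d [d0 dk d1]] := pos_common_lb (divr_gt0 e0 k0) ltr01.
have : \forall y \near (x : T), forall i : 'I_j, `|x i - y i| <= d.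
  apply: (@filter_forall _ _ _ _ FT) => i.
  have := @proj_continuous _ (fun _ : 'I_j => X) i x.
  by move=> /(@cvgrPdist_le K X T (nbhs (x : T)) FT (fun y => y i) (x i))/(_ d d0).
apply: (@filterS _ _ FT) => y xy.
rewrite -(form_of_enum Phi x) -(form_of_enum Phi y) distrC.
apply: (@le_trans _ _ (j%:R * C * B ^+ j * d)); last first.
  apply: (@le_trans _ _ (k * d)); first by rewrite ler_wpM2r ?(ltW d0) // lerDl.
  by rewrite mulrC -ler_pdivlMr.
have sz (z : 'I_j -> X) : size [seq z i | i <- enum 'I_j] = j.
  by rewrite size_map size_enum_ord.
apply: (form_lipschitz C0 (ltW d0) B1 lF bPhi (sz x) (sz y)).
- by move=> _ /mapP[i _ ->]; apply: le_trans (xB i); rewrite lerDl.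
- move=> _ /mapP[i _ ->]; apply: le_trans (xB i).
  rewrite -[y i](subrK (x i)) addrC; apply: le_trans (ler_normD _ _) _.
  by rewrite lerD // distrC (le_trans (xy i)).
- move=> i; have [ij|ij] := ltnP i j; last first.
    by rewrite !nth_default ?sz // subrr normr0 ltW.
  have nthE (z : 'I_j -> X) : nth 0 [seq z k | k <- enum 'I_j] i = z (Ordinal ij).
    rewrite (nth_map (Ordinal ij)) ?size_enum_ord //; congr (z _).
    exact: (nth_ord_enum _ (Ordinal ij)).
  by rewrite !nthE distrC.
Qed.

End FormOf.

(** * Aron-Berner extensions *)


Section BidualExtension.
Variables (K : scalarFieldType) (X Y : normedModType K).
Implicit Types (G : seq X -> Y) (s : seq (bidual X)) (C : K).

Lemma dual_form_linear j G (v : dual Y) : form_linear j G ->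
  form_linear j (fun l => v (G l)).
Proof. by move=> lG l1 l2 a x y lj; rewrite lG // dual_mapD dual_mapZ. Qed.

Lemma dual_form_bounded j C G (v : dual Y) : form_bounded j C G ->
  form_bounded j (`|v| * C) (fun l => v (G l)).
Proof.
move=> bG l lj; apply: le_trans (le_dual_normM _ _) _.
by rewrite -mulrA ler_wpM2l // bG.
Qed.

Lemma dual_form_swap E j G (v : dual Y) : form_swap E j G ->
  form_swap E j (fun l => v (G l)).
Proof. by move=> sG l1 l2 a b lj Ea Eb E1 E2; rewrite sG. Qed.

Definition bidual_ext G s : bidual Y :=
  to_dual (fun v : dual Y => form_ext (fun l => v (G l)) s).

Lemma bidual_extE j C G s (v : dual Y) : 0 <= C -> form_linear j G ->
  form_bounded j C G -> size s = j ->
  bidual_ext G s v = form_ext (fun l => v (G l)) s.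
Proof.
move=> C0 lG bG sj; apply: (@to_dualE _ _ _ (C * \prod_(u <- s) `|u|)).
  move=> a w z; rewrite -(@form_extP _ _ j _ _ (`|w| * C) (`|z| * C)) ?mulr_ge0 //.
  - exact: dual_form_linear.
  - exact: dual_form_bounded.
  - exact: dual_form_linear.
  - exact: dual_form_bounded.
move=> w; rewrite mulrAC [C * _]mulrC.
apply: (@form_ext_bounded _ _ j) => //; first by rewrite mulr_ge0.
- exact: dual_form_linear.
- exact: dual_form_bounded.
Qed.

(** The intermediate limits are the extensions with the first entry frozen in [X]. The outermost
    limit, tested on [v], is then the w*-convergence to [u ord0] tested on the functional of
    [form_ext_cons]. *)
Lemma iter_wstar_lim_ext j C G (u : 'I_j -> bidual X) (F : 'I_j -> set_system X) :
  0 <= C -> form_linear j G -> form_bounded j C G ->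
  (forall i, wstar_cvg (evaluation (X := X) @ F i) (u i)) ->
  iter_wstar_lim F (fun x => evaluation (G [seq x i | i <- enum 'I_j]))
    (bidual_ext G [seq u i | i <- enum 'I_j]).
Proof.
have szE n (z : 'I_n -> bidual X) : size [seq z i | i <- enum 'I_n] = n.
  by rewrite size_map size_enum_ord.
elim: j C G u F => [|j IH] C G u F C0 lG bG Fu.
  move=> x; apply: dual_ext => v.
  by rewrite (bidual_extE _ C0 lG bG (szE _ u)) enum_ord0.
pose u' (i : 'I_j) := u (lift ord0 i).
have sz := szE _ u'.
have C1 (x : X) : 0 <= C * `|x| by rewrite mulr_ge0.
exists (fun x => bidual_ext (fun l => G (x :: l)) [seq u' i | i <- enum 'I_j]).
  move=> x; have := IH _ (fun l => G (x :: l)) u' (fun i => F (lift ord0 i)) (C1 x)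
    (form_linear_cons x lG) (form_bounded_cons x bG) (fun i => Fu _).
  congr (iter_wstar_lim _ _ _); apply/funext => y; congr (evaluation (G _)).
  rewrite enum_ordSl /= /ocons unlift_none /=; congr (_ :: _).
  by rewrite -map_comp; apply: eq_map => i /=; rewrite liftK.
move=> v.
have [phi phiE phi'] := form_ext_cons (mulr_ge0 (normr_ge0 v) C0)
  (dual_form_linear v lG) (dual_form_bounded v bG) sz.
have := Fu ord0 phi.
have -> : bidual_ext G [seq u i | i <- enum 'I_j.+1] v = u ord0 phi.
  by rewrite (bidual_extE _ C0 lG bG (szE _ u)) enum_ordSl map_cons -map_comp -phi'.
move=> cv A /cv.
set h := fun x => bidual_ext _ _.
change (F ord0 [set x | A (evaluation x phi)] -> F ord0 [set x | A (h x v)]).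
suff hE x : evaluation x phi = h x v.
  have -> : [set x | A (h x v)] = [set x | A (evaluation x phi)] => //.
  by apply/seteqP; split=> x; rewrite /mkset hE.
rewrite evaluationE phiE /h (@bidual_extE j (C * `|x|)) //.
- exact: form_linear_cons.
- exact: form_bounded_cons.
Qed.

Lemma iter_wstar_lim_unique j (F : 'I_j -> set_system X)
    (psi : ('I_j -> X) -> bidual Y) (l l' : bidual Y) :
  (forall i, ProperFilter (F i)) ->
  iter_wstar_lim F psi l -> iter_wstar_lim F psi l' -> l = l'.
Proof.
elim: j F psi l l' => [|j IH] F psi l l' PF /=.
  by move=> /(_ (fun=> 0)) <- /(_ (fun=> 0)) <-.
move=> [h hE hl] [h' h'E h'l].
have hh' : h = h'.
  by apply/funext => x; apply: (IH (fun i => F (lift ord0 i)) _ _ _ _ (hE x) (h'E x)).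
apply: dual_ext => v.
have := h'l v; rewrite -hh' => h'v.
exact: (cvg_unique (@norm_hausdorff K K^o) (hl v) h'v).
Qed.

End BidualExtension.

(** * Filters on X converging to an element of the bidual *)

Section WeakStarDensity.
Variables (K : scalarFieldType) (X : normedModType K).

(** A functional vanishing on the common kernel of finitely many others is a combination of them;
    this is the same statement with the coefficients eliminated and [u] applied. Either the new
    [psi] is nonzero somewhere on the kernel of [s], and a multiple of it is subtracted from [phi],
    or it adds no condition. *)
Lemma bidual_vanish (s : seq (dual X)) (phi : dual X) (u : bidual X) :
  (forall z, (forall psi, psi \in s -> psi z = 0) -> phi z = 0) ->
  (forall psi, psi \in s -> u psi = 0) -> u phi = 0.
Proof.
elim: s phi => [|psi s IH] phi phis us.
  by rewrite (_ : phi = 0) ?raddf0 //; apply: dual_ext => z; rewrite phis.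
have us' psi' : psi' \in s -> u psi' = 0.
  by move=> ps; rewrite us // in_cons ps orbT.
have [[z zs zpsi]|Nz] := pselect (exists2 z, (forall psi', psi' \in s -> psi' z = 0)
    & psi z <> 0); last first.
  apply: IH => // z zs; apply: phis => psi'; rewrite in_cons => /orP[/eqP ->|/zs//].
  by apply: contrapT => pz; apply: Nz; exists z.
have /eqP psiz0 := zpsi.
pose c := phi z / psi z.
have : u (phi - c *: psi) = 0.
  apply: IH => // y ys.
  have <- : phi (y - (psi y / psi z) *: z) = (phi - c *: psi) y.
    rewrite dual_addE -[(- (c *: psi)) y]/(- (c * psi y)) -scaleNr dual_mapD dual_mapZ.
    by rewrite /c; field.
  apply: phis => psi'; rewrite in_cons => /orP[/eqP ->|ps].
    by rewrite -scaleNr dual_mapD dual_mapZ mulNr divfK // subrr.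
  by rewrite -scaleNr dual_mapD dual_mapZ (ys _ ps) (zs _ ps) mulr0 addr0.
by rewrite -scaleNr dual_mapD dual_mapZ (us psi) ?mem_head // mulr0 addr0.
Qed.

(** If [phi] is nonzero at a point of the kernel of [s], the interpolating point is corrected along
    it; otherwise [bidual_vanish], applied to [u - evaluation x], shows that [phi] takes the right
    value already. *)
Lemma bidual_interpolation (s : seq (dual X)) (u : bidual X) :
  exists x : X, forall phi, phi \in s -> phi x = u phi.
Proof.
elim: s => [|phi s [x xs]]; first by exists 0.
have [[z zs zphi]|Nz] := pselect (exists2 z, (forall psi, psi \in s -> psi z = 0)
    & phi z <> 0).
  have /eqP phiz0 := zphi.
  exists (x + ((u phi - phi x) / phi z) *: z) => psi.
  rewrite dual_mapD dual_mapZ in_cons => /orP[/eqP ->|ps].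
    by rewrite divfK // addrC subrK.
  by rewrite (zs _ ps) mulr0 addr0 xs.
exists x => psi; rewrite in_cons => /orP[/eqP ->|/xs//].
have : (u - evaluation x) phi = 0.
  apply: (@bidual_vanish s) => [z zs|psi' ps].
    by apply: contrapT => pz; apply: Nz; exists z.
  by rewrite dual_subE evaluationE xs // subrr.
by rewrite dual_subE evaluationE => /eqP; rewrite subr_eq0 => /eqP.
Qed.

(** Generated by the affine sets of points that agree exactly with [u] on finitely many functionals.
    No bound on the norms of these points is imposed, so linear algebra suffices to show that the
    sets are nonempty. *)
Definition wstar_filter (u : bidual X) : set_system X :=
  [set A | exists s : seq (dual X), forall x,
    (forall phi, phi \in s -> phi x = u phi) -> A x].

Lemma wstar_filter_proper (u : bidual X) : ProperFilter (wstar_filter u).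
Proof.
apply: Build_ProperFilter_ex.
  move=> A [s sA]; have [x xs] := bidual_interpolation s u.
  by exists x; exact: sA.
split; first by exists [::].
  move=> A B [s sA] [t tB]; exists (s ++ t) => x xst.
  by split; [apply: sA|apply: tB] => phi ps; apply: xst; rewrite mem_cat ps ?orbT.
by move=> A B AB [s sA]; exists s => x /sA /AB.
Qed.

Lemma wstar_filter_cvg (u : bidual X) :
  wstar_cvg (evaluation (X := X) @ wstar_filter u) u.
Proof.
move=> phi A A0; exists [:: phi] => x /(_ phi (mem_head _ _)) phix.
rewrite /= phix; exact: nbhs_singleton.
Qed.

End WeakStarDensity.


(** * Symmetric bounded forms and the diagonal of their extensions *)

Section SymMultilinear.
Variables (K : scalarFieldType) (X : normedModType K).
Implicit Types (Y : normedModType K) (j : nat) (C : K).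

Definition sym_multilinear Y j (Phi : ('I_j -> X) -> Y) :=
  [/\ multilinear Phi, symmetric_map Phi &
      exists2 C : K, 0 <= C & form_bounded j C (form_of Phi)].

Lemma form_of_boundedP Y j (Phi : ('I_j -> X) -> Y) C :
  (forall x, `|Phi x| <= C * \prod_i `|x i|) <-> form_bounded j C (form_of Phi).
Proof.
split=> [bPhi l lj|bF x].
  rewrite (big_nth 0) lj big_mkord; exact: bPhi.
rewrite -form_of_enum; have := bF [seq x i | i <- enum 'I_j].
by rewrite size_map size_enum_ord big_map big_enum; apply.
Qed.

Lemma multilinear_comb Y j (Phi Psi : ('I_j -> X) -> Y) (a : K) :
  multilinear Phi -> multilinear Psi ->
  multilinear (fun x => a *: Phi x + Psi x).
Proof.
move=> l1 l2 x i b u v; rewrite l1 l2 !scalerDr addrACA !scalerA.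
by rewrite (mulrC a).
Qed.

Lemma sym_multilinear_comb Y j (Phi Psi : ('I_j -> X) -> Y) (a : K) :
  sym_multilinear Phi -> sym_multilinear Psi ->
  sym_multilinear (fun x => a *: Phi x + Psi x).
Proof.
move=> [l1 s1 [C C0 bC]] [l2 s2 [D D0 bD]]; split.
- exact: multilinear_comb.
- by move=> s x; rewrite s1 s2.
- exists (`|a| * C + D); first by rewrite addr_ge0 // mulr_ge0.
  move=> l lj; apply: le_trans (ler_normD _ _) _; rewrite mulrDl lerD ?bD //.
  by rewrite normrZ -mulrA ler_wpM2l // bC.
Qed.

Lemma sym_multilinear0 Y j : @sym_multilinear Y j (fun=> 0).
Proof.
split=> [x i a u v|//|]; first by rewrite scaler0 addr0.
by exists 0 => // l _; rewrite normr0 mul0r.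
Qed.

Lemma sym_multilinear_dual Y j (Phi : ('I_j -> X) -> Y) (v : dual Y) :
  sym_multilinear Phi -> @sym_multilinear K^o j (fun x => v (Phi x)).
Proof.
move=> [lPhi sPhi [C C0 bC]]; split.
- by move=> x i a u w; rewrite lPhi dual_mapD dual_mapZ.
- by move=> s x; rewrite sPhi.
- exists (`|v| * C); first by rewrite mulr_ge0.
  exact: dual_form_bounded.
Qed.

Lemma sym_multilinear_vec Y j (Phi : ('I_j -> X) -> K^o) (y : Y) :
  sym_multilinear Phi -> sym_multilinear (fun x => Phi x *: y).
Proof.
move=> [lPhi sPhi [C C0 bC]]; split.
- by move=> x i a u w; rewrite lPhi scalerDl -scalerA.
- by move=> s x; rewrite sPhi.
- exists (`|y| * C); first by rewrite mulr_ge0.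
  by move=> l lj; rewrite normrZ mulrC -mulrA ler_wpM2l // bC.
Qed.

(** The average over all permutations of the entries, which is unchanged on the diagonal. Inserting
    a vector at place [i] and permuting by [s] amounts to inserting it at place [s^-1 i], whence
    multilinearity. *)
Lemma symmetrization Y j (Phi : ('I_j -> X) -> Y) : cont_multilinear Phi ->
  exists2 Psi : ('I_j -> X) -> Y, sym_multilinear Psi &
    forall x, Psi (fun=> x) = Phi (fun=> x).
Proof.
move=> cPhi; have [lPhi _] := cPhi.
have [C C0 bC] := cont_multilinear_bounded cPhi.
have nz : (#|{perm 'I_j}|%:R : K) != 0.
  by rewrite pnatr_eq0 -lt0n; apply/card_gt0P; exists 1%g.
exists (fun x => #|{perm 'I_j}|%:R^-1 *: \sum_(s : {perm 'I_j}) Phi (x \o s)).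
  split.
  - move=> x i a u v; rewrite scalerA mulrC -scalerA -scalerDr; congr (_ *: _).
    rewrite scaler_sumr -big_split /=; apply: eq_bigr => s _.
    have E w : dfwith x i w \o s = dfwith (x \o s) (s^-1 i)%g w.
      apply/funext => k /=; have [->|nk] := eqVneq k ((s^-1)%g i).
        by rewrite permKV !dfwithin.
      have nk' : (s^-1)%g i != k by rewrite eq_sym.
      have nsk : i != s k by apply: contra nk => /eqP ->; rewrite permK.
      by rewrite !dfwithout.
    by rewrite !E lPhi.
  - move=> s x; congr (_ *: _).
    rewrite [RHS](reindex_inj (mulIg s)) /=; apply: eq_bigr => t _.
    by congr (Phi _); apply/funext => k /=; rewrite permM.
  - exists C => //; apply/form_of_boundedP => x.
    rewrite normrZ normfV ger0_norm // mulrC ler_pdivrMr ?lt_def ?nz ?ler0n //.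
    apply: le_trans (ler_norm_sum _ _ _) _.
    have -> : C * \prod_i `|x i| * #|{perm 'I_j}|%:R =
        \sum_(s : {perm 'I_j}) C * \prod_i `|x i|.
      by rewrite sumr_const mulr_natr.
    apply: ler_sum => s _; apply: le_trans.
      exact: (form_of_boundedP Phi C).2.
    by rewrite [X in _ <= _ * X](reindex_inj (@perm_inj _ s)).
move=> x; rewrite (eq_bigr (fun=> Phi (fun=> x))) //.
by rewrite sumr_const -scaler_nat scalerA mulVf // scale1r.
Qed.

Lemma homogeneous_polyP Y j (P : X -> Y) : homogeneous_poly j P <->
  exists2 Phi : ('I_j -> X) -> Y, sym_multilinear Phi &
    forall x, P x = Phi (fun=> x).
Proof.
split=> [[Phi /symmetrization[Psi sPsi E] PE]|[Phi [lPhi _ [C C0 bC]] PE]].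
  by exists Psi => // x; rewrite PE E.
by exists Phi => //; exact: form_bounded_continuous bC.
Qed.

(** From now on the nets are gone. One direction evaluates the canonical extension along
    [wstar_filter u] in every variable and uses uniqueness of limits; the other is
    [iter_wstar_lim_ext], valid along all convergent filters. *)
Lemma AB_homogeneousP Y j (P : X -> Y) (Pbar : bidual X -> bidual Y) :
  AB_homogeneous j P Pbar <->
  exists Phi : ('I_j -> X) -> Y, [/\ sym_multilinear Phi,
    forall x, P x = Phi (fun=> x) &
    forall u, Pbar u = bidual_ext (form_of Phi) (nseq j u)].
Proof.
have canon (Phi : ('I_j -> X) -> Y) : sym_multilinear Phi ->
    canonical_extension Phi (fun u => bidual_ext (form_of Phi) [seq u i | i <- enum 'I_j]).
  move=> [lPhi sPhi [C C0 bC]] u F PF Fu.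
  have := iter_wstar_lim_ext C0 (form_of_linear lPhi) bC Fu.
  by congr (iter_wstar_lim _ _ _); apply/funext => x; rewrite form_of_enum.
have diag (u : bidual X) : [seq (fun=> u) i | i <- enum 'I_j] = nseq j u.
  by rewrite -[X in nseq X](size_enum_ord j); elim: (enum 'I_j) => //= i s ->.
split=> [[Phi [Phibar [cPhi sPhi PE PhiE PbarE]]]|[Phi [sPhi PE PbarE]]].
  have [C C0 bC] := cont_multilinear_bounded cPhi.
  have smPhi : sym_multilinear Phi by split => //; [exact: cPhi.1|exists C].
  exists Phi; split=> // u; rewrite PbarE -diag.
  apply: (@iter_wstar_lim_unique _ _ _ j (fun=> wstar_filter u)
    (fun x => evaluation (Phi x))).
  - by move=> i; exact: wstar_filter_proper.
  - by apply: PhiE => i; [exact: wstar_filter_proper|exact: wstar_filter_cvg].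
  - by apply: canon => // i; [exact: wstar_filter_proper|exact: wstar_filter_cvg].
have [lPhi syPhi [C C0 bC]] := sPhi.
exists Phi, (fun u => bidual_ext (form_of Phi) [seq u i | i <- enum 'I_j]).
split=> //; first exact: form_bounded_continuous bC.
  exact: canon.
by move=> u; rewrite diag.
Qed.

Lemma AB_homogeneous_form Y j (P : X -> Y) (Pbar : bidual X -> bidual Y) (v : dual Y) :
  AB_homogeneous j P Pbar -> exists F : seq X -> K^o, exists C : K,
    [/\ [/\ 0 <= C, form_linear j F, form_bounded j C F & form_swap setT j F],
        forall x, v (P x) = F (nseq j x) &
        forall u, Pbar u v = form_ext F (nseq j u)].
Proof.
move=> /AB_homogeneousP [Phi [[lPhi sPhi [C C0 bC]] PE PbarE]].
have lF := form_of_linear lPhi; have sF := form_of_swap sPhi.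
exists (fun l => v (form_of Phi l)), (`|v| * C); split.
- split; first by rewrite mulr_ge0.
  + exact: dual_form_linear.
  + exact: dual_form_bounded.
  + exact: dual_form_swap.
- by move=> x; rewrite PE -form_of_nseq.
- by move=> u; rewrite PbarE (bidual_extE _ C0 lF bC) // size_nseq.
Qed.

(* The theorem of Davie and Gamelin. *)
Lemma AB_sum_bounded Y (r : seq nat) (p : nat -> X -> Y)
    (pbar : nat -> bidual X -> bidual Y) (M : K) :
  (forall j, j \in r -> AB_homogeneous j (p j) (pbar j)) ->
  (forall x, `|x| <= 1 -> `|\sum_(j <- r) p j x| <= M) ->
  forall u, `|u| <= 1 -> `|\sum_(j <- r) pbar j u| <= M.
Proof.
move=> pAB pM u u1; have M0 : 0 <= M := bounded_on_ball_ge0 pM.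
apply: dual_norm_le => // v.
pose Q j (FC : (seq X -> K^o) * K) := j \in r -> [/\ [/\ 0 <= FC.2,
   form_linear j FC.1, form_bounded j FC.2 FC.1 & form_swap setT j FC.1],
   forall x, v (p j x) = FC.1 (nseq j x) &
   forall u, pbar j u v = form_ext FC.1 (nseq j u)].
have /choice[FC FCP] : forall j, exists FC, Q j FC.
  move=> j; have [jr|jr] := boolP (j \in r); last by exists (fun=> 0, 0); rewrite /Q (negbTE jr).
  have [F [C FP]] := AB_homogeneous_form v (pAB _ jr).
  by exists (F, C).
have -> : (\sum_(j <- r) pbar j u) v = \sum_(j <- r) form_ext (FC j).1 (nseq j u).
  by rewrite dual_sumE big_seq [RHS]big_seq; apply: eq_bigr => j jr; have [_ _ ->] := FCP j jr.
rewrite mulrC.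
apply: (@form_ext_sum_bound _ _ r (fun j => (FC j).1) (fun j => (FC j).2)) u1.
- by move=> j jr; have [[]] := FCP j jr.
- by move=> j jr; have [[]] := FCP j jr.
- by move=> j jr; have [[]] := FCP j jr.
- by move=> j jr; have [[]] := FCP j jr.
- move=> x x1; apply: (@le_trans _ _ `|v (\sum_(j <- r) p j x)|).
    rewrite dual_map_sum big_seq [in leRHS]big_seq.
    by rewrite (eq_bigr (fun j => v (p j x))) // => j jr; have [_ -> _] := FCP j jr.
  apply: le_trans (le_dual_normM _ _) _; by rewrite ler_wpM2l // pM.
Qed.

End SymMultilinear.


(** * The bidual of the scalar field *)

Section ScalarDual.
Variable K : scalarFieldType.

Definition id_dual : dual K^o := to_dual (fun x : K^o => x).

Lemma id_dualE (x : K^o) : id_dual x = x.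
Proof. by apply: (@to_dualE _ K^o _ 1) => // y; rewrite mul1r. Qed.

Lemma norm_id_dual : `|id_dual| <= 1.
Proof. by apply: dual_norm_le => // x; rewrite id_dualE mul1r. Qed.

(** The dual of [K^o] is spanned by [id_dual], so evaluation there turns the values of scalar
    extensions, which lie in a bidual, back into scalars of the same norm. *)
Lemma norm_bidual_scalar (u : bidual K^o) : `|u| = `|u id_dual|.
Proof.
apply/eqP; rewrite eq_le; apply/andP; split; last first.
  apply: le_trans (le_dual_normM u _) _.
  by rewrite ler_piMr // norm_id_dual.
apply: dual_norm_le => // v.
have vE : v = v 1 *: id_dual.
  apply: dual_ext => x; rewrite dual_scaleE id_dualE mulrC -dual_mapZ.
  by congr (v _); rewrite -[RHS]/(x * 1) mulr1.
rewrite {1}vE dual_mapZ normrM mulrC ler_wpM2l //.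
have := @le_dual_normM K K^o v 1.
by rewrite (_ : `|1 : K^o| = 1) ?mulr1 // -[LHS]/(`|1 : K|) normr1.
Qed.

End ScalarDual.

(** * Extensions of combinations and perturbations of polynomials *)

Section AronBernerPerturbation.
Variables (K : scalarFieldType) (X Y : normedModType K).

(** Since [phi y = 1], composing the perturbed polynomial with [phi] cancels [f] and leaves [c * p];
    the identity persists for the extensions because they are defined by testing on functionals. *)
Lemma AB_homogeneous_perturb j (f : X -> Y) (p : X -> K^o) pbar (y : Y)
    (phi : dual Y) (c : K) :
  homogeneous_poly j f -> AB_homogeneous j p pbar -> phi y = 1 ->
  exists2 Qbar, AB_homogeneous j (fun x => f x + (c * p x - phi (f x)) *: y) Qbar &
    forall u, Qbar u phi = c * pbar u (id_dual K).
Proof.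
move=> /homogeneous_polyP[Phi sPhi fE] /AB_homogeneousP[Psi [sPsi pE pbarE]] y1.
pose Q (x : 'I_j -> X) : Y := Phi x + (c * Psi x - phi (Phi x)) *: y.
have sQ : sym_multilinear Q.
  have := sym_multilinear_comb 1 (sym_multilinear_vec y
    (sym_multilinear_comb (- 1) (sym_multilinear_dual phi sPhi)
    (sym_multilinear_comb c sPsi (@sym_multilinear0 _ X K^o j)))) sPhi.
  congr (sym_multilinear _); apply/funext => x.
  rewrite scale1r addrC; congr (_ + _ *: _).
  by rewrite addr0 scaleN1r addrC.
exists (fun u => bidual_ext (form_of Q) (nseq j u)).
  by apply/AB_homogeneousP; exists Q; split => // x; rewrite fE pE.
move=> u; rewrite pbarE.
have [lQ _ [D D0 bD]] := sQ; have [lP _ [E E0 bE]] := sPsi.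
rewrite (bidual_extE _ D0 (form_of_linear lQ) bD) ?size_nseq //.
rewrite (bidual_extE _ E0 (form_of_linear lP) bE) ?size_nseq //.
have lF := dual_form_linear (id_dual K) (form_of_linear lP).
have bF := dual_form_bounded (id_dual K) bE.
have F0 := mulr_ge0 (normr_ge0 (id_dual K)) E0.
have l0 : @form_linear K X K^o j (fun=> 0).
  by move=> l1 l2 a x z _; rewrite scaler0 addr0.
have b0 : @form_bounded K X K^o j 0 (fun=> 0).
  by move=> l _; rewrite normr0 mul0r.
have := form_extP c F0 lF bF (lexx 0) l0 b0 (size_nseq j u).
have -> : form_ext (fun=> 0) (nseq j u) = 0.
  apply/eqP; rewrite -normr_le0.
  by have := form_ext_bounded (lexx 0) l0 b0 (size_nseq j u); rewrite mul0r.
rewrite addr0 -[RHS]/(c * _) => <-; congr (form_ext _ _); apply/funext => l.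
rewrite addr0 id_dualE /form_of /Q dual_mapD dual_mapZ y1 mulr1.
by rewrite addrC subrK.
Qed.

Lemma AB_homogeneous_comb j (p q : X -> Y) pbar qbar (a : K) :
  AB_homogeneous j p pbar -> AB_homogeneous j q qbar ->
  AB_homogeneous j (fun x => a *: p x + q x) (fun u => a *: pbar u + qbar u).
Proof.
move=> /AB_homogeneousP[Phi [sPhi pE pbarE]] /AB_homogeneousP[Psi [sPsi qE qbarE]].
apply/AB_homogeneousP; exists (fun x => a *: Phi x + Psi x); split.
- exact: sym_multilinear_comb.
- by move=> x; rewrite pE qE.
- move=> u; rewrite pbarE qbarE; apply: dual_ext => v.
  have [lQ _ [D D0 bD]] := sym_multilinear_comb a sPhi sPsi.
  have [lP _ [E E0 bE]] := sPhi; have [lR _ [H H0 bH]] := sPsi.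
  rewrite dual_addE dual_scaleE.
  rewrite (bidual_extE _ D0 (form_of_linear lQ) bD) ?size_nseq //.
  rewrite (bidual_extE _ E0 (form_of_linear lP) bE) ?size_nseq //.
  rewrite (bidual_extE _ H0 (form_of_linear lR) bH) ?size_nseq //.
  rewrite -(form_extP a (mulr_ge0 (normr_ge0 v) E0) (dual_form_linear v (form_of_linear lP))
    (dual_form_bounded v bE) (mulr_ge0 (normr_ge0 v) H0)
    (dual_form_linear v (form_of_linear lR))
    (dual_form_bounded v bH) (size_nseq j u)).
  by congr (form_ext _ _); apply/funext => l; rewrite /form_of dual_mapD dual_mapZ.
Qed.

Lemma AB_homogeneous0 j : AB_homogeneous j ((fun=> 0) : X -> Y) (fun=> 0).
Proof.
apply/AB_homogeneousP; exists (fun=> 0); split=> //; first exact: sym_multilinear0.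
move=> u; apply: dual_ext => v.
have [l0 _ [D D0 bD]] := @sym_multilinear0 _ X Y j.
rewrite (@bidual_extE _ _ _ j 0 _ _ _ _ (form_of_linear l0)) ?size_nseq //; last first.
  by move=> l _; rewrite normr0 mul0r.
apply/esym/eqP; rewrite -normr_le0.
have := @form_ext_bounded _ _ j (fun=> v 0) 0 (lexx 0) _ _ (nseq j u) (size_nseq j u).
rewrite mul0r; apply.
  by move=> l1 l2 a x z _; rewrite dual_map0 scaler0 addr0.
by move=> l _; rewrite dual_map0 normr0 mul0r.
Qed.

Lemma AB_homogeneous_evaluation j (p : X -> Y) pbar x :
  AB_homogeneous j p pbar -> pbar (evaluation x) = evaluation (p x).
Proof.
move=> pAB; apply: dual_ext => v.
have [F [C [[C0 lF bF _] pE pbarE]]] := AB_homogeneous_form v pAB.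
rewrite evaluationE pE pbarE -map_nseq.
by rewrite (form_ext_evaluation C0 lF bF) ?size_nseq.
Qed.

Lemma homogeneous_polyZ j (p : X -> Y) : homogeneous_poly j p ->
  forall a x, p (a *: x) = a ^+ j *: p x.
Proof.
move=> /homogeneous_polyP[Phi [lPhi _ _] pE] a x.
rewrite !pE -!form_of_nseq.
rewrite -(form_linear_map_scale a (form_of_linear lPhi)) ?size_nseq //.
by rewrite map_nseq.
Qed.

Lemma AB_homogeneousZ j (p : X -> Y) pbar :
  AB_homogeneous j p pbar -> forall a u, pbar (a *: u) = a ^+ j *: pbar u.
Proof.
move=> pAB a u; apply: dual_ext => v; rewrite dual_scaleE.
have [F [C [[C0 lF bF _] _ pbarE]]] := AB_homogeneous_form v pAB.
rewrite !pbarE.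
have lE := form_ext_linear C0 lF bF.
by rewrite -map_nseq (form_linear_map_scale a lE) ?size_nseq.
Qed.

Lemma AB_homogeneous_poly j (p : X -> Y) pbar :
  AB_homogeneous j p pbar -> homogeneous_poly j p.
Proof.
by move=> /AB_homogeneousP[Phi [sPhi pE _]]; apply/homogeneous_polyP; exists Phi.
Qed.

Lemma homogeneous_poly_bounded j (p : X -> Y) : homogeneous_poly j p ->
  bounded_on_ball p.
Proof.
move=> /homogeneous_polyP[Phi [_ _ [C C0 bC]] pE]; exists C => x x1.
rewrite pE -form_of_nseq.
apply: le_trans (form_bounded_le (B := 1) C0 bC (size_nseq j x) _) _.
  by move=> z /nseqP[->].
by rewrite expr1n mulr1.
Qed.

End AronBernerPerturbation.

(** * Perturbation by property (beta) *)


Section PropertyBeta.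
Variables (K : scalarFieldType) (Y : normedModType K).

(** The hypothesis [0 <= M] takes care of an empty index set, where the supremum has its default
    value 0. *)
Lemma norming_le (L : Type) (g : L -> dual Y) (z : Y) (M : K) :
  `|z| = supremum 0 (range (fun a => `|g a z| : K)) ->
  0 <= M -> (forall a, `|g a z| <= M) -> `|z| <= M.
Proof.
move=> -> M0 gM; set A := image _ _.
rewrite /supremum; case: ifPn => // /set0P A0.
have ubA : ubound A M by move=> _ [a _ <-].
have [s As] : supremums A !=set0.
  by apply: nneg_supremums => //; [exists M|move=> _ [a _ <-]].
by case: xgetP => [w _ [_ lbw]|/(_ s)/(_ As)//]; exact: lbw.
Qed.

Lemma norming_gt (L : Type) (g : L -> dual Y) (z : Y) (M : K) :
  `|z| = supremum 0 (range (fun a => `|g a z| : K)) ->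
  0 <= M -> M < `|z| -> exists a, M < `|g a z|.
Proof.
move=> zE M0 Mz; apply: contrapT => Na.
suff /(lt_le_trans Mz) : `|z| <= M by rewrite ltxx.
apply: (norming_le zE M0) => a.
rewrite real_leNgt ?normr_real ?ger0_real //.
by apply/negP => Ma; apply: Na; exists a.
Qed.

End PropertyBeta.

(** * From scalar to vector values, for an abstract class of functions *)

Section Transfer.
Variables (K : scalarFieldType) (X Y : normedModType K).
Variables (SK : set (X -> K^o)) (SY : set (X -> Y)).
Variables (ABK : (X -> K^o) -> (bidual X -> bidual K^o) -> Prop).
Variables (ABY : (X -> Y) -> (bidual X -> bidual Y) -> Prop).

(** The argument common to the three classes. The last hypothesis but one collects what depends on
    the class: [Q] stays in it, its extension reduces under [phi] to that of [c * p], and a bound of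
    [Q] on the ball carries over to the bidual. *)
Lemma lindenstrauss_transfer : property_beta Y ->
  (forall p, SK p -> bounded_on_ball p) ->
  (forall f, SY f -> bounded_on_ball f) ->
  (forall f (phi : dual Y), SY f -> SK (fun x => phi (f x))) ->
  SY (fun=> 0) -> ABY (fun=> 0) (fun=> 0) ->
  (forall p pbar, SK p -> ABK p pbar ->
    forall x, `|x| <= 1 -> `|p x| <= sup_norm pbar) ->
  (forall f p pbar y (phi : dual Y) c,
    SY f -> SK p -> ABK p pbar -> phi y = 1 ->
    let Q x := f x + (c * p x - phi (f x)) *: y in
    SY Q /\ exists Qbar, [/\ ABY Q Qbar,
      forall u, `|u| <= 1 -> Qbar u phi = c * pbar u (id_dual K) &
      forall M, (forall x, `|x| <= 1 -> `|Q x| <= M) ->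
        forall u, `|u| <= 1 -> `|Qbar u| <= M]) ->
  lindenstrauss_for SK ABK -> lindenstrauss_for SY ABY.
Proof.
move=> [L [y [g [yg1 [lam /andP[lam0 lam1] glam] znorm]]]] bK bY compS S0 AB0 dom pert LK.
move=> f Sf e e0; have bf := bY f Sf.
have g1 a : `|g a| = 1 by have [] := yg1 a.
set s := sup_norm f.
have s0 : 0 <= s := sup_norm_ge0 bf.
have [sE|sn0] := eqVneq s 0.
  exists (fun=> 0); split=> //.
    exists (fun=> 0) => //; exists 0; rewrite ?normr0 //.
    apply/esym/eqP; rewrite eq_le; apply/andP; split.
      by apply: sup_norm_le => x _; rewrite normr0.
    by apply: sup_norm_ge0; exists 0 => x _; rewrite normr0.
  have -> : f - (fun=> 0) = f by apply/funext => x; rewrite -[LHS]/(f x - 0) subr0.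
  by rewrite -/s sE.
have sgt0 : 0 < s by rewrite lt_def sn0.
have lam' : 0 < 1 - lam by rewrite subr_gt0.
(* As [|p| <= s + d <= 2 s] on the ball, the factor [1 + eta] costs at most [eta * 2 s = e / 2]. *)
pose eta := e / (4 * s).
have eta0 : 0 < eta by rewrite divr_gt0 // mulr_gt0.
have [d1 [d10 d1s d1e]] := pos_common_lb (divr_gt0 sgt0 (ltr0n K 4)) (divr_gt0 e0 (ltr0n K 4)).
(* By [4 d <= s], the norm [N >= s - 2 d] is at least [s / 2], so the gain [eta (1 - lam) N] is at
   least [e (1 - lam) / 8]. The losses are at most [3 d], which explains 24. *)
have [d [d0 dd1 dlam]] := pos_common_lb d10 (divr_gt0 (mulr_gt0 e0 lam') (ltr0n K 24)).
have ds : d * 4 <= s by rewrite -ler_pdivlMr // (le_trans dd1).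
have de : d * 4 <= e by rewrite -ler_pdivlMr // (le_trans dd1).
have {}dlam : d * 24 <= e * (1 - lam) by rewrite -ler_pdivlMr.
have sd0 : 0 <= s - d.
  by rewrite subr_ge0; apply: le_trans ds; rewrite ler_peMr ?ltW // ltr1n.
have [x0 x01 fx0] : exists2 x, `|x| <= 1 & s - d < `|f x|.
  by apply: sup_norm_gt => //; rewrite ltrBlDr ltrDl.
have [a ha] := norming_gt (znorm (f x0)) sd0 fx0.
pose h x : K^o := g a (f x).
have gz b z : `|g b z| <= `|z|.
  by apply: le_trans (le_dual_normM _ _) _; rewrite g1 mul1r.
have fs x : `|x| <= 1 -> `|f x| <= s by move=> x1; exact: sup_norm_ge.
have Sh : SK h := compS f (g a) Sf.
have [p [Sp [pbar ABp [u0 u01 pu0]] hp]] := LK h Sh d d0.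
have hpd x : `|x| <= 1 -> `|h x - p x| <= d.
  move=> x1; apply: le_trans (ltW hp).
  apply: (@sup_norm_ge K X K^o (h - p)) => //.
  have [M1 hM1] := bK _ Sh; have [M2 pM2] := bK _ Sp.
  exists (M1 + M2) => z z1; apply: le_trans (ler_normB _ _) _.
  by rewrite lerD ?hM1 ?pM2.
set N := sup_norm pbar in pu0.
have pN x : `|x| <= 1 -> `|p x| <= N := dom _ _ Sp ABp x.
have N0 : 0 <= N by rewrite -pu0.
have sN : s <= N + d * 2.
  have : s - d <= N + d.
    apply: le_trans (ltW ha) _; rewrite -/(h x0) -(subrK (p x0) (h x0)) addrC.
    by apply: le_trans (ler_normD _ _) _; rewrite lerD ?pN ?hpd.
  by rewrite lerBlDr -addrA -mulr2n mulr_natr.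
have ps x : `|x| <= 1 -> `|p x| <= s + d.
  move=> x1; rewrite -(subrK (h x) (p x)) addrC; apply: le_trans (ler_normD _ _) _.
  by rewrite lerD // ?(distrC (p x)) ?hpd // (le_trans (gz _ _)) // fs.
have [ya1 _ gya] := yg1 a.
have [SQ [Qbar [ABQ QbarE Qbarle]]] := pert f p pbar (y a) (g a) (1 + eta) Sf Sp ABp gya.
move: SQ ABQ Qbarle; set Q := fun x => _ => SQ ABQ Qbarle.
have corr x : `|x| <= 1 -> `|(1 + eta) * p x - h x| <= d + eta * `|p x|.
  move=> x1; have -> : (1 + eta) * p x - h x = (p x - h x) + eta * p x by ring.
  apply: le_trans (ler_normD _ _) _.
  by rewrite lerD // ?(distrC (p x)) ?hpd // normrM gtr0_norm.
have eta10 : 0 <= 1 + eta by rewrite addr_ge0 // ltW.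
have QN x : `|x| <= 1 -> `|Q x| <= (1 + eta) * N.
  move=> x1; apply: (norming_le (znorm _)); first by rewrite mulr_ge0.
  move=> b; rewrite /Q dual_mapD dual_mapZ; have [->|nba] := pselect (b = a).
    by rewrite gya mulr1 addrC subrK normrM ger0_norm // ler_wpM2l // pN.
  apply: (@le_trans _ _ (s + (d + eta * N) * lam)).
    apply: le_trans (ler_normD _ _) _; rewrite lerD //.
      by rewrite (le_trans (gz _ _)) // fs.
    rewrite normrM ler_pM // ?glam //.
    by apply: le_trans (corr x x1) _; rewrite lerD2l ler_wpM2l ?(ltW eta0) // pN.
  (* [N >= s - 2 d], and the gain [eta (1 - lam) N] absorbs the errors of order [d]. *)
  have etas : eta * s * 4 = e by rewrite /eta; field.
  rewrite -subr_ge0.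
  have -> : (1 + eta) * N - (s + (d + eta * N) * lam) =
     (N + d * 2 - s) * (1 + eta * (1 - lam)) + (s - d * 4) * (eta * (1 - lam)) / 2
     + d * (1 - lam) + (eta * s * 4 * (1 - lam) - d * 24) / 8.
    by field.
  rewrite etas; have el0 : 0 <= eta * (1 - lam) by rewrite mulr_ge0 // ltW.
  rewrite !addr_ge0 //.
  - by rewrite mulr_ge0 ?subr_ge0 // addr_ge0.
  - by rewrite divr_ge0 // mulr_ge0 ?subr_ge0.
  - by rewrite mulr_ge0 // ltW.
  - by rewrite divr_ge0 // subr_ge0.
(* Testing on [g a], of norm 1, gives the lower bound at [u0]; it coincides with the upper bound
   that [QN] gives on the whole ball of the bidual. *)
have Qbar_u0 : (1 + eta) * N <= `|Qbar u0|.
  apply: (@le_trans _ _ `|Qbar u0 (g a)|).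
    by rewrite QbarE // normrM ger0_norm // -norm_bidual_scalar pu0.
  by apply: le_trans (le_dual_normM _ _) _; rewrite g1 mulr1.
exists Q; split=> //.
  exists Qbar => //; exists u0 => //; apply/eqP; rewrite eq_le; apply/andP; split.
    by apply: sup_norm_ge => //; exists ((1 + eta) * N); exact: Qbarle.
  by apply: le_trans Qbar_u0; apply: sup_norm_le; exact: Qbarle.
apply: (@le_lt_trans _ _ (d + e / 2)).
  apply: sup_norm_le => x x1.
  have -> : (f - Q) x = - (((1 + eta) * p x - h x) *: y a).
    by rewrite -[LHS]/(f x - Q x) /Q opprD addrA subrr add0r.
  rewrite normrN normrZ ya1 mulr1; apply: le_trans (corr x x1) _.
  rewrite lerD2l.
  apply: (@le_trans _ _ (eta * (s * 2))).
    rewrite ler_wpM2l ?(ltW eta0) //; apply: le_trans (ps x x1) _.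
    rewrite mulr_natr mulr2n lerD2l; apply: le_trans ds.
    by rewrite ler_peMr ?ltW // ltr1n.
  by rewrite (_ : eta * (s * 2) = e / 2) // /eta; field.
rewrite -subr_gt0.
have -> : e - (d + e / 2) = (e - d * 4) / 4 + e / 4 by field.
by rewrite ltr_wpDl ?divr_gt0 // divr_ge0 ?subr_ge0.
Qed.

End Transfer.

(** * Homogeneous polynomials and polynomials of bounded degree *)

Section HomogeneousAndPoly.
Variables (K : scalarFieldType) (X Y : normedModType K).

Lemma homogeneous_poly_dual j (f : X -> Y) (phi : dual Y) :
  homogeneous_poly j f -> @homogeneous_poly K X K^o j (fun x => phi (f x)).
Proof.
move=> /homogeneous_polyP[Phi sPhi fE]; apply/homogeneous_polyP.
exists (fun x => phi (Phi x)); first exact: sym_multilinear_dual.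
by move=> x; rewrite fE.
Qed.

Lemma lindenstrauss_homogeneous_transfer N : property_beta Y ->
  lindenstrauss_homogeneous X K^o N -> lindenstrauss_homogeneous X Y N.
Proof.
move=> bY; apply: lindenstrauss_transfer => //.
- by move=> p; exact: homogeneous_poly_bounded.
- by move=> p; exact: homogeneous_poly_bounded.
- by move=> f phi; exact: homogeneous_poly_dual.
- exact: AB_homogeneous_poly (AB_homogeneous0 _ _ N).
- exact: AB_homogeneous0.
- move=> p pbar _ pAB x x1.
  have bp : bounded_on_ball pbar.
    have [M pM] := homogeneous_poly_bounded (AB_homogeneous_poly pAB).
    exists M => u u1.
    have := @AB_sum_bounded K X K^o [:: N] (fun=> p) (fun=> pbar) M _ _ u u1.
    rewrite big_seq1; apply=> [j|z z1]; first by rewrite inE => /eqP ->.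
    by rewrite big_seq1 pM.
  have := sup_norm_ge bp (le_trans (le_norm_evaluation x) x1).
  by rewrite (AB_homogeneous_evaluation _ pAB) norm_bidual_scalar evaluationE id_dualE.
- move=> f p pbar y phi c Sf _ pAB phiy Q.
  have [Qbar QAB QbarE] := AB_homogeneous_perturb c Sf pAB phiy.
  split; first exact: AB_homogeneous_poly QAB.
  exists Qbar; split=> // M QM u u1.
  have := @AB_sum_bounded K X Y [:: N] (fun=> Q) (fun=> Qbar) M _ _ u u1.
  rewrite big_seq1; apply=> [j|z z1]; first by rewrite inE => /eqP ->.
  by rewrite big_seq1 QM.
Qed.

Lemma AB_poly_bounded (Z : normedModType K) k (p : X -> Z) pbar M :
  AB_poly k p pbar -> (forall x, `|x| <= 1 -> `|p x| <= M) ->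
  forall u, `|u| <= 1 -> `|pbar u| <= M.
Proof.
move=> [q [qbar [qAB pE pbarE]]] pM u u1; rewrite pbarE -(big_mkord xpredT (qbar^~ u)).
apply: AB_sum_bounded u1.
  by move=> j; rewrite mem_index_iota => /andP[_ jk]; apply: qAB; rewrite -ltnS.
by move=> x x1; rewrite big_mkord -pE pM.
Qed.

Lemma poly_deg_le_bounded (Z : normedModType K) k (p : X -> Z) :
  poly_deg_le k p -> bounded_on_ball p.
Proof.
move=> [q qh pE].
have bq j : exists M, (j <= k)%N -> forall x, `|x| <= 1 -> `|q j x| <= M.
  have [jk|jk] := leqP j k; last by exists 0.
  by have [M qM] := homogeneous_poly_bounded (qh j jk); exists M.
have [M qM] := choice bq; exists (\sum_(j < k.+1) M j) => x x1.
rewrite pE; apply: le_trans (ler_norm_sum _ _ _) _; apply: ler_sum => j _.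
by apply: qM => //; rewrite -ltnS.
Qed.

(** The perturbation is linear in the pair [(f, p)], so it can be carried out and extended in each
    degree separately. *)
Lemma lindenstrauss_poly_transfer k : property_beta Y ->
  lindenstrauss_poly X K^o k -> lindenstrauss_poly X Y k.
Proof.
move=> bY; apply: lindenstrauss_transfer => //.
- by move=> p; exact: poly_deg_le_bounded.
- by move=> p; exact: poly_deg_le_bounded.
- move=> f phi [q qh fE]; exists (fun j x => phi (q j x)).
    by move=> j jk; apply: homogeneous_poly_dual; exact: qh.
  by move=> x; rewrite fE dual_map_sum.
- exists (fun _ _ => 0); last by move=> x; rewrite big1.
  by move=> j _; exact: AB_homogeneous_poly (AB_homogeneous0 _ _ j).
- exists (fun _ _ => 0), (fun _ _ => 0); split.
  + by move=> j _; exact: AB_homogeneous0.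
  + by move=> x; rewrite big1.
  + by move=> x; rewrite big1.
- move=> p pbar Sp pAB x x1.
  have bp : bounded_on_ball pbar.
    have [M pM] := poly_deg_le_bounded Sp; exists M.
    exact: AB_poly_bounded pAB pM.
  have := sup_norm_ge bp (le_trans (le_norm_evaluation x) x1).
  have -> : pbar (evaluation x) = evaluation (p x).
    have [q [qbar [qAB pE pbarE]]] := pAB.
    apply: dual_ext => v; rewrite pbarE evaluationE pE dual_map_sum dual_sumE.
    apply: eq_bigr => j _; rewrite (AB_homogeneous_evaluation _ (qAB _ _)) //.
    by rewrite -ltnS.
  by rewrite norm_bidual_scalar evaluationE id_dualE.
- move=> f p pbar y phi c [q qh fE] _ [r [rbar [rAB pE pbarE]]] phiy Q.
  have ex j : exists Rbar, (j <= k)%N ->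
      AB_homogeneous j (fun x => q j x + (c * r j x - phi (q j x)) *: y) Rbar /\
      forall u, Rbar u phi = c * rbar j u (id_dual K).
    have [jk|jk] := leqP j k; last by exists (fun=> 0).
    have [Rbar RAB RbarE] := AB_homogeneous_perturb c (qh j jk) (rAB j jk) phiy.
    by exists Rbar.
  have [Rbar RP] := choice ex.
  pose Qbar u := \sum_(j < k.+1) Rbar j u.
  have jk (j : 'I_k.+1) : (j <= k)%N by rewrite -ltnS.
  have QE x : Q x = \sum_(j < k.+1) (q j x + (c * r j x - phi (q j x)) *: y).
    rewrite big_split /= -fE -scaler_suml; congr (_ + _ *: _).
    by rewrite sumrB -mulr_sumr -pE -dual_map_sum -fE.
  have QAB : AB_poly k Q Qbar.
    exists (fun j x => q j x + (c * r j x - phi (q j x)) *: y), Rbar.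
    by split=> // j jk'; have [] := RP j jk'.
  split.
    exists (fun j x => q j x + (c * r j x - phi (q j x)) *: y) => //.
    by move=> j jk'; have [RAB _] := RP j jk'; exact: AB_homogeneous_poly RAB.
  exists Qbar; split=> //.
    move=> u _; rewrite /Qbar dual_sumE pbarE dual_sumE mulr_sumr.
    by apply: eq_bigr => j _; have [_ ->] := RP j (jk j).
  by move=> M; exact: AB_poly_bounded QAB.
Qed.

End HomogeneousAndPoly.

(** * Power series *)


Section PowerSeries.
Variables (K : scalarFieldType).
Implicit Types (X V : normedModType K).

Lemma cvg_seqP V (u : nat -> V) (l : V) : u @ \oo --> l <->
  forall e : K, 0 < e -> exists N : nat, forall n, (N <= n)%N -> `|l - u n| <= e.
Proof.
split=> [/cvgrPdist_le ul e e0|ul].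
  by have [N _ Nn] := ul e e0; exists N => n Nn'; exact: Nn.
apply/cvgrPdist_le => e e0; have [N Nn] := ul e e0.
by exists N => // n /= Nn'; exact: Nn.
Qed.

Lemma cvg_term_bounded V (u : nat -> V) (l : V) : series u @ \oo --> l ->
  exists2 B : K, 0 <= B & forall n, `|u n| <= B.
Proof.
move=> /cvg_seqP /(_ 1 ltr01)[N Nn].
have B0 : 0 <= \sum_(k < N) `|u k| by rewrite sumr_ge0.
exists (2 + \sum_(k < N) `|u k|); first by rewrite addr_ge0.
move=> n; have [nN|nN] := ltnP n N.
  by rewrite (bigD1 (Ordinal nN)) //= addrCA lerDl addr_ge0 // sumr_ge0.
apply: (@le_trans _ _ 2); last by rewrite lerDl.
have -> : u n = (l - series u n) - (l - series u n.+1).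
  by rewrite opprB addrC addrA subrK /series /= big_nat_recr //= addrC addKr.
apply: le_trans (ler_normB _ _) _.
by rewrite -[2]/(1 + 1) lerD // Nn // leqW.
Qed.

Lemma geometric_tail (rho : K) (m n : nat) : 0 <= rho < 1 ->
  \sum_(m <= k < n) rho ^+ k <= rho ^+ m / (1 - rho).
Proof.
move=> /andP[r0 r1]; have r10 : 0 < 1 - rho by rewrite subr_gt0.
have [mn|nm] := leqP m n; last first.
  by rewrite big_geq ?(ltnW nm) // divr_ge0 ?exprn_ge0 // ltW.
rewrite ler_pdivlMr //.
suff -> : (\sum_(m <= k < n) rho ^+ k) * (1 - rho) = rho ^+ m - rho ^+ n.
  by rewrite gerBl exprn_ge0.
rewrite -(subnK mn); elim: (n - m)%N => [|k IH]; first by rewrite big_geq // mul0r subrr.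
rewrite addSn big_nat_recr ?leq_addl //= mulrDl IH exprS; ring.
Qed.

Lemma series_tail V (u : nat -> V) (l : V) (B rho : K) (m : nat) :
  0 <= rho < 1 -> series u @ \oo --> l -> (forall k, `|u k| <= B * rho ^+ k) ->
  `|l - series u m| <= B * rho ^+ m / (1 - rho).
Proof.
move=> r01 /cvg_seqP ul uB; apply/ler_addgt0Pr => e e0.
have [N Nn] := ul e e0.
pose n := (N + m)%N.
rewrite -(subrK (series u n) l) -addrA; apply: le_trans (ler_normD _ _) _.
rewrite [leLHS]addrC lerD //; last by rewrite Nn // leq_addr.
have mn : (m <= n)%N by rewrite leq_addl.
rewrite /series /= (big_cat_nat (leq0n m) mn) /= [X in `|X|]addrC addKr.
have B0 : 0 <= B by have := uB 0%N; rewrite expr0 mulr1; apply: le_trans.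
apply: le_trans (ler_norm_sum _ _ _) _.
rewrite -mulrA; apply: le_trans (ler_wpM2l B0 (geometric_tail m n r01)).
by rewrite mulr_sumr; apply: ler_sum.
Qed.

Lemma norm_unity_root (w : K) (n : nat) : (0 < n)%N -> w ^+ n = 1 -> `|w| = 1.
Proof.
move=> n0 wn; apply/eqP; rewrite -(pexpr_eq1 n0) //.
by rewrite -normrX wn normr1.
Qed.

(** Orthogonality of the characters of a cyclic group: for [i != j] the sum is geometric with a
    ratio [q != 1] satisfying [q ^+ J = 1]. *)
Lemma sum_unity_root (w : K) (J i j : nat) : J.-primitive_root w ->
  (i < J)%N -> (j < J)%N ->
  \sum_(k < J) (w ^+ (j * k))^-1 * w ^+ (k * i) = (i == j)%:R * J%:R.
Proof.
move=> pw iJ jJ; have w0 : w != 0.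
  by rewrite (prim_root_eq0 pw); case: J {pw} iJ jJ.
pose q := w ^+ i / w ^+ j.
have E k : (w ^+ (j * k))^-1 * w ^+ (k * i) = q ^+ k.
  by rewrite /q expr_div_n -!exprM mulrC (mulnC k).
rewrite (eq_bigr (fun k : 'I_J => q ^+ k)) //.
have [ij|nij] := eqVneq i j.
  rewrite /q ij divff ?expf_neq0 // mul1r (eq_bigr (fun=> 1)) => [|k _].
    by rewrite sumr_const card_ord.
  by rewrite expr1n.
rewrite mul0r; apply/eqP.
have q1 : q - 1 != 0.
  rewrite subr_eq0; apply: contra nij => /eqP q1.
  have : w ^+ i == w ^+ j.
    by rewrite -[w ^+ i](divfK (expf_neq0 j w0)) -/q q1 mul1r.
  by rewrite (eq_prim_root_expr pw) !modn_small.
have := subrX1 q J.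
have -> : q ^+ J = 1.
  rewrite /q expr_div_n -!exprM ![(_ * J)%N]mulnC !exprM (prim_expr_order pw).
  by rewrite !expr1n divr1.
by rewrite subrr => /esym/eqP; rewrite mulf_eq0 (negbTE q1).
Qed.

(* A discrete substitute for Cauchy's integral formula: on polynomials of degree
   less than [J] it extracts the [j]-th homogeneous component exactly. *)
Definition root_average X V (w : K) (J j : nat) (f : X -> V) (x : X) : V :=
  J%:R^-1 *: \sum_(k < J) (w ^+ (j * k))^-1 *: f (w ^+ k *: x).

Lemma root_average_le X V (w : K) (J j : nat) (f : X -> V) (x : X) (M : K) :
  J.-primitive_root w -> (forall k, `|f (w ^+ k *: x)| <= M) ->
  `|root_average w J j f x| <= M.
Proof.
move=> pw fM; have J0 := prim_order_gt0 pw.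
have w1 := norm_unity_root J0 (prim_expr_order pw).
have J0' : 0 < J%:R :> K by rewrite ltr0n.
rewrite normrZ normfV gtr0_norm // mulrC ler_pdivrMr // mulr_natr.
apply: le_trans (ler_norm_sum _ _ _) _.
rewrite -[in leRHS](card_ord J) -sumr_const; apply: ler_sum => k _.
by rewrite normrZ normfV normrX w1 expr1n invr1 mul1r.
Qed.

Lemma root_averageB X V (w : K) (J j : nat) (f g : X -> V) (x : X) :
  root_average w J j (fun x => f x - g x) x =
    root_average w J j f x - root_average w J j g x.
Proof.
by rewrite -scalerBr -sumrB; congr (_ *: _); apply: eq_bigr => k _; rewrite scalerBr.
Qed.

Lemma root_average_dual X V (w : K) (J j : nat) (f : X -> V) (phi : dual V) (x : X) :
  phi (root_average w J j f x) =
    @root_average X K^o w J j (fun x => phi (f x)) x.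
Proof.
rewrite dual_mapZ dual_map_sum; congr (_ * _); apply: eq_bigr => k _.
by rewrite dual_mapZ.
Qed.

Definition homogeneous_family X V (p : nat -> X -> V) :=
  forall j a x, p j (a *: x) = a ^+ j *: p j x.

Lemma root_average_poly X V (w : K) (J j : nat) (p : nat -> X -> V) (x : X) :
  J.-primitive_root w -> (j < J)%N -> homogeneous_family p ->
  root_average w J j (fun x => series (p ^~ x) J) x = p j x.
Proof.
move=> pw jJ hp; rewrite /root_average.
have -> : \sum_(k < J) (w ^+ (j * k))^-1 *: series (p ^~ (w ^+ k *: x)) J =
    \sum_(i < J) (\sum_(k < J) (w ^+ (j * k))^-1 * w ^+ (k * i)) *: p i x.
  under [RHS]eq_bigr do rewrite scaler_suml.
  rewrite exchange_big /=; apply: eq_bigr => k _.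
  rewrite /series /= big_mkord scaler_sumr; apply: eq_bigr => i _.
  by rewrite hp scalerA -exprM.
rewrite (bigD1 (Ordinal jJ)) //= [X in _ + X]big1 => [|i ij]; last first.
  by rewrite (sum_unity_root pw) // (negbTE (ij : (i : nat) != j)) mul0r scale0r.
rewrite (sum_unity_root pw) // eqxx mul1r addr0 scalerA mulVf ?scale1r //.
by rewrite pnatr_eq0 -lt0n (leq_ltn_trans _ jJ).
Qed.

(** Complex scalars enter here: over the reals this fails for every [n > 2]. *)
Hypothesis prim_roots : forall n, (0 < n)%N -> exists w : K, n.-primitive_root w.

(** Cauchy's estimate. The average over [J]-th roots of unity returns [p j x] exactly from a partial
    sum of length [J], and at all the rotated points this sum is as close to [h] as the same
    geometric tail permits. *)
Lemma series_coef_le_open X V (p : nat -> X -> V) (h : X -> V) (M : K) (j : nat) (x : X) :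
  homogeneous_family p -> (forall x, `|x| < 1 -> series (p ^~ x) @ \oo --> h x) ->
  (forall x, `|x| < 1 -> `|h x| <= M) -> `|x| < 1 -> `|p j x| <= M.
Proof.
move=> hp ph hM x1.
(* A number strictly between [|x|] and 1: the terms of the series are bounded at [rho^-1 *: x],
   hence decay at [x] like [rho ^+ k]. *)
pose rho : K := (1 + `|x|) / 2.
have xp : 0 < 1 + `|x| by rewrite ltr_pwDl.
have rho0 : 0 < rho by rewrite divr_gt0.
have rho1 : rho < 1 by rewrite ltr_pdivrMr // mul1r -[2]/(1 + 1) ltrD2l.
have rho01 : 0 <= rho < 1 by rewrite (ltW rho0) rho1.
have sx1 : `|rho^-1 *: x| < 1.
  rewrite normrZ normfV gtr0_norm // mulrC ltr_pdivrMr // mul1r ltr_pdivlMr //.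
  by rewrite mulr_natr mulr2n ltrD2r.
have [B B0 pB] := cvg_term_bounded (ph _ sx1).
have pB' k : `|p k x| <= B * rho ^+ k.
  have := pB k; rewrite hp normrZ normrX normfV gtr0_norm //.
  by rewrite exprVn mulrC ler_pdivrMr ?exprn_gt0.
apply/ler_addgt0Pr => e e0.
have BR0 : 0 <= B / (1 - rho) by rewrite divr_ge0 // subr_ge0 ltW.
have [n nE] := scalar_expr_lt rho01 BR0 e0.
pose J := (n + j.+1)%N.
have jJ : (j < J)%N by rewrite leq_addl.
have [w pw] := prim_roots (leq_ltn_trans (leq0n j) jJ).
have w1 := norm_unity_root (prim_order_gt0 pw) (prim_expr_order pw).
rewrite -(root_average_poly x pw jJ hp).
apply: root_average_le => // k; set y := _ *: x.
have y1 : `|y| < 1 by rewrite normrZ normrX w1 expr1n mul1r.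
rewrite -(subrK (h y) (series _ J)) addrC; apply: le_trans (ler_normD _ _) _.
rewrite lerD ?hM // distrC; apply: (@le_trans _ _ (B * rho ^+ J / (1 - rho))).
  apply: series_tail (ph _ y1) _ => // i.
  by rewrite hp normrZ !normrX w1 !expr1n mul1r.
by rewrite mulrAC ltW // nE // leq_addr.
Qed.

(** The limit [t -> 1], made quantitative by Bernoulli's inequality for [t = 1 - d]. *)
Lemma le_of_expr_le (j : nat) (a b : K) : 0 <= a ->
  (forall t, 0 < t -> t < 1 -> t ^+ j * a <= b) -> a <= b.
Proof.
move=> a0 tab; apply/ler_addgt0Pr => e e0.
have k0 : 0 < j%:R * a + 1 by rewrite ltr_wpDl // mulr_ge0.
have [d [d0 d1 d2]] := pos_common_lb (divr_gt0 e0 k0) (divr_gt0 (ltr01 : 0 < 1 :> K) (ltr0n K 2)).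
have t0 : 0 < 1 - d.
  by rewrite subr_gt0; apply: le_lt_trans d2 _; rewrite ltr_pdivrMr // mul1r ltr1n.
have t1 : 1 - d < 1 by rewrite ltrBlDr ltrDl.
have bern (i : nat) : 1 - i%:R * d <= (1 - d) ^+ i.
  elim: i => [|i IH]; first by rewrite mul0r subr0 expr0.
  rewrite exprS; apply: le_trans (ler_wpM2l (ltW t0) IH).
  rewrite -subr_ge0 (_ : _ - _ = i%:R * d ^+ 2); last by rewrite -natr1; ring.
  by rewrite mulr_ge0 // exprn_ge0 // ltW.
have := tab _ t0 t1; move=> /(le_trans (ler_wpM2r a0 (bern j))) jb.
rewrite -lerBlDr; apply: le_trans jb.
rewrite mulrBl mul1r lerD2l lerN2 mulrAC.
apply: (@le_trans _ _ ((j%:R * a + 1) * d)); first by rewrite ler_wpM2r ?(ltW d0) // lerDl.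
by rewrite mulrC -ler_pdivlMr.
Qed.

Lemma homogeneous_le X V (p : X -> V) (j : nat) (M : K) (x : X) :
  (forall a x, p (a *: x) = a ^+ j *: p x) ->
  (forall x, `|x| < 1 -> `|p x| <= M) -> `|p x| <= M * `|x| ^+ j.
Proof.
move=> hp pM; have [->|xn0] := eqVneq x 0.
  have M0 : 0 <= M by apply: le_trans (pM 0 _); rewrite ?normr0.
  case: j hp => [|j] hp; first by rewrite expr0 mulr1 pM ?normr0.
  have -> : p 0 = 0 by have := hp 0 0; rewrite scale0r expr0n scale0r.
  by rewrite !normr0 expr0n mulr0.
have nx0 : 0 < `|x| by rewrite normr_gt0.
apply: (@le_of_expr_le j) => // t t0 t1.
have := pM ((t / `|x|) *: x).
rewrite hp !normrZ normrX normrM normfV normr_id (gtr0_norm t0).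
rewrite divfK ?gt_eqF // => /(_ t1).
by rewrite expr_div_n mulrAC ler_pdivrMr ?exprn_gt0.
Qed.

Lemma series_coef_le X V (p : nat -> X -> V) (h : X -> V) (M : K) (j : nat) (x : X) :
  homogeneous_family p -> (forall x, `|x| < 1 -> series (p ^~ x) @ \oo --> h x) ->
  (forall x, `|x| < 1 -> `|h x| <= M) -> `|p j x| <= M * `|x| ^+ j.
Proof.
move=> hp ph hM; apply: homogeneous_le => [a y|y]; first exact: hp.
exact: series_coef_le_open hp ph hM.
Qed.

End PowerSeries.

(** * Polarization *)


Section Polarization.
Variables (K : scalarFieldType) (X Y : normedModType K).

Lemma big_tuple_cons (T : finType) (V : nmodType) j (G : j.+1.-tuple T -> V) :
  \sum_(t : j.+1.-tuple T) G t =
  \sum_(i : T) \sum_(t : j.-tuple T) G (cons_tuple i t).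
Proof.
rewrite pair_bigA /=.
rewrite (reindex (fun p : T * j.-tuple T => cons_tuple p.1 p.2)) //=.
exists (fun t => (thead t, behead_tuple t)) => [[i t] _|t _] /=.
  by rewrite theadE; congr pair; apply: val_inj.
by rewrite [RHS]tuple_eta; apply: val_inj.
Qed.

Lemma form_linear_sum j (F : seq X -> Y) l n (a : 'I_n -> K) (x : 'I_n -> X) :
  form_linear j F -> (size l).+1 = j ->
  F ((\sum_i a i *: x i) :: l) = \sum_i a i *: F (x i :: l).
Proof.
move=> lF lj; elim/big_rec2: _ => [|i z y _ <-]; first exact: form_linear_00 lF lj.
by rewrite (form_linear0D _ _ lF lj) (form_linear0Z _ _ lF lj).
Qed.

Lemma form_linear_expand j (F : seq X -> Y) n (a : 'I_n -> K) (x : 'I_n -> X) :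
  form_linear j F -> F (nseq j (\sum_i a i *: x i)) =
    \sum_(t : j.-tuple 'I_n) (\prod_(i <- t) a i) *: F [seq x i | i <- t].
Proof.
elim: j F => [|j IH] F lF /=.
  rewrite (big_pred1 [tuple]) => [|t]; last by apply/esym/eqP; exact: tuple0.
  by rewrite big_nil scale1r.
rewrite (form_linear_sum _ _ lF) ?size_nseq // big_tuple_cons; apply: eq_bigr => i _.
rewrite (IH (fun l => F (x i :: l))); last exact: form_linear_cons.
rewrite scaler_sumr; apply: eq_bigr => t _.
by rewrite big_cons scalerA.
Qed.

Lemma form_of_perm j (Phi : ('I_j -> X) -> Y) (x : 'I_j -> X) (t : j.-tuple 'I_j) :
  symmetric_map Phi -> uniq t -> form_of Phi [seq x i | i <- t] = Phi x.
Proof.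
move=> sPhi ut; have inj : injective (tnth t) by apply/tuple_uniqP.
rewrite -[RHS](sPhi (perm inj)); congr (Phi _); apply/funext => i /=.
rewrite permE (tnth_nth i) (nth_map i) // size_tuple; exact: ltn_ord.
Qed.

Let sgn j (s : {ffun 'I_j -> bool}) (i : 'I_j) : K := (-1) ^+ s i.

(** A tuple with a repetition misses some index [i0]; flipping the sign at [i0] changes the sign of
    each summand, so the sum equals its own opposite. *)
Let sign_sum j (t : j.-tuple 'I_j) :
  \sum_(s : {ffun 'I_j -> bool}) (\prod_i sgn s i) * \prod_(i <- t) sgn s i =
  if uniq t then (#|{ffun 'I_j -> bool}|)%:R else 0.
Proof.
case: ifPn => ut.
  have inj : injective (tnth t) by apply/tuple_uniqP.
  rewrite (eq_bigr (fun=> 1)) ?sumr_const // => s _.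
  rewrite big_tuple [X in X * _](reindex_inj inj) -big_split big1 // => i _.
  by rewrite /= -expr2 sqrr_sign.
have [i0 i0t] : exists i0, i0 \notin t.
  apply/existsP; apply: contraNT ut; rewrite negb_exists => /forallP Nt.
  apply: (leq_size_uniq (enum_uniq 'I_j)) => [i _|].
    by have := Nt i; rewrite negbK.
  by rewrite size_tuple size_enum_ord.
pose flip (s : {ffun 'I_j -> bool}) := [ffun i => (i == i0) (+) s i].
have flipK : involutive flip.
  by move=> s; apply/ffunP => i; rewrite !ffunE addbA addbb.
set S := \sum_s _.
suff : S = - S by move=> /eqP; rewrite -addr_eq0 -mulr2n mulrn_eq0 => /eqP.
rewrite {1}/S (reindex_inj (inv_inj flipK)) /S -sumrN; apply: eq_bigr => s _ /=.
rewrite -mulNr; congr (_ * _); last first.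
  apply: eq_big_seq => i it; rewrite /sgn ffunE.
  by have /negbTE -> : i != i0 by apply: contraNneq i0t => <-.
rewrite (bigD1 i0) //= [in RHS](bigD1 i0) //= -mulNr /sgn ffunE eqxx; congr (_ * _).
  by case: (s i0); rewrite /= ?expr0 ?expr1 ?opprK.
by apply: eq_bigr => i /negbTE ii0; rewrite ffunE ii0.
Qed.

(** The coefficients do not depend on [Phi]. Hence the same formula can define a candidate form out
    of a diagonal not yet known to be a polynomial, as is done in [taylor_series]. *)
Lemma polarization j : exists c : {ffun 'I_j -> bool} -> K,
  forall (Phi : ('I_j -> X) -> Y), multilinear Phi -> symmetric_map Phi ->
  forall x, Phi x =
    \sum_(s : {ffun 'I_j -> bool}) c s *: Phi (fun=> \sum_i (-1) ^+ s i *: x i).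
Proof.
(* [N] is [j!] and [kappa] is [2 ^ j j!]; they stay cardinals because only [kappa != 0] matters. *)
pose N := #|[pred t : j.-tuple 'I_j | uniq t]|.
pose kappa : K := #|{ffun 'I_j -> bool}|%:R * N%:R.
have k0 : kappa != 0.
  rewrite mulf_neq0 // pnatr_eq0 -lt0n; apply/card_gt0P.
    by exists [ffun=> true].
  by exists (ord_tuple j); rewrite inE; exact: enum_uniq.
exists (fun s => kappa^-1 * \prod_i sgn s i) => Phi lPhi sPhi x.
have lF := form_of_linear lPhi.
rewrite (eq_bigr (fun s : {ffun 'I_j -> bool} => \sum_(t : j.-tuple 'I_j)
    kappa^-1 *: (((\prod_i sgn s i) * \prod_(i <- t) sgn s i) *:
      form_of Phi [seq x i | i <- t]))); last first.
  move=> s _; rewrite -form_of_nseq (form_linear_expand _ x lF) scaler_sumr.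
  by apply: eq_bigr => t _; rewrite !scalerA mulrA.
rewrite exchange_big /=.
rewrite (eq_bigr (fun t : j.-tuple 'I_j => kappa^-1 *:
    ((if uniq t then #|{ffun 'I_j -> bool}|%:R else 0) *:
      form_of Phi [seq x i | i <- t]))); last first.
  by move=> t _; rewrite -scaler_sumr -scaler_suml sign_sum.
rewrite -scaler_sumr (bigID (fun t : j.-tuple 'I_j => uniq t)) /=.
rewrite [X in _ + X]big1 ?addr0 => [|t /negbTE ->]; last by rewrite scale0r.
rewrite (eq_bigr (fun=> #|{ffun 'I_j -> bool}|%:R *: Phi x)) => [|t ut]; last first.
  by rewrite ut form_of_perm.
by rewrite sumr_const -scaler_nat !scalerA [X in _ * X]mulrC -/N -/kappa mulVf // scale1r.
Qed.

End Polarization.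

(** * Aron-Berner extensions in A_u *)


Section UniformContinuity.
Variables (K : scalarFieldType) (X Y : normedModType K).
Implicit Types f g : X -> Y.

(** The segment from 0 to [x] is cut into [n + 1] pieces shorter than [d], each of which changes [f]
    by less than 1. *)
Lemma uniformly_continuous_bounded f :
  uniformly_continuous_on_ball f -> bounded_on_ball f.
Proof.
move=> /(_ 1 ltr01)[d d0 fd]; have [n /(_ n (leqnn n)) nd] := scalar_invS_lt d0.
exists (`|f 0| + n.+1%:R) => x x1.
pose c : K := n.+1%:R^-1; have c0 : 0 < c by rewrite invr_gt0 ltr0Sn.
have nc : n.+1%:R * c = 1 by rewrite divff // pnatr_eq0.
have small (m : nat) : (m <= n.+1)%N -> `|(m%:R * c) *: x| <= 1.
  move=> mn; rewrite normrZ ger0_norm ?mulr_ge0 ?(ltW c0) // mulr_ile1 ?mulr_ge0 ?(ltW c0) //.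
  by rewrite -[leRHS]nc ler_wpM2r ?(ltW c0) // ler_nat.
have walk (m : nat) : (m <= n.+1)%N -> `|f ((m%:R * c) *: x)| <= `|f 0| + m%:R.
  elim: m => [_|m IH mn]; first by rewrite mul0r scale0r addr0.
  set y := _ *: x; set z := (m%:R * c) *: x in IH.
  rewrite -(subrK (f z) (f y)) addrC; apply: le_trans (ler_normD _ _) _.
  rewrite -natr1 addrA lerD //; first exact: IH (ltnW mn).
  apply: ltW; apply: fd; [exact: small|exact: small (ltnW mn)|].
  rewrite -scalerBl -mulrBl -natr1 addrAC subrr add0r mul1r normrZ gtr0_norm //.
  by apply: le_lt_trans nd; rewrite ler_piMr // ltW.
by have := walk _ (leqnn _); rewrite nc scale1r.
Qed.

Lemma ucont_add f g : uniformly_continuous_on_ball f ->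
  uniformly_continuous_on_ball g ->
  uniformly_continuous_on_ball (fun x => f x + g x).
Proof.
move=> uf ug e e0; have e20 : 0 < e / 2 by rewrite divr_gt0.
have [d1 d10 fd] := uf _ e20; have [d2 d20 gd] := ug _ e20.
have [d [d0 dd1 dd2]] := pos_common_lb d10 d20.
exists d => // x y x1 y1 xy; rewrite opprD addrACA.
apply: le_lt_trans (ler_normD _ _) _.
have -> : e = e / 2 + e / 2 by field.
by rewrite ltrD ?fd ?gd // (lt_le_trans xy).
Qed.

Lemma ucont_limit f (F : nat -> X -> Y) (e : nat -> K) :
  (forall d, 0 < d -> exists n, e n < d) ->
  (forall n, uniformly_continuous_on_ball (F n)) ->
  (forall n x, `|x| <= 1 -> `|f x - F n x| <= e n) ->
  uniformly_continuous_on_ball f.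
Proof.
move=> e0 uF fF d d0; have d30 : 0 < d / 3 by rewrite divr_gt0.
have [n en] := e0 _ d30; have [a a0 Fa] := uF n _ d30.
exists a => // x y x1 y1 xy.
have -> : f x - f y = (f x - F n x) + (F n x - F n y) + (F n y - f y).
  by rewrite !addrA !subrK.
have -> : d = d / 3 + d / 3 + d / 3 by field.
apply: le_lt_trans (ler_normD _ _) _; rewrite ltrD //.
  apply: le_lt_trans (ler_normD _ _) _; rewrite ltrD ?Fa //.
  exact: le_lt_trans (fF n x x1) en.
by rewrite distrC; exact: le_lt_trans (fF n y y1) en.
Qed.

(** Power series represent the functions in the open ball only; this passes bounds, and with [M = 0]
    identities, on to the sphere. *)
Lemma ucont_sphere f x (M : K) : uniformly_continuous_on_ball f -> `|x| <= 1 ->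
  (forall t, 0 < t -> t < 1 -> `|f (t *: x)| <= M) -> `|f x| <= M.
Proof.
move=> uf x1 fM; apply/ler_addgt0Pr => e e0.
have [d d0 fd] := uf _ e0.
have [c [c0 cd c2]] := pos_common_lb d0 (divr_gt0 (ltr01 : 0 < 1 :> K) (ltr0n K 2)).
have [b [b0 bc b2]] := pos_common_lb (divr_gt0 c0 (ltr0n K 2)) c0.
have b1 : b < 1.
  by apply: le_lt_trans b2 (le_lt_trans c2 _); rewrite ltr_pdivrMr // mul1r ltr1n.
have t0 : 0 < 1 - b by rewrite subr_gt0.
have t1 : 1 - b < 1 by rewrite ltrBlDr ltrDl.
rewrite -(subrK (f ((1 - b) *: x)) (f x)) addrC.
apply: le_trans (ler_normD _ _) _; rewrite lerD ?fM //.
apply/ltW/fd => //.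
  by rewrite normrZ gtr0_norm // mulr_ile1 // ltW.
rewrite -{1}[x]scale1r -scalerBl opprB addrC subrK normrZ gtr0_norm //.
apply: (@le_lt_trans _ _ b); first by rewrite ler_piMr // ltW.
apply: le_lt_trans bc (lt_le_trans _ cd).
by rewrite ltr_pdivrMr // ltr_pMr // ltr1n.
Qed.

End UniformContinuity.

(** * Construction of the extension of the sum of a power series *)

Section ExtensionAu.
Variables (K : scalarFieldType) (X Y : normedModType K).

Hypothesis prim_roots : forall n, (0 < n)%N -> exists w : K, n.-primitive_root w.
Hypothesis K_complete : forall u : nat -> K,
  (forall e : K, 0 < e -> exists N : nat, forall n m, (N <= n)%N -> (N <= m)%N ->
    `|u n - u m| <= e) -> exists l : K, u @ \oo --> (l : K^o).

(** Completeness of a dual for a prescribed rate. The limit is taken pointwise; the uniform rate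
    makes it linear and bounded. *)
Lemma dual_limit (E : normedModType K) (T : nat -> dual E) :
  (forall n m, `|T n - T m| <= n.+1%:R^-1 + m.+1%:R^-1) ->
  exists l : dual E, forall n, `|l - T n| <= n.+1%:R^-1.
Proof.
move=> TC; have TCv n m v : `|T n v - T m v| <= (n.+1%:R^-1 + m.+1%:R^-1) * `|v|.
  by rewrite -dual_subE; apply: le_trans (le_dual_normM _ _) _; rewrite ler_wpM2r.
have lim v : exists l : K, (fun n => T n v : K) @ \oo --> (l : K^o).
  apply: K_complete => e e0.
  have k0 : 0 < 2 * (`|v| + 1) by rewrite mulr_gt0 // ltr_wpDl.
  have [N Nn] := scalar_invS_lt (divr_gt0 e0 k0).
  exists N => n m Nln Nlm; apply: le_trans (TCv n m v) _.
  apply: (@le_trans _ _ ((e / (2 * (`|v| + 1)) + e / (2 * (`|v| + 1))) * (`|v| + 1))).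
    rewrite ler_pM ?lerDl ?addr_ge0 ?invr_ge0 //.
    by rewrite lerD // ltW // Nn.
  rewrite le_eqVlt; apply/orP; left; apply/eqP; field.
  by rewrite gt_eqF // ltr_wpDl.
have [l lP] := choice lim.
have lT n v : `|l v - T n v| <= n.+1%:R^-1 * `|v|.
  apply/ler_addgt0Pr => e e0.
  have k0 : 0 < `|v| + 1 by rewrite ltr_wpDl.
  have e20 : 0 < e / 2 by rewrite divr_gt0.
  have [N Nn] := scalar_invS_lt (divr_gt0 e20 k0).
  have /(@cvg_seqP K K^o)/(_ _ e20)[N' Nn'] := lP v.
  pose m := (N + N')%N.
  rewrite -(subrK (T m v) (l v)) -addrA; apply: le_trans (ler_normD _ _) _.
  have -> : n.+1%:R^-1 * `|v| + e = e / 2 + (n.+1%:R^-1 * `|v| + e / 2) by rewrite addrCA -splitr.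
  rewrite lerD ?Nn' ?leq_addl //; apply: le_trans (TCv m n v) _.
  rewrite mulrDl addrC lerD //.
  apply: (@le_trans _ _ (e / 2 / (`|v| + 1) * (`|v| + 1))).
    by rewrite ler_pM ?lerDl ?invr_ge0 // ltW // Nn // leq_addr.
  by rewrite divfK // gt_eqF.
have ll : linear (l : E -> K^o).
  move=> a v w; apply/eqP; rewrite -subr_eq0 -normr_eq0; apply/eqP.
  apply: forall_pos_le0 => // e e0.
  pose k := `|a *: v + w| + (`|a| * `|v| + `|w|) + 1.
  have k0 : 0 < k by rewrite ltr_wpDl // !addr_ge0 // mulr_ge0.
  have [N /(_ N (leqnn N)) Nn] := scalar_invS_lt (divr_gt0 e0 k0).
  have -> : l (a *: v + w) - (a *: (l v : K^o) + l w) =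
    (l (a *: v + w) - T N (a *: v + w)) - (a * (l v - T N v) + (l w - T N w)).
    by rewrite dual_mapD dual_mapZ -[a *: (l v : K^o)]/(a * l v); ring.
  apply: le_trans (ler_normB _ _) _.
  apply: (@le_trans _ _ (N.+1%:R^-1 * k)); last first.
    by rewrite -ler_pdivlMr // ltW.
  apply: (@le_trans _ _ (N.+1%:R^-1 * (`|a *: v + w| + (`|a| * `|v| + `|w|)))); last first.
    by rewrite ler_wpM2l ?invr_ge0 // lerDl.
  rewrite [leRHS]mulrDr lerD //; apply: le_trans (ler_normD _ _) _.
  by rewrite [leRHS]mulrDr lerD // normrM mulrCA ler_wpM2l.
have bl v : `|(l : E -> K^o) v| <= (1 + `|T 0%N|) * `|v|.
  rewrite -(subrK (T 0%N v) (l v)); apply: le_trans (ler_normD _ _) _.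
  rewrite mulrDl lerD ?le_dual_normM //.
  by apply: le_trans (lT 0%N v) _; rewrite invr1.
exists (to_dual (l : E -> K^o)) => n; apply: dual_norm_le; first by rewrite invr_ge0.
by move=> v; rewrite dual_subE (to_dualE ll bl).
Qed.

Lemma AB_homogeneous_ucont j (p : X -> Y) pbar : AB_homogeneous j p pbar ->
  uniformly_continuous_on_ball pbar.
Proof.
move=> /AB_homogeneousP[Phi [[lPhi _ [C C0 bC]] _ pbarE]] e e0.
have lF := form_of_linear lPhi.
have k0 : 0 < j%:R * C + 1 by rewrite ltr_wpDl // mulr_ge0.
exists (e / (j%:R * C + 1)); first by rewrite divr_gt0.
move=> u w u1 w1 uw; apply: (@le_lt_trans _ _ (j%:R * C * `|u - w|)).
  apply: dual_norm_le => [|v]; first by rewrite mulr_ge0 // mulr_ge0.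
  rewrite dual_subE !pbarE !(bidual_extE _ C0 lF bC) ?size_nseq //.
  have := @form_diag_lipschitz K (bidual X) K^o j (`|v| * C)
    (form_ext (fun l => v (form_of Phi l))) w u.
  have -> : j%:R * C * `|u - w| * `|v| = j%:R * (`|v| * C) * `|u - w| by ring.
  have vC0 : 0 <= `|v| * C by rewrite mulr_ge0.
  apply=> //.
  - by apply: form_ext_linear (dual_form_linear v lF) (dual_form_bounded v bC).
  - by apply: form_ext_bounded (dual_form_linear v lF) (dual_form_bounded v bC).
apply: (@le_lt_trans _ _ ((j%:R * C + 1) * `|u - w|)).
  by rewrite ler_wpM2r // lerDl.
by rewrite mulrC -ltr_pdivlMr.
Qed.

Variables (q : X -> Y) (p : nat -> X -> Y) (pbar : nat -> bidual X -> bidual Y).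
Hypotheses (pAB : forall j, AB_homogeneous j (p j) (pbar j))
  (uq : uniformly_continuous_on_ball q)
  (pq : forall x, `|x| < 1 -> series (p ^~ x) @ \oo --> q x).

Let p_hom : homogeneous_family p.
Proof. by move=> j; exact: homogeneous_polyZ (AB_homogeneous_poly (pAB j)). Qed.

Let AB_coef (a : nat -> K) j :
  AB_homogeneous j (fun x => a j *: p j x) (fun u => a j *: pbar j u).
Proof.
have := AB_homogeneous_comb (a j) (pAB j) (AB_homogeneous0 X Y j).
by congr (AB_homogeneous _ _ _); apply/funext => x; rewrite addr0.
Qed.

Let sum_bounded (a : nat -> K) n M u :
  (forall x, `|x| <= 1 -> `|\sum_(0 <= j < n) a j *: p j x| <= M) ->
  `|u| <= 1 -> `|\sum_(0 <= j < n) a j *: pbar j u| <= M.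
Proof.
move=> aM u1; apply: (@AB_sum_bounded K X Y _ (fun j x => a j *: p j x)
  (fun j u => a j *: pbar j u) M) => //.
Qed.

(** Uniform continuity permits replacing [q] by [q (rho x)], whose series converges uniformly on the
    closed ball. The pair [(rho, n)] encodes a polynomial with components [rho ^+ j *: p j], so its
    extension is the same combination of the [pbar j]. *)
Let approx (e : K) : 0 < e -> exists rn : K * nat, forall x, `|x| <= 1 ->
  `|q x - \sum_(0 <= j < rn.2) rn.1 ^+ j *: p j x| <= e.
Proof.
move=> e0; have e20 : 0 < e / 2 by rewrite divr_gt0.
have [M0 qM0] := uniformly_continuous_bounded uq.
have M0_ge0 := bounded_on_ball_ge0 qM0.
have pM0 j x : `|p j x| <= M0 * `|x| ^+ j.
  by apply: series_coef_le pq _ => // z z1; exact: qM0 (ltW z1).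
have [d d0 qd] := uq e20.
have [c [c0 cd c2]] := pos_common_lb (divr_gt0 d0 (ltr0n K 2)) (divr_gt0 (ltr01 : 0 < 1 :> K) (ltr0n K 2)).
have c1 : c < 1 by apply: le_lt_trans c2 _; rewrite ltr_pdivrMr // mul1r ltr1n.
pose rho := 1 - c.
have rho0 : 0 < rho by rewrite subr_gt0.
have rho1 : rho < 1 by rewrite ltrBlDr ltrDl.
have rho01 : 0 <= rho < 1 by rewrite (ltW rho0).
have k0 : 0 <= M0 / (1 - rho) by rewrite divr_ge0 // subr_ge0 ltW.
have [n /(_ n (leqnn n)) nE] := scalar_expr_lt rho01 k0 e20.
exists (rho, n) => x x1 /=.
have rx1 : `|rho *: x| < 1.
  by rewrite normrZ gtr0_norm //; apply: le_lt_trans rho1; rewrite ler_piMr // ltW.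
rewrite -(subrK (q (rho *: x)) (q x)) -addrA; apply: le_trans (ler_normD _ _) _.
have -> : e = e / 2 + e / 2 by field.
rewrite lerD //.
  apply/ltW/qd => //; first exact: ltW.
  rewrite -{1}[x]scale1r -scalerBl opprB addrC subrK normrZ gtr0_norm //.
  apply: (@le_lt_trans _ _ c); first by rewrite ler_piMr // ltW.
  by apply: le_lt_trans cd _; rewrite ltr_pdivrMr // ltr_pMr // ltr1n.
have -> : \sum_(0 <= j < n) rho ^+ j *: p j x = series (p ^~ (rho *: x)) n.
  by rewrite /series /=; apply: eq_bigr => j _; rewrite p_hom.
apply: le_trans (@series_tail _ _ _ _ M0 rho n rho01 (pq rx1) _) _ => [k|].
  apply: le_trans (pM0 k _) _; rewrite ler_wpM2l // lerXn2r ?nnegrE ?(ltW rho0) //.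
  by rewrite normrZ gtr0_norm // ler_piMr // ltW.
by rewrite mulrAC ltW.
Qed.

(** Padding with zero coefficients, so that two sums of different lengths can be subtracted
    termwise. *)
Let cut (V : lmodType K) n N (a : nat -> K) (F : nat -> V) : (n <= N)%N ->
  \sum_(0 <= j < n) a j *: F j = \sum_(0 <= j < N) (a j *+ (j < n)%N) *: F j.
Proof.
move=> nN; rewrite (big_cat_nat (leq0n n) nN) /= [X in _ + X]big_nat_cond.
rewrite [X in _ + X]big1 ?addr0 => [|j /andP[/andP[nj _] _]].
  by apply: eq_big_nat => j /andP[_ jn]; rewrite jn.
by rewrite ltnNge nj scale0r.
Qed.

Let diff_bounded n (a : nat -> K) m (b : nat -> K) M u :
  (forall x, `|x| <= 1 ->
    `|\sum_(0 <= j < n) a j *: p j x - \sum_(0 <= j < m) b j *: p j x| <= M) ->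
  `|u| <= 1 ->
  `|\sum_(0 <= j < n) a j *: pbar j u - \sum_(0 <= j < m) b j *: pbar j u| <= M.
Proof.
pose N := maxn n m; move=> abM u1.
rewrite (cut a _ (leq_maxl n m)) (cut b _ (leq_maxr n m)) -sumrB.
under eq_bigr do rewrite -scalerBl.
apply: (@sum_bounded (fun j => a j *+ (j < n)%N - b j *+ (j < m)%N)) => // x x1.
under eq_bigr do rewrite scalerBl.
by rewrite sumrB -(cut a _ (leq_maxl n m)) -(cut b _ (leq_maxr n m)) abM.
Qed.

(** The limit of the extensions [T n] of the polynomials from [approx]. The Davie-Gamelin bound,
    applied to their differences, carries the rate of convergence from the ball of [X] to that of
    the bidual. *)
Lemma Au_extension : exists qbar : bidual X -> bidual Y,
  [/\ forall u, `|u| < 1 -> series (pbar ^~ u) @ \oo --> qbar u,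
      uniformly_continuous_on_ball qbar &
      forall M, (forall x, `|x| <= 1 -> `|q x| <= M) ->
        forall u, `|u| <= 1 -> `|qbar u| <= M].
Proof.
pose eps (n : nat) : K := n.+1%:R^-1.
have eps0 n : 0 < eps n by rewrite invr_gt0 ltr0Sn.
have [rn rnP] := choice (fun n => approx (eps0 n)).
pose T n u := \sum_(0 <= j < (rn n).2) (rn n).1 ^+ j *: pbar j u.
have TC n m u : `|u| <= 1 -> `|T n u - T m u| <= eps n + eps m.
  move=> u1; apply: diff_bounded u1 => x x1.
  set A := \sum_(_ <= _ < _) _; set B := \sum_(_ <= _ < _) _.
  have -> : A - B = (q x - B) - (q x - A) by rewrite opprB [RHS]addrC addrA subrK.
  by rewrite [leRHS]addrC; apply: le_trans (ler_normB _ _) _; rewrite lerD ?rnP.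
have lim u : exists l : bidual Y, `|u| <= 1 -> forall n, `|l - T n u| <= eps n.
  have [u1|Nu1] := pselect (`|u| <= 1); last by exists 0.
  have [l lT] := dual_limit (fun n m => TC n m u u1).
  by exists l.
have [qbar qbarP] := choice lim.
have eps_small e : 0 < e -> exists n, eps n < e.
  by move=> /scalar_invS_lt[n /(_ n (leqnn n)) ne]; exists n.
have [M0 qM0] := uniformly_continuous_bounded uq.
have M0_ge0 := bounded_on_ball_ge0 qM0.
have pM0 j x : `|p j x| <= M0 * `|x| ^+ j.
  by apply: series_coef_le pq _ => // z z1; exact: qM0 (ltW z1).
exists qbar; split.
- move=> u u1; apply/cvg_seqP => e e0.
  set r : K := `|u| in u1; have r0 : 0 <= r by exact: normr_ge0.
  have r01 : 0 <= r < 1 by rewrite r0 u1.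
  (* With [r ^+ j] absorbed in the coefficients, [T n u] and the partial sum become combinations at
     [u']. Their difference is then estimated on the ball of [X], at the points [r *: x], where the
     series has a tail of order [r ^+ m]. *)
  pose u' := r^-1 *: u.
  have [u'1 uE] : `|u'| <= 1 /\ u = r *: u'.
    rewrite /u' scalerA; have [u0|un0] := eqVneq u 0.
      by rewrite u0 !scaler0 normr0 ler01.
    by rewrite divff ?normr_eq0 // scale1r normfZV.
  have k0 : 0 <= M0 / (1 - r) by rewrite divr_ge0 // subr_ge0 ltW.
  have e20 : 0 < e / 2 by rewrite divr_gt0.
  have e40 : 0 < e / 2 / 2 by rewrite divr_gt0.
  have [N Nn] := scalar_expr_lt r01 k0 e20.
  have [n en] := eps_small _ e40.
  exists N => m Nm; have {Nn}Nm := Nn m Nm.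
  rewrite -(subrK (T n u) (qbar u)) -addrA; apply: le_trans (ler_normD _ _) _.
  apply: (@le_trans _ _ (eps n + (eps n + M0 * r ^+ m / (1 - r)))); last first.
    have -> : e = e / 2 / 2 + (e / 2 / 2 + e / 2) by rewrite addrA -!splitr.
    by rewrite !lerD ?(ltW en) // mulrAC ltW.
  rewrite lerD ?qbarP ?(ltW u1) //.
  have TE : T n u = \sum_(0 <= j < (rn n).2) ((rn n).1 ^+ j * r ^+ j) *: pbar j u'.
    by apply: eq_bigr => j _; rewrite {1}uE (AB_homogeneousZ (pAB j)) scalerA.
  have SE : series (pbar ^~ u) m = \sum_(0 <= j < m) r ^+ j *: pbar j u'.
    by apply: eq_bigr => j _; rewrite {1}uE (AB_homogeneousZ (pAB j)).
  rewrite TE SE; apply: diff_bounded u'1 => x x1.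
  have rx1 : `|r *: x| <= r by rewrite normrZ ger0_norm // ler_piMr.
  have -> : \sum_(0 <= j < (rn n).2) ((rn n).1 ^+ j * r ^+ j) *: p j x =
      \sum_(0 <= j < (rn n).2) (rn n).1 ^+ j *: p j (r *: x).
    by apply: eq_bigr => j _; rewrite p_hom scalerA.
  have -> : \sum_(0 <= j < m) r ^+ j *: p j x = series (p ^~ (r *: x)) m.
    by apply: eq_bigr => j _; rewrite p_hom.
  set A := \sum_(_ <= _ < _) _; set B := series _ _.
  have -> : A - B = (q (r *: x) - B) - (q (r *: x) - A).
    by rewrite opprB [RHS]addrC addrA subrK.
  rewrite [leRHS]addrC; apply: le_trans (ler_normB _ _) _; rewrite lerD //.
    apply: series_tail (pq _) _ => //; first exact: le_lt_trans u1.
    move=> k; apply: le_trans (pM0 k _) _; rewrite ler_wpM2l //.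
    by rewrite lerXn2r // nnegrE.
  by apply: rnP; apply: le_trans rx1 (ltW u1).
- apply: (@ucont_limit _ _ _ qbar T eps) => //; last first.
    by move=> n u u1; exact: qbarP.
  move=> n; rewrite /T; elim: (rn n).2 => [|k IH].
    have -> : (fun u => \sum_(0 <= j < 0) (rn n).1 ^+ j *: pbar j u) = fun=> 0.
      by apply/funext => u; rewrite big_geq.
    by move=> e e0; exists 1 => // x y _ _ _; rewrite subrr normr0.
  have -> : (fun u => \sum_(0 <= j < k.+1) (rn n).1 ^+ j *: pbar j u) =
      fun u => \sum_(0 <= j < k) (rn n).1 ^+ j *: pbar j u + (rn n).1 ^+ k *: pbar k u.
    by apply/funext => u; rewrite big_nat_recr.
  by apply: ucont_add => //; exact: AB_homogeneous_ucont (AB_coef _ k).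
- move=> M qM u u1; apply/ler_addgt0Pr => e e0.
  have [n en] := eps_small _ (divr_gt0 e0 (ltr0n K 2)).
  rewrite -(subrK (T n u) (qbar u)); apply: le_trans (ler_normD _ _) _.
  have -> : M + e = e / 2 + (M + e / 2) by rewrite addrCA -splitr.
  rewrite lerD //; first by apply: le_trans (qbarP _ u1 n) (ltW en).
  apply: (@sum_bounded (fun j => (rn n).1 ^+ j)) => // x x1.
  set A := \sum_(_ <= _ < _) _; rewrite -(subrK (q x) A) addrC.
  apply: le_trans (ler_normD _ _) _; rewrite lerD ?qM // distrC.
  by apply: le_trans (rnP n x x1) (ltW en).
Qed.

End ExtensionAu.

(** * Taylor series in A_u *)


Lemma complete_seq_cvg (K : scalarFieldType) (Y : completeNormedModType K)
    (u : nat -> Y) :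
  (forall e : K, 0 < e -> exists N : nat, forall n m, (N <= n)%N -> (N <= m)%N ->
    `|u n - u m| <= e) -> exists l : Y, u @ \oo --> l.
Proof.
move=> uC; apply/cvg_ex/cauchy_cvgP/cauchy_exP => e e0.
have [N Nn] := uC _ (divr_gt0 e0 (ltr0n K 2)).
exists (u N); exists N => // n /= Nn'; rewrite -ball_normE /=.
apply: le_lt_trans (Nn N n (leqnn N) Nn') _.
by rewrite ltr_pdivrMr // ltr_pMr // ltr1n.
Qed.

Section TaylorSeries.
Variables (K : scalarFieldType) (X : normedModType K) (Y : completeNormedModType K).

Hypothesis prim_roots : forall n, (0 < n)%N -> exists w : K, n.-primitive_root w.

(** What is retained of the scalar density hypothesis: a power series whose sum is uniformly within
    [e] of [h]. *)
Definition approximant (h : X -> K^o) (e : K) (p : nat -> X -> K^o) :=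
  (forall j, homogeneous_poly j (p j)) /\
  exists h' : X -> K^o,
    (forall x, `|x| < 1 -> series (p ^~ x) @ \oo --> h' x) /\
    (forall x, `|x| <= 1 -> `|h x - h' x| <= e).

Variables (L : Type) (g : L -> dual Y).
Hypotheses (g1 : forall a, `|g a| = 1)
  (znorm : forall z : Y, `|z| = supremum 0 (range (fun a => `|g a z| : K))).
Variables (f : X -> Y) (M : K).
Hypotheses (fM : forall x, `|x| <= 1 -> `|f x| <= M)
  (approx : forall a e, 0 < e -> exists p, approximant (fun x => g a (f x)) e p).

Let M0 : 0 <= M. Proof. exact: bounded_on_ball_ge0 fM. Qed.
Let M10 : 0 <= M + 1. Proof. by rewrite addr_ge0. Qed.

Let gz b z : `|g b z| <= `|z|.
Proof. by apply: le_trans (le_dual_normM _ _) _; rewrite g1 mul1r. Qed.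

(** Used to pass algebraic identities from the approximating scalar forms to [Y]; the constant may
    depend on [a]. *)
Let eq0_norming (z : Y) : (forall a, exists2 C : K, 0 <= C &
    forall e, 0 < e -> e <= 1 -> `|g a z| <= C * e) -> z = 0.
Proof.
move=> zC; apply/normr0_eq0/forall_pos_le0 => // e e0.
apply: (norming_le (znorm z)); first exact: ltW.
move=> a; have [C C0 zCe] := zC a.
have k0 : 0 < C + 1 by rewrite ltr_wpDl.
have [d [d0 d1 d2]] := pos_common_lb (divr_gt0 e0 k0) (ltr01 : 0 < 1 :> K).
apply: le_trans (zCe d d0 d2) _.
apply: (@le_trans _ _ ((C + 1) * d)); first by rewrite ler_wpM2r ?(ltW d0) // lerDl.
by rewrite mulrC -ler_pdivlMr.
Qed.

(** Because [e <= 1], the sum of the approximating series is bounded by [M + 1], and so are its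
    coefficients. The tail estimate therefore depends on neither [a] nor [p]. *)
Let approx_tail a e p x J : 0 < e -> e <= 1 ->
  approximant (fun x => g a (f x)) e p -> `|x| < 1 ->
  `|g a (f x) - series (p ^~ x) J| <= e + (M + 1) * `|x| ^+ J / (1 - `|x|).
Proof.
move=> e0 e1 [ph [h' [ph' hh']]] x1.
have hp : homogeneous_family p by move=> j; exact: homogeneous_polyZ.
have h'M y : `|y| < 1 -> `|h' y| <= M + 1.
  move=> y1; rewrite -(subrK (g a (f y)) (h' y)) addrC.
  apply: le_trans (ler_normD _ _) _; rewrite lerD //.
    by apply: le_trans (gz _ _) _; rewrite fM // ltW.
  by rewrite distrC; apply: le_trans (hh' y (ltW y1)) e1.
rewrite -(subrK (h' x) (g a (f x))) -addrA; apply: le_trans (ler_normD _ _) _.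
rewrite lerD ?hh' ?(ltW x1) //; apply: series_tail (ph' x x1) _.
  by rewrite normr_ge0 x1.
by move=> k; apply: series_coef_le ph' h'M.
Qed.

(** The averages [D n] are taken of [f] itself. Tested on [g a] they are within [e + t n] of
    [p j x], and [t n] is independent of [a], [e] and [p]; letting [e] tend to 0 and using the
    norming family shows that they are Cauchy in [Y]. *)
Let coef_open j x : `|x| < 1 -> exists z : Y, forall a e p, 0 < e -> e <= 1 ->
  approximant (fun x => g a (f x)) e p -> `|g a z - p j x| <= e.
Proof.
move=> x1; set r := `|x| in x1 *; have r0 : 0 <= r by exact: normr_ge0.
have r01 : 0 <= r < 1 by rewrite r0 x1.
have [w pw] : exists w : nat -> K, forall J, (0 < J)%N -> J.-primitive_root (w J).
  have /choice[w wP] : forall J, exists w : K, (0 < J)%N -> J.-primitive_root w.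
    by move=> [|J]; [exists 0|have [w pw] := prim_roots (ltn0Sn J); exists w].
  by exists w.
pose D n := root_average (w (n + j.+1)%N) (n + j.+1) j f x.
pose t n := (M + 1) * r ^+ (n + j.+1) / (1 - r).
have DE a e p n : 0 < e -> e <= 1 -> approximant (fun x => g a (f x)) e p ->
    `|g a (D n) - p j x| <= e + t n.
  move=> e0 e1 ap; have [ph _] := ap; set J := (n + j.+1)%N.
  have jJ : (j < J)%N by rewrite leq_addl.
  have pJ := pw J (leq_ltn_trans (leq0n j) jJ).
  have w1 := norm_unity_root (prim_order_gt0 pJ) (prim_expr_order pJ).
  have hp : homogeneous_family p by move=> i; exact: homogeneous_polyZ.
  rewrite root_average_dual -(root_average_poly x pJ jJ hp) -root_averageB.
  apply: root_average_le => // k; set y := _ *: x.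
  have yr : `|y| = r by rewrite normrZ normrX w1 expr1n mul1r.
  by rewrite /t -yr; apply: approx_tail => //; rewrite yr.
have k0 : 0 <= (M + 1) / (1 - r) by rewrite divr_ge0 // subr_ge0 ltW.
have tsmall e : 0 < e -> exists N : nat, forall n, (N <= n)%N -> t n < e.
  move=> e0; have [N Nn] := scalar_expr_lt r01 k0 e0; exists N => n Nn'.
  by rewrite /t mulrAC Nn // (leq_trans Nn') // leq_addr.
have t0 n : 0 <= t n.
  by rewrite /t divr_ge0 ?subr_ge0 ?(ltW x1) // mulr_ge0 // exprn_ge0.
have DC n m : `|D n - D m| <= t n + t m.
  apply: (norming_le (znorm _)); first by rewrite addr_ge0.
  move=> a; apply/ler_addgt0Pr => e e0.
  have [d [d0 de d1]] := pos_common_lb (divr_gt0 e0 (ltr0n K 2)) (ltr01 : 0 < 1 :> K).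
  have [p ap] := approx a d0.
  rewrite dual_mapB.
  have -> : g a (D n) - g a (D m) = (g a (D n) - p j x) - (g a (D m) - p j x).
    by rewrite opprB addrA subrK.
  apply: le_trans (ler_normB _ _) _.
  apply: (@le_trans _ _ ((d + t n) + (d + t m))); first by rewrite lerD // DE.
  by rewrite addrACA addrC lerD2l [leRHS]splitr lerD.
have [z Dz] : exists z : Y, D @ \oo --> z.
  apply: complete_seq_cvg => e e0.
  have [N Nn] := tsmall _ (divr_gt0 e0 (ltr0n K 2)).
  exists N => n m Nn' Nm; apply: le_trans (DC n m) _.
  by rewrite [leRHS]splitr lerD // ltW // Nn.
exists z => a e p e0 e1 ap; apply/ler_addgt0Pr => d d0.
have d20 := divr_gt0 d0 (ltr0n K 2).
have [N Nn] := tsmall _ d20.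
move/cvg_seqP: Dz => /(_ _ d20)[N' Nn'].
pose n := (N + N')%N.
have -> : g a z - p j x = g a (z - D n) + (g a (D n) - p j x).
  by rewrite dual_mapB addrA subrK.
apply: le_trans (ler_normD _ _) _.
apply: (@le_trans _ _ (d / 2 + (e + t n))).
  by rewrite lerD ?DE // (le_trans (gz _ _)) // Nn' // leq_addl.
by rewrite addrCA lerD2l [leRHS]splitr lerD2l ltW // Nn // leq_addr.
Qed.

(** Homogeneity reaches the points outside the ball. Scaling by [1 + |x|] brings every [x],
    including 0, strictly inside. *)
Let coef j x : exists z : Y, forall a e p, 0 < e -> e <= 1 ->
  approximant (fun x => g a (f x)) e p -> `|g a z - p j x| <= (1 + `|x|) ^+ j * e.
Proof.
pose s := 1 + `|x|; have s0 : 0 < s by rewrite ltr_pwDl.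
have [z zP] : exists z : Y, forall a e p, 0 < e -> e <= 1 ->
    approximant (fun x => g a (f x)) e p -> `|g a z - p j (s^-1 *: x)| <= e.
  apply: coef_open; rewrite normrZ normfV gtr0_norm // mulrC ltr_pdivrMr // mul1r.
  by rewrite ltrDr.
exists (s ^+ j *: z) => a e p e0 e1 ap.
have [ph _] := ap.
have -> : p j x = s ^+ j * p j (s^-1 *: x).
  rewrite (homogeneous_polyZ (ph j)) exprVn -[_ *: _]/(_ * _).
  by rewrite mulVKf // expf_neq0 // gt_eqF.
rewrite dual_mapZ -mulrBr normrM normrX gtr0_norm // ler_wpM2l ?exprn_ge0 ?(ltW s0) //.
exact: zP.
Qed.

(** The [P j] are chosen point by point and carry no algebraic structure at first. All they satisfy
    is closeness, under each [g a], to a scalar polynomial, with an error proportional to [e]; each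
    identity is recovered by letting [e] tend to 0. *)
Lemma taylor_series : exists P : nat -> X -> Y,
  (forall j, homogeneous_poly j (P j)) /\
  forall x, `|x| < 1 -> series (P ^~ x) @ \oo --> f x.
Proof.
have [P PP] : exists P : nat -> X -> Y, forall j x a e p, 0 < e -> e <= 1 ->
    approximant (fun x => g a (f x)) e p ->
    `|g a (P j x) - p j x| <= (1 + `|x|) ^+ j * e.
  have [P PP] := choice (fun jx : nat * X => coef jx.1 jx.2).
  by exists (fun j x => P (j, x)) => j x; exact: (PP (j, x)).
exists P; split; last first.
  move=> x x1; set r := `|x| in x1 *; have r0 : 0 <= r by exact: normr_ge0.
  have r01 : 0 <= r < 1 by rewrite r0 x1.
  have k0 : 0 <= (M + 1) / (1 - r) by rewrite divr_ge0 // subr_ge0 ltW.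
  apply/cvg_seqP => e e0; have [N Nn] := scalar_expr_lt r01 k0 e0.
  exists N => n Nn'; apply: le_trans (ltW (Nn n Nn')).
  rewrite mulrAC; apply: (norming_le (znorm _)).
    by rewrite divr_ge0 ?subr_ge0 ?(ltW x1) // mulr_ge0 // exprn_ge0.
  move=> a; apply/ler_addgt0Pr => d d0.
  pose C := 1 + \sum_(0 <= j < n) (1 + r) ^+ j.
  have S0 : 0 <= \sum_(0 <= j < n) (1 + r) ^+ j.
    by rewrite sumr_ge0 // => j _; rewrite exprn_ge0 // addr_ge0.
  have C0 : 0 < C by rewrite ltr_pwDl.
  have [c [c0 cd c1]] := pos_common_lb (divr_gt0 d0 C0) (ltr01 : 0 < 1 :> K).
  have [p ap] := approx a c0.
  have -> : g a (f x - series (P ^~ x) n) = (g a (f x) - series (p ^~ x) n) -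
      \sum_(0 <= j < n) (g a (P j x) - p j x).
    by rewrite sumrB opprB addrA subrK dual_mapB dual_map_sum.
  apply: le_trans (ler_normB _ _) _.
  apply: (@le_trans _ _ ((c + (M + 1) * r ^+ n / (1 - r)) +
      (\sum_(0 <= j < n) (1 + r) ^+ j) * c)).
    rewrite lerD //; first exact: approx_tail.
    apply: le_trans (ler_norm_sum _ _ _) _; rewrite mulr_suml.
    by apply: ler_sum => j _; apply: PP.
  rewrite addrAC addrC lerD2l -[X in X + _]mul1r -mulrDl mulrC -ler_pdivlMr //.
move=> j.
have [c cP] := @polarization K X K^o j.
pose node (s : {ffun 'I_j -> bool}) (x : 'I_j -> X) : X := \sum_i (-1) ^+ s i *: x i.
(* The polarization formula read as a definition. For each approximating form [Psi] it is an
   identity with the same coefficients, so [g a (Phi x)] is within [B x * e] of [Psi x]. *)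
pose Phi (x : 'I_j -> X) : Y := \sum_(s : {ffun 'I_j -> bool}) c s *: P j (node s x).
pose B (x : 'I_j -> X) : K := \sum_(s : {ffun 'I_j -> bool}) `|c s| * (1 + `|node s x|) ^+ j.
have B0 x : 0 <= B x.
  by rewrite sumr_ge0 // => s _; rewrite mulr_ge0 // exprn_ge0 // addr_ge0.
have PhiP a (e : K) : 0 < e -> e <= 1 -> exists Psi : ('I_j -> X) -> K^o,
    [/\ multilinear Psi, symmetric_map Psi,
        forall x, `|g a (Phi x) - Psi x| <= B x * e &
        forall x, `|g a (P j x) - Psi (fun=> x)| <= (1 + `|x|) ^+ j * e].
  move=> e0 e1; have [p ap] := approx a e0; have [ph _] := ap.
  have /homogeneous_polyP[Psi [lPsi sPsi _] pE] := ph j.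
  exists Psi; split=> // x; last by rewrite -pE; exact: PP.
  rewrite (cP Psi lPsi sPsi) /Phi dual_map_sum -sumrB mulr_suml.
  apply: le_trans (ler_norm_sum _ _ _) _; apply: ler_sum => s _.
  rewrite dual_mapZ -[_ *: Psi _]/(_ * Psi _) -mulrBr normrM -mulrA ler_wpM2l //.
  by rewrite -pE; exact: PP.
have PE x : P j x = Phi (fun=> x).
  apply/eqP; rewrite -subr_eq0; apply/eqP/eq0_norming => a.
  exists ((1 + `|x|) ^+ j + B (fun=> x)).
    by rewrite addr_ge0 // exprn_ge0 // addr_ge0.
  move=> e e0 e1; have [Psi [_ _ h1 h2]] := PhiP a e e0 e1.
  have -> : g a (P j x - Phi (fun=> x)) =
      (g a (P j x) - Psi (fun=> x)) - (g a (Phi (fun=> x)) - Psi (fun=> x)).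
    by rewrite dual_mapB opprB addrA subrK.
  by apply: le_trans (ler_normB _ _) _; rewrite mulrDl lerD.
have lPhi : multilinear Phi.
  move=> x i b u v; apply/eqP; rewrite -subr_eq0; apply/eqP/eq0_norming => a.
  set y1 := dfwith _ _ _; set y2 := dfwith _ _ u; set y3 := dfwith _ _ v.
  exists (B y1 + (`|b| * B y2 + B y3)); first by rewrite !addr_ge0 // mulr_ge0.
  move=> e e0 e1; have [Psi [lPsi _ h1 _]] := PhiP a e e0 e1.
  have -> : g a (Phi y1 - (b *: Phi y2 + Phi y3)) = (g a (Phi y1) - Psi y1) -
     (b * (g a (Phi y2) - Psi y2) + (g a (Phi y3) - Psi y3)).
    rewrite dual_mapB dual_mapD dual_mapZ.
    have -> : Psi y1 = b * Psi y2 + Psi y3 by exact: lPsi.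
    ring.
  apply: le_trans (ler_normB _ _) _; rewrite [leRHS]mulrDl lerD //.
  apply: le_trans (ler_normD _ _) _; rewrite [leRHS]mulrDl lerD //.
  by rewrite normrM -mulrA ler_wpM2l.
have sPhi : symmetric_map Phi.
  move=> s x; apply/eqP; rewrite -subr_eq0; apply/eqP/eq0_norming => a.
  exists (B (x \o s) + B x); first by rewrite addr_ge0.
  move=> e e0 e1; have [Psi [_ sPsi h1 _]] := PhiP a e e0 e1.
  have -> : g a (Phi (x \o s) - Phi x) =
      (g a (Phi (x \o s)) - Psi (x \o s)) - (g a (Phi x) - Psi x).
    by rewrite sPsi dual_mapB opprB addrA subrK.
  by apply: le_trans (ler_normB _ _) _; rewrite mulrDl lerD.
apply/homogeneous_polyP; exists Phi => //; split=> //.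
have PB x : `|P j x| <= (M + 1) * `|x| ^+ j.
  apply: (norming_le (znorm _)); first by rewrite mulr_ge0 // exprn_ge0.
  move=> a; apply/ler_addgt0Pr => d d0.
  have C0 : 0 < (1 + `|x|) ^+ j by rewrite exprn_gt0 // ltr_pwDl.
  have [e [e0 ed e1]] := pos_common_lb (divr_gt0 d0 C0) (ltr01 : 0 < 1 :> K).
  have [p ap] := approx a e0; have [ph [h' [ph' hh']]] := ap.
  rewrite -(subrK (p j x) (g a (P j x))) addrC; apply: le_trans (ler_normD _ _) _.
  rewrite lerD //; last first.
    by apply: le_trans (PP j x a e p e0 e1 ap) _; rewrite mulrC -ler_pdivlMr.
  apply: series_coef_le ph' _ => //; first by move=> i; exact: homogeneous_polyZ.
  move=> y y1; rewrite -(subrK (g a (f y)) (h' y)) addrC.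
  apply: le_trans (ler_normD _ _) _; rewrite lerD //.
    by apply: le_trans (gz _ _) _; rewrite fM // ltW.
  by rewrite distrC; apply: le_trans (hh' y (ltW y1)) e1.
(* If the entries have norm at most 1, every polarization node has norm at most [j]. *)
pose C : K := \sum_(s : {ffun 'I_j -> bool}) `|c s| * ((M + 1) * j%:R ^+ j).
have C0 : 0 <= C.
  by rewrite sumr_ge0 // => s _; rewrite !mulr_ge0 // exprn_ge0.
exists C => //; apply: form_bounded_ball; first exact: form_of_linear.
move=> l lj l1; apply: le_trans (ler_norm_sum _ _ _) _; apply: ler_sum => s _.
rewrite normrZ ler_wpM2l //; apply: le_trans (PB _) _; rewrite ler_wpM2l //.
rewrite lerXn2r ?nnegrE //; apply: le_trans (ler_norm_sum _ _ _) _.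
have -> : j%:R = \sum_(i < j) (1 : K) by rewrite sumr_const card_ord.
apply: ler_sum => i _; rewrite normrZ normrX normrN1 expr1n mul1r.
by rewrite l1 // mem_nth // lj.
Qed.

End TaylorSeries.


(** ['X^n - 1] splits and is separable, so it has [n] distinct roots, and a finite group of roots of
    unity in a field is cyclic. *)
Lemma complex_prim_root (R : realType) n : (0 < n)%N ->
  exists w : R[i], n.-primitive_root w.
Proof.
pose p : {poly R[i]} := 'X^n - 1; have [r Dp] := closed_field_poly_normal p.
move=> n_gt0; rewrite (monicP _) ?monicXnsubC // scale1r in Dp.
have rn1 : all n.-unity_root r by apply/allP => z; rewrite -root_prod_XsubC -Dp.
have sz_r : (n < (size r).+1)%N.
  by rewrite -(size_prod_XsubC r id) -Dp size_XnsubC.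
have [|z] := hasP (has_prim_root n_gt0 rn1 _ sz_r); last by exists z.
by rewrite -separable_prod_XsubC -Dp separable_Xn_sub_1 // pnatr_eq0 -lt0n.
Qed.

Lemma ucont_dual (K : scalarFieldType) (X Z : normedModType K) (f : X -> Z) (phi : dual Z) :
  uniformly_continuous_on_ball f ->
  @uniformly_continuous_on_ball K X K^o (fun x => phi (f x)).
Proof.
move=> uf e e0; have k0 : 0 < `|phi| + 1 by rewrite ltr_wpDl.
have [d d0 fd] := uf _ (divr_gt0 e0 k0).
exists d => // x y x1 y1 xy; rewrite -dual_mapB.
apply: le_lt_trans (le_dual_normM _ _) _.
apply: (@le_lt_trans _ _ ((`|phi| + 1) * `|f x - f y|)).
  by rewrite ler_wpM2r // lerDl.
by rewrite mulrC -ltr_pdivlMr // fd.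
Qed.

(** * The transfer for A_u *)

Section AuTransfer.
Variables (K : scalarFieldType) (X : normedModType K) (Y : completeNormedModType K).

Hypothesis prim_roots : forall n, (0 < n)%N -> exists w : K, n.-primitive_root w.

(* The scalars embed isometrically, up to a factor, in a nonzero Banach space. *)
Lemma scalar_complete (y : Y) (phi : dual Y) : phi y = 1 -> forall u : nat -> K,
  (forall e : K, 0 < e -> exists N : nat, forall n m, (N <= n)%N -> (N <= m)%N ->
    `|u n - u m| <= e) -> exists l : K, u @ \oo --> (l : K^o).
Proof.
move=> y1 u uC.
have [z /cvg_seqP uz] : exists z : Y, (fun n => u n *: y) @ \oo --> z.
  apply: complete_seq_cvg => e e0.
  have k0 : 0 < `|y| + 1 by rewrite ltr_wpDl.
  have [N Nn] := uC _ (divr_gt0 e0 k0).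
  exists N => n m Nn' Nm; rewrite -scalerBl normrZ.
  apply: (@le_trans _ _ (e / (`|y| + 1) * (`|y| + 1))).
    by rewrite ler_pM // ?Nn // lerDl.
  by rewrite divfK // gt_eqF.
exists (phi z); apply/(@cvg_seqP K K^o) => e e0.
have k0 : 0 < `|phi| + 1 by rewrite ltr_wpDl.
have [N Nn] := uz _ (divr_gt0 e0 k0).
exists N => n /Nn uzn.
have -> : phi z - u n = phi (z - u n *: y) by rewrite dual_mapB dual_mapZ y1 mulr1.
apply: le_trans (le_dual_normM _ _) _.
apply: (@le_trans _ _ ((`|phi| + 1) * (e / (`|phi| + 1)))).
  by rewrite ler_pM // lerDl.
by rewrite mulrC divfK // gt_eqF.
Qed.

Lemma ucont_scale (f : X -> K^o) (z : Y) :
  uniformly_continuous_on_ball f -> uniformly_continuous_on_ball (fun x => f x *: z).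
Proof.
move=> uf e e0; have k0 : 0 < `|z| + 1 by rewrite ltr_wpDl.
have [d d0 fd] := uf _ (divr_gt0 e0 k0).
exists d => // x y x1 y1 xy; rewrite -scalerBl normrZ.
apply: (@le_lt_trans _ _ (`|f x - f y| * (`|z| + 1))).
  by rewrite ler_wpM2l // lerDl.
by rewrite -ltr_pdivlMr // fd.
Qed.

Lemma Au_dual (f : X -> Y) (phi : dual Y) : Au f -> @Au K X K^o (fun x => phi (f x)).
Proof.
move=> [uf df]; split; first exact: ucont_dual.
move=> x x1; apply: (@differentiable_comp _ _ _ _ f (phi : Y -> K^o)); first exact: df.
by apply: (@linear_differentiable _ _ K^o phi); exact: dual_continuous.
Qed.

Lemma Au_perturb (f : X -> Y) (p : X -> K^o) (y : Y) (phi : dual Y) (c : K) :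
  Au f -> Au p -> Au (fun x => f x + (c * p x - phi (f x)) *: y).
Proof.
move=> Af Ap; have [uf df] := Af; have [up dp] := Ap.
have [uh dh] := Au_dual phi Af; split.
  apply: ucont_add => //; apply: ucont_scale.
  have -> : (fun x => c * p x - phi (f x)) =
      fun x => c *: p x + (- phi (f x)) :> K^o by [].
  apply: (@ucont_add K X K^o); last first.
    move=> e e0; have [d d0 hd] := uh e e0; exists d => // x z x1 z1 xz.
    by rewrite -opprD normrN; exact: hd.
  have := @ucont_dual K X K^o p (c *: id_dual K) up.
  by congr (uniformly_continuous_on_ball _); apply/funext => x; rewrite dual_scaleE id_dualE.
move=> x x1; apply: (@differentiableD _ _ _ f); first exact: df.
apply: (@differentiableZl _ X Y); apply: (@differentiableB _ X K^o).
  by apply: (@differentiableZ _ X K^o); exact: dp.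
exact: dh.
Qed.

Lemma AB_Au_evaluation (Z : normedModType K) (p : X -> Z) pbar x : AB_Au p pbar -> `|x| < 1 ->
  pbar (evaluation x) = evaluation (p x).
Proof.
move=> [r [rbar [rAB pr prbar _]]] x1.
have ex1 : `|evaluation x| < 1 by apply: le_lt_trans (le_norm_evaluation x) x1.
apply: (@cvg_unique _ (@norm_hausdorff _ (bidual Z)) _ _ _ _ (prbar _ ex1)).
apply/cvg_seqP => e e0; have /cvg_seqP/(_ e e0)[N Nn] := pr x x1.
exists N => n /Nn; apply: le_trans.
have -> : evaluation (p x) - series (rbar ^~ (evaluation x)) n =
    evaluation (p x - series (r ^~ x) n).
  apply: dual_ext => v; rewrite dual_subE !evaluationE dual_mapB; congr (_ - _).
  rewrite /series /= dual_map_sum dual_sumE; apply: eq_bigr => j _.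
  by rewrite (AB_homogeneous_evaluation _ (rAB j)).
exact: le_norm_evaluation.
Qed.

Lemma Au_le_extension (p : X -> K^o) pbar x : Au p -> AB_Au p pbar -> `|x| <= 1 ->
  `|p x| <= sup_norm pbar.
Proof.
move=> [up _] pAB x1; have [r [rbar [_ _ _ ubar]]] := pAB.
have bbar := uniformly_continuous_bounded ubar.
apply: (ucont_sphere up x1) => t t0 t1.
have tx1 : `|t *: x| < 1.
  by rewrite normrZ gtr0_norm //; apply: le_lt_trans t1; rewrite ler_piMr // ltW.
have := sup_norm_ge bbar (le_trans (le_norm_evaluation (t *: x)) (ltW tx1)).
by rewrite (AB_Au_evaluation pAB tx1) norm_bidual_scalar evaluationE id_dualE.
Qed.

(** The scalar hypothesis serves twice: in the general transfer, and once more for every [g a]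
    composed with [f], where it supplies the approximants from which the Taylor series of [f] is
    built. *)
Lemma lindenstrauss_Au_transfer : property_beta Y ->
  lindenstrauss_Au X K^o -> lindenstrauss_Au X Y.
Proof.
move=> bY LK; have [L [b [g [bg1 _ znorm]]]] := bY.
have g1 a : `|g a| = 1 by have [] := bg1 a.
apply: (lindenstrauss_transfer bY) (LK) => //.
- by move=> p [up _]; exact: uniformly_continuous_bounded.
- by move=> p [up _]; exact: uniformly_continuous_bounded.
- by move=> f phi; exact: Au_dual.
- split; first by move=> e e0; exists 1 => // x y _ _ _; rewrite subrr normr0.
  by move=> x _; exact: differentiable_cst.
- have c0 (V W : normedModType K) (x : V) : series ((fun _ _ => 0 : W) ^~ x) @ \oo --> (0 : W).
    apply/cvg_seqP => e e0; exists 0%N => n _.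
    by rewrite /series /= big1 // subrr normr0 ltW.
  exists (fun _ _ => 0), (fun _ _ => 0); split.
  + by move=> j; exact: AB_homogeneous0.
  + by move=> x _; exact: (c0 X Y x).
  + by move=> x _; exact: (c0 (bidual X) (bidual Y) x).
  + by move=> e e0; exists 1 => // x y _ _ _; rewrite subrr normr0.
- by move=> p pbar Ap pAB x; exact: Au_le_extension.
move=> f p pbar y phi c Af Ap pAB y1 Q.
(* Since [phi y = 1], the space [Y] is nonzero and hands its completeness down to the scalars. *)
have K_complete := scalar_complete y1.
have [uf _] := Af.
have [M fM] := uniformly_continuous_bounded uf.
have approx a (e : K) : 0 < e -> exists q, approximant (fun x => g a (f x)) e q.
  move=> e0; have Ah := Au_dual (g a) Af.
  have [h [Ah' [hbar [q [qbar [qAB qh _ _]]] _] hh]] := LK _ Ah e e0.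
  exists q; split; first by move=> j; exact: AB_homogeneous_poly (qAB j).
  exists h; split=> // x x1; apply: le_trans (ltW hh).
  apply: (@sup_norm_ge K X K^o ((fun x => g a (f x)) - h)) => //.
  have [M1 hM1] := uniformly_continuous_bounded Ah.1.
  have [M2 hM2] := uniformly_continuous_bounded Ah'.1.
  exists (M1 + M2) => z z1; apply: le_trans (ler_normB _ _) _.
  by rewrite lerD ?hM1 ?hM2.
have [P [Ph Pf]] := taylor_series prim_roots g1 znorm fM approx.
have [r [rbar [rAB pr prbar upbar]]] := pAB.
have [Pbar PP] : exists Pbar : nat -> bidual X -> bidual Y, forall j,
    AB_homogeneous j (fun x => P j x + (c * r j x - phi (P j x)) *: y) (Pbar j) /\
    forall u, Pbar j u phi = c * rbar j u (id_dual K).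
  have ex j : exists Pbar,
      AB_homogeneous j (fun x => P j x + (c * r j x - phi (P j x)) *: y) Pbar /\
      forall u, Pbar u phi = c * rbar j u (id_dual K).
    have [Pbar PAB PbarE] := AB_homogeneous_perturb c (Ph j) (rAB j) y1.
    by exists Pbar.
  by have [Pbar PP] := choice ex; exists Pbar.
have AQ : Au Q := Au_perturb y phi c Af Ap.
pose Qj j x : Y := P j x + (c * r j x - phi (P j x)) *: y.
have QS x : `|x| < 1 -> series (Qj ^~ x) @ \oo --> Q x.
  move=> x1.
  have -> : series (Qj ^~ x) = fun n => series (P ^~ x) n +
      (c * series (r ^~ x) n - phi (series (P ^~ x) n)) *: y.
    apply/funext => n; rewrite /series /= big_split /= -scaler_suml; congr (_ + _ *: _).
    by rewrite sumrB -mulr_sumr dual_map_sum.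
  apply: cvgD; first exact: Pf.
  apply: cvgZr_tmp; apply: (@cvgB _ K^o).
    by apply: (@cvgZl_tmp _ K^o); exact: pr.
  by apply: (cvg_comp _ _ (Pf x x1)); exact: dual_continuous.
have [Qbar [QbarS uQbar Qbarle]] := Au_extension prim_roots K_complete
  (fun j => (PP j).1) AQ.1 QS.
split=> //; exists Qbar; split=> //.
  exists Qj, Pbar; split=> // j; exact: (PP j).1.
(* Both sides are limits of the same series in the open ball; uniform continuity of the difference
   settles the sphere. *)
move=> u u1; apply/eqP; rewrite -subr_eq0 -normr_le0.
have uD : @uniformly_continuous_on_ball K (bidual X) K^o
    (fun u => Qbar u phi + - c * pbar u (id_dual K)).
  apply: ucont_add; first exact: (ucont_dual (evaluation phi) uQbar).
  exact: (ucont_dual (- c *: evaluation (id_dual K)) upbar).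
rewrite -mulNr; apply: (ucont_sphere uD u1) => t t0 t1.
have tu1 : `|t *: u| < 1.
  by rewrite normrZ gtr0_norm //; apply: le_lt_trans t1; rewrite ler_piMr // ltW.
have dual_cvg (V : normedModType K) (v : nat -> V) (l : V) (psi : dual V) :
    v @ \oo --> l -> (fun n => psi (v n)) @ \oo --> psi l.
  by move=> vl; apply: (cvg_comp _ _ vl); exact: dual_continuous.
suff -> : Qbar (t *: u) phi = c * pbar (t *: u) (id_dual K).
  by rewrite mulNr subrr normr0.
have Q1 := dual_cvg _ _ _ (evaluation phi) (QbarS _ tu1).
have p1 := dual_cvg _ _ _ (c *: evaluation (id_dual K)) (prbar _ tu1).
apply: (cvg_unique (@norm_hausdorff K K^o) Q1).
have E : (fun n => (c *: evaluation (id_dual K)) (series (rbar ^~ (t *: u)) n)) =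
    fun n => evaluation phi (series (Pbar ^~ (t *: u)) n).
  apply/funext => n.
  rewrite dual_scaleE !evaluationE /series /= !dual_sumE mulr_sumr.
  by apply: eq_bigr => j _; rewrite (PP j).2.
by rewrite E in p1.
Qed.

End AuTransfer.

Theorem proposition3p5 (R : realType) :
  (forall X Y : completeNormedModType R, property_beta Y ->
     (forall N : nat, lindenstrauss_homogeneous X R^o N ->
        lindenstrauss_homogeneous X Y N) /\
     (forall k : nat, lindenstrauss_poly X R^o k -> lindenstrauss_poly X Y k))
  /\
  (forall X Y : completeNormedModType R[i], property_beta Y ->
     [/\ forall N : nat, lindenstrauss_homogeneous X R[i]^o N ->
           lindenstrauss_homogeneous X Y N,
         forall k : nat, lindenstrauss_poly X R[i]^o k ->
           lindenstrauss_poly X Y k &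
         lindenstrauss_Au X R[i]^o -> lindenstrauss_Au X Y]).
Proof.
split=> X Y bY; first split.
- by move=> N; exact: lindenstrauss_homogeneous_transfer.
- by move=> k; exact: lindenstrauss_poly_transfer.
split.
- by move=> N; exact: lindenstrauss_homogeneous_transfer.
- by move=> k; exact: lindenstrauss_poly_transfer.
- exact: (lindenstrauss_Au_transfer (@complex_prim_root R) bY).
Qed.
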